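(* Let $0<\alpha<n$, let $1\le r<p<n/\alpha$, and let $\frac1q=\frac1p-\frac{\alpha}{n}$. Suppose $K_\alpha\in S_{\alpha,r'}\cap H_{\alpha,r'}$, where $r'$ is the conjugate exponent of $r$, and let $T_\alpha f(x)=\int_{\mathbb{R}^n}K_\alpha(x-y)f(y)\,dy$. Then there is a constant $c>0$, independent of $f$ and $w$, such that for every weight $w$ with $w^r\in A_{\frac pr,\frac qr}$ and every $f\in L^\infty_c(\mathbb{R}^n)$, $$\|T_{\alpha}f\|_{L^q(w^q)}\le c\,[w^r]_{A_{\frac{p}{r},\frac{q}{r}}}^{\max\left\{1-\frac{\alpha}{n},\ \frac{(p/r)'}{q}\left(1-\frac{\alpha r}{n}\right)\right\}}\|f\|_{L^p(w^p)}.$$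
   Context: Work on $\mathbb{R}^n$ with Lebesgue measure; $L^\infty_c(\mathbb{R}^n)$ denotes the bounded functions with compact support. For $1\le s\le\infty$, $s'$ is the conjugate exponent ($\frac1s+\frac1{s'}=1$, with $1'=\infty$). Averages: for a ball (or cube) $B$ and $1\le s<\infty$, $\|f\|_{s,B}=\left(\frac1{|B|}\int_B|f|^s\right)^{1/s}$; for $s=\infty$ it is the essential supremum of $|f|$ on $B$. The notation $|x|\sim t$ means $t<|x|\le 2t$, and $\|f\|_{s,|x|\sim t}=\|f\chi_{\{|x|\sim t\}}\|_{s,B(0,2t)}$. Fractional size condition: for $0<\alpha<n$ and $1\le s\le\infty$, a measurable function $g$ defined away from $0$ belongs to $S_{\alpha,s}$ if there is $C>0$ such that $\|g\|_{s,|x|\sim t}\le C t^{\alpha-n}$ for all $t>0$. $L^{\alpha,s}$-Hörmander condition: $h\in H_{\alpha,s}$ if there exist $c_s>1$ and $C_s>0$ such that for all $x$ and all $R>c_s|x|$, $$\sum_{m=1}^\infty(2^mR)^{n-\alpha}\|h(\cdot-x)-h(\cdot)\|_{s,|y|\sim2^mR}\le C_s .$$ Weights: a weight is a non-negative locally integrable function. $L^p(w^p)$ is the $L^p$ space with respect to $w^p\,dx$. For $1<a<b<\infty$, $v\in A_{a,b}$ if $$[v]_{A_{a,b}}:=\sup_Q\left(\frac1{|Q|}\int_Qv^b\right)\left(\frac1{|Q|}\int_Qv^{-a'}\right)^{b/a'}<\infty,$$ the supremum being over all cubes $Q\subset\mathbb{R}^n$. *)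

(* Defs.v *)
From HB Require Import structures.
From mathcomp Require Import all_boot all_order all_algebra.
From mathcomp Require Import all_classical all_reals all_analysis.
From mathcomp Require Import ess_sup_inf measurable_realfun.

Set Implicit Arguments.
Unset Strict Implicit.
Unset Printing Implicit Defensive.

Import Order.TTheory GRing.Theory Num.Theory.
Import numFieldNormedType.Exports.

Local Open Scope classical_set_scope.
Local Open Scope ring_scope.

(* 'rV[R]_n carries the sigma-algebra generated by the coordinates, that is
   the Borel sigma-algebra of R^n. *)

Definition rV_display : measure_display.
Proof. exact: default_measure_display. Qed.

Definition rV_coord (R : realType) n (i : 'I_n) (x : 'rV[R]_n) :
  measurableTypeR R := x ord0 i.

Section rV_measurable.
Variables (R : realType) (n : nat).

Let rV_measurable := g_sigma_preimage (@rV_coord R n).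

Let rV_set0 : rV_measurable set0. Proof. exact: sigma_algebra0. Qed.

Let rV_setC A : rV_measurable A -> rV_measurable (~` A).
Proof. exact: sigma_algebraC. Qed.

Let rV_bigcup (F : (set 'rV[R]_n)^nat) :
  (forall i, rV_measurable (F i)) -> rV_measurable (\bigcup_i (F i)).
Proof. exact: sigma_algebra_bigcup. Qed.

HB.instance Definition _ := @isMeasurable.Build rV_display
  'rV[R]_n rV_measurable rV_set0 rV_setC rV_bigcup.

End rV_measurable.

Lemma measurable_rV_coord (R : realType) n (i : 'I_n) :
  measurable_fun [set: 'rV[R]_n] (rV_coord i).
Proof.
move=> _ Y mY; rewrite setTI; apply: sub_sigma_algebra => /=.
rewrite -bigcup_seq/=; exists i => /=; first by rewrite mem_index_enum.
by exists Y => //; rewrite setTI.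
Qed.

Lemma measurable_fun_rVP d (T : measurableType d) (R : realType) n
    (f : T -> 'rV[R]_n) :
  (forall i, measurable_fun [set: T] (rV_coord i \o f)) ->
  measurable_fun [set: T] f.
Proof.
move=> mf _ A; move: A; apply: smallest_sub.
  split=> [|B mB|F mF].
  - by rewrite setTI preimage_set0.
  - rewrite !setTI in mB *; rewrite setTD.
    by rewrite preimage_setC; exact: measurableC.
  - rewrite setTI preimage_bigcup; apply: bigcup_measurable => k _.
    by have := mF k; rewrite setTI.
move=> B; rewrite -bigcup_seq => -[i _ [Y mY <-]].
by rewrite setTI setTI -comp_preimage; have := mf i measurableT _ mY; rewrite setTI.
Qed.

Section rV_cons.
Variables (R : realType) (n : nat).

Definition rV_cons (tx : measurableTypeR R * 'rV[R]_n) : 'rV[R]_n.+1 :=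
  row_mx (const_mx tx.1 : 'rV[R]_1) tx.2.

Definition rV_uncons (x : 'rV[R]_n.+1) : measurableTypeR R * 'rV[R]_n :=
  (x ord0 ord0, \row_i x ord0 (lift ord0 i)).

Lemma rV_cons0 tx : rV_cons tx ord0 ord0 = tx.1.
Proof.
have -> : (ord0 : 'I_n.+1) = lshift n (ord0 : 'I_1) by exact: val_inj.
by rewrite [LHS](row_mxEl (const_mx tx.1)) mxE.
Qed.

Lemma rV_consS tx i : rV_cons tx ord0 (lift ord0 i) = tx.2 ord0 i.
Proof.
have -> : lift ord0 i = rshift 1 i by exact: val_inj.
exact: (row_mxEr (const_mx tx.1)).
Qed.

Lemma rV_consK : cancel rV_cons rV_uncons.
Proof.
move=> [t x]; rewrite /rV_uncons rV_cons0; congr pair.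
by apply/rowP => i; rewrite mxE rV_consS.
Qed.

Lemma measurable_rV_cons : measurable_fun [set: _] rV_cons.
Proof.
apply: measurable_fun_rVP => i; have [j ->|->] := unliftP ord0 i.
- rewrite (_ : _ \o _ = rV_coord j \o snd); last first.
    by apply/funext => tx /=; rewrite /rV_coord rV_consS.
  by apply: measurableT_comp => //; exact: measurable_rV_coord.
- rewrite (_ : _ \o _ = fst)//.
  by apply/funext => tx /=; rewrite /rV_coord rV_cons0.
Qed.

Lemma measurable_rV_uncons : measurable_fun [set: _] rV_uncons.
Proof.
apply: measurable_fun_pair => /=; first exact: measurable_rV_coord.
apply: measurable_fun_rVP => i.
rewrite (_ : _ \o _ = rV_coord (lift ord0 i)); first exact: measurable_rV_coord.
by apply/funext => x /=; rewrite /rV_coord mxE.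
Qed.

End rV_cons.

HB.instance Definition _ (R : realType) (n : nat) :=
  isMeasurableFun.Build _ _ _ _ (@rV_cons R n) (@measurable_rV_cons R n).

Section lebesgue_cons.
Local Open Scope ereal_scope.
Variables (R : realType) (n : nat).
Variable m : {sigma_finite_measure set 'rV[R]_n -> \bar R}.

Definition lebesgue_cons : set 'rV[R]_n.+1 -> \bar R :=
  pushforward (@lebesgue_measure R \x m) (@rV_cons R n).

Let lebesgue_cons0 : lebesgue_cons set0 = 0.
Proof. exact: measure0. Qed.

Let lebesgue_cons_ge0 A : 0 <= lebesgue_cons A.
Proof. exact: measure_ge0. Qed.

Let lebesgue_cons_sigma_additive : semi_sigma_additive lebesgue_cons.
Proof. exact: measure_semi_sigma_additive. Qed.

HB.instance Definition _ := isMeasure.Build _ _ _ lebesgue_cons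
  lebesgue_cons0 lebesgue_cons_ge0 lebesgue_cons_sigma_additive.

Let lebesgue_cons_sigma_finite : sigma_finite [set: 'rV[R]_n.+1] lebesgue_cons.
Proof.
have /sigma_finiteP[F [FT ndF Foo]] := sigma_finiteT (@lebesgue_measure R).
have /sigma_finiteP[G [GT ndG Goo]] := sigma_finiteT m.
exists (fun k => @rV_uncons R n @^-1` (F k `*` G k)).
  apply/seteqP; split=> // x _; set y := rV_uncons x.
  have [[i _ Fi] [j _ Gj]] : (\bigcup_k F k) y.1 /\ (\bigcup_k G k) y.2.
    by rewrite -FT -GT.
  exists (maxn i j) => //; split.
  - by apply: (subsetPset _ _ (ndF _ _ (leq_maxl i j))).
  - by apply: (subsetPset _ _ (ndG _ _ (leq_maxr i j))).
move=> k; have [mF Fkoo] := Foo k; have [mG Gkoo] := Goo k; split.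
  rewrite -[X in measurable X]setTI; apply: measurable_rV_uncons => //.
  exact: measurableX.
rewrite /lebesgue_cons /pushforward -comp_preimage.
rewrite (_ : _ \o _ = id); last by apply/funext => x /=; rewrite rV_consK.
by rewrite preimage_id product_measure1E// lte_mul_pinfty// ge0_fin_numE.
Qed.

HB.instance Definition _ := Measure_isSigmaFinite.Build _ _ _ lebesgue_cons
  lebesgue_cons_sigma_finite.

End lebesgue_cons.

Fixpoint lebesgue_rV (R : realType) (n : nat) :
    {sigma_finite_measure set 'rV[R]_n -> \bar R} :=
  if n is k.+1 then lebesgue_cons (lebesgue_rV R k) else \d_(0 : 'rV[R]_0).

Definition rV_box (R : realType) n (a b : 'rV[R]_n) : set 'rV[R]_n :=
  [set x | forall i, a ord0 i <= x ord0 i <= b ord0 i].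

(* Characterizes [lebesgue_rV]: boxes generate the Borel sets. *)
Lemma lebesgue_rV_box (R : realType) n (a b : 'rV[R]_n) :
  (forall i, a ord0 i <= b ord0 i) ->
  lebesgue_rV R n (rV_box a b) = (\prod_(i < n) (b ord0 i - a ord0 i))%:E.
Proof.
have mbox m (u v : 'rV[R]_m) : measurable (rV_box u v).
  have -> : rV_box u v =
      \bigcap_(i in [set: 'I_m]) (rV_coord i @^-1` `[u ord0 i, v ord0 i]).
    apply/seteqP; split=> x /= xuv i; last by have := xuv i I; rewrite /= in_itv.
    by move=> _; rewrite /= in_itv; exact: xuv.
  apply: fin_bigcap_measurable => // i _; rewrite -[X in measurable X]setTI.
  exact: measurable_rV_coord.
elim: n a b => [|n IHn] a b ab.
  by rewrite big_ord0 /= diracE mem_set// => -[].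
pose tl (c : 'rV[R]_n.+1) : 'rV[R]_n := \row_i c ord0 (lift ord0 i).
have boxE : @rV_cons R n @^-1` rV_box a b =
    `[a ord0 ord0, b ord0 ord0] `*` rV_box (tl a) (tl b).
  apply/seteqP; split=> [x /= xab|x /= [x1 x2] i].
    split; first by rewrite /= in_itv /= -rV_cons0; exact: xab.
    by move=> i; rewrite !mxE -rV_consS; exact: xab.
  have [j ->|->] := unliftP ord0 i.
    by rewrite rV_consS; have := x2 j; rewrite !mxE.
  by rewrite rV_cons0; move: x1; rewrite /= in_itv.
have itvE : lebesgue_measure `[a ord0 ord0, b ord0 ord0]%classic =
    (b ord0 ord0 - a ord0 ord0)%:E.
  rewrite lebesgue_measure_itv/= lte_fin; case: ltP => // ba.
  have -> : b ord0 ord0 = a ord0 ord0 by apply/eqP; rewrite eq_le ba ab.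
  by rewrite subrr.
rewrite /= /lebesgue_cons /pushforward boxE product_measure1E//; last exact: mbox.
rewrite big_ord_recl EFinM; congr (_ * _)%E; first exact: itvE.
rewrite IHn => [|i]; last by rewrite !mxE.
by congr _%:E; apply: eq_bigr => i _; rewrite !mxE.
Qed.

Section fractional.
Variables (R : realType) (n : nat).
Local Notation mu := (lebesgue_rV R n).
Implicit Types (f g h K w v : 'rV[R]_n -> R) (s : \bar R).

(* Measurability for the completion of the Borel sigma-algebra.  Integrals
   with respect to [mu] have the usual value on such functions: they are
   suprema of integrals of Borel simple functions. *)
Definition lebesgue_measurable f :=
  forall B : set (measurableTypeR R), measurable B ->
    completed_algebra_gen mu (f @^-1` B).

(* The library norm on 'rV[R]_n is the sup norm. *)
Definition eucl_norm (x : 'rV[R]_n) : R := Num.sqrt (\sum_i x ord0 i ^+ 2).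

Definition eucl_ball (c : 'rV[R]_n) (t : R) : set 'rV[R]_n :=
  [set x | eucl_norm (x - c) < t].

Definition cube (a : 'rV[R]_n) (l : R) : set 'rV[R]_n :=
  rV_box a (a + const_mx l).

Definition annulus (t : R) : set 'rV[R]_n :=
  [set x | t < eucl_norm x <= 2 * t].

(* [s] ranges over [1, +oo]; the junk value [-oo] is never used. *)
Definition avg_norm s (B : set 'rV[R]_n) f : \bar R :=
  (match s with
   | s%:E => ((mu B)^-1 * \int[mu]_(x in B) (`|f x| `^ s)%:E) `^ s^-1
   | _ => ess_sup mu (fun x => (`|f x| * \1_B x)%:E)
   end)%E.

Definition avg_norm_annulus s (t : R) f : \bar R :=
  avg_norm s (eucl_ball 0 (2 * t)) (fun x => f x * \1_(annulus t) x).

Definition size_condition (alpha : R) s g :=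
  lebesgue_measurable g /\
  exists2 C : R, 0 < C & forall t, 0 < t ->
    (avg_norm_annulus s t g <= (C * t `^ (alpha - n%:R))%:E)%E.

Definition hormander_condition (alpha : R) s h :=
  exists c C : R, [/\ 1 < c, 0 < C &
    forall (x : 'rV[R]_n) (r : R), c * eucl_norm x < r ->
      (\sum_(1 <= m <oo) (((2 ^+ m * r) `^ (n%:R - alpha))%:E *
          avg_norm_annulus s (2 ^+ m * r)%R (fun y => h (y - x) - h y)%R)
        <= C%:E)%E].

Definition weight w :=
  [/\ forall x, 0 <= w x, lebesgue_measurable w &
    forall K : set 'rV[R]_n, compact K -> (\int[mu]_(x in K) (w x)%:E < +oo)%E].

(* [v] is only used where [0 <= v]; [v ^ (- a')] is [+oo] where [v] vanishes,
   whereas [0 `^ (- a')] would be [0]. *)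
Definition A_const (a b : R) v : \bar R :=
  let a' := fine (hoelder_conjugate a%:E) in
  ereal_sup [set (((mu Q)^-1 * \int[mu]_(x in Q) (v x `^ b)%:E) *
      ((mu Q)^-1 * \int[mu]_(x in Q) ((v x `^ a')%:E)^-1) `^ (b / a'))%E
    | Q in [set cube c l | c in setT & l in [set l : R | 0 < l]]].

Definition A_class (a b : R) v := (A_const a b v < +oo)%E.

(* The norm of [g] in L^p(u dx). *)
Definition weighted_norm (p : R) (u : 'rV[R]_n -> R) (g : 'rV[R]_n -> \bar R) :
  \bar R := ((\int[mu]_x (`|g x| `^ p * (u x)%:E)) `^ p^-1)%E.

Definition Linfty_c f :=
  [/\ lebesgue_measurable f, exists M : R, forall x, `|f x| <= M &
    compact (closure [set x | f x != 0])].

Definition convolution_operator K f (x : 'rV[R]_n) : \bar R :=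
  (\int[mu]_y (K (x - y) * f y)%:E)%E.

End fractional.

(* Main.v *)
Require Import Defs.
From HB Require Import structures.
From mathcomp Require Import all_boot all_order all_algebra.
From mathcomp Require Import all_classical all_reals all_analysis.
From mathcomp Require Import ess_sup_inf measurable_realfun.
From mathcomp Require Import ring lra zify.
Set Implicit Arguments.
Unset Strict Implicit.
Unset Printing Implicit Defensive.
Import Order.TTheory GRing.Theory Num.Theory.
Import numFieldNormedType.Exports.
Local Open Scope ring_scope.

(** The operator is dominated pointwise by averages over dyadic cubes, and the
    resulting positive operator is bounded by finite combinatorics.

    Cut the integral into the shells t < |z| <= 2t, for t = 2^k / 2^m. The size
    of the kernel and Hölder's inequality bound the contribution of a shell to
    T f (x) by t^(alpha - n/r) times the L^r norm of f on the shell around x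
    ([shell_kernel_bound]). In one of 2^n shifted dyadic grids, this shell and
    the point x lie in a common cube of side 16 t ([one_third_trick]). Hence
    |T f (x)| is at most a constant times the sum, over the 2^n grids and over
    the cubes Q that contain x, of |Q|^(alpha/n) times the r-average of f on Q
    ([convolution_pointwise]). The grids are finite, made of leaves of side
    2^-m in a cube of side 2^(m+5), and m tends to infinity only at the end,
    by Fatou's lemma ([positive_weight_bound]).

    On a finite grid, functions and weights are reduced to their masses on the
    leaves: m for the volume, o for w^q and s for w^-e, with 1/e = 1/r - 1/p.
    For rho = q/e, the condition on w^r becomes
    (o(Q)/m(Q)) (s(Q)/m(Q))^rho <= A for all cubes. In [discrete_bound], the
    maximal function with respect to s replaces r-averages by averages, and
    duality leaves a bilinear form in averages with respect to s and o. Such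
    forms are bounded as soon as the operator and its adjoint satisfy testing
    conditions on single cubes ([bilinear_embedding]).

    Testing sums are products of powers of m, o and s summed over nested cubes
    and raised to a power. Such powers are iterated sums
    ([iterated_chain_sum]), where each inner sum is geometric in the volume
    after a small power of A has been spent ([chain_moment]). The outcome is a
    power of A times the sum of s(Q)^eta over the subcubes, with eta > 1
    ([testing_bound]), and the last sum costs A^(1/rho) because the masses s(Q)
    decrease along nested cubes by factors 1 - c A^(-1/rho) ([mass_decay]). The
    powers of A obtained for the operator and for its adjoint are the two
    terms of the maximum: (1 + e/q)/q = ((p/r)'/q) (1 - alpha r/n) and
    1/q + 1/p' = 1 - alpha/n.

    For a general weight, the kernel, the function and the weight are replaced
    by Borel functions. Finiteness of the constant forces the weight to be
    positive almost everywhere unless it vanishes almost everywhere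
    ([A_class_zero_or_positive]). *)

(** * Powers and finite sums *)

Section powers.
Context {R : realType}.
Implicit Types a b p q r x y : R.

Lemma ler_powRl r x y : 0 <= r -> 0 <= x -> x <= y -> x `^ r <= y `^ r.
Proof.
move=> r0 x0 xy; apply: ge0_ler_powR => //; rewrite nnegrE//.
exact: le_trans xy.
Qed.

Lemma expR_lnE x : 0 < x -> x = expR (ln x).
Proof. by move=> x0; rewrite lnK ?posrE. Qed.

Lemma powRVK r x : 0 < r -> 0 <= x -> (x `^ r) `^ r^-1 = x.
Proof. by move=> r0 x0; rewrite -powRrM divff ?gt_eqF// powRr1. Qed.

Lemma powRKV r x : 0 < r -> 0 <= x -> (x `^ r^-1) `^ r = x.
Proof. by move=> r0 x0; rewrite -powRrM mulVf ?gt_eqF// powRr1. Qed.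

Lemma le_powRV r x y : 0 < r -> 0 <= x -> 0 <= y ->
  (x `^ r <= y) = (x <= y `^ r^-1).
Proof.
move=> r0 x0 y0; apply/idP/idP => h.
- rewrite -(powRVK r0 x0); apply: ler_powRl => //.
  + by rewrite invr_ge0 ltW.
  + exact: powR_ge0.
- rewrite -[leRHS](powRKV r0 y0); apply: ler_powRl => //; exact: ltW.
Qed.

Lemma hoelder_sum (I : finType) (P : pred I) (a b : I -> R) (p q : R) :
  0 < p -> 0 < q -> p^-1 + q^-1 = 1 ->
  (forall i, P i -> 0 <= a i) -> (forall i, P i -> 0 <= b i) ->
  \sum_(i | P i) a i * b i <=
  (\sum_(i | P i) a i `^ p) `^ p^-1 * (\sum_(i | P i) b i `^ q) `^ q^-1.
Proof.
move=> p0 q0 pq a0 b0.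
move AE : (\sum_(i | P i) a i `^ p) => A; move BE : (\sum_(i | P i) b i `^ q) => B.
have A0 : 0 <= A by rewrite -AE; apply: sumr_ge0 => i _; exact: powR_ge0.
have B0 : 0 <= B by rewrite -BE; apply: sumr_ge0 => i _; exact: powR_ge0.
have zero (c : I -> R) r : \sum_(i | P i) c i `^ r = 0 ->
    forall i, P i -> c i = 0.
  move=> c0 i Pi; apply: (@powR_eq0_eq0 _ _ r); apply/eqP.
  have /(psumr_eq0P (F := fun i => c i `^ r)) : forall i, P i -> 0 <= c i `^ r.
    by move=> j _; exact: powR_ge0.
  by move=> /(_ c0 i Pi) ->.
have [A00|An0] := eqVneq A 0.
  rewrite big1; first by rewrite mulr_ge0// powR_ge0.
  by move=> i Pi; rewrite (zero a p)// ?AE// mul0r.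
have [B00|Bn0] := eqVneq B 0.
  rewrite big1; first by rewrite mulr_ge0// powR_ge0.
  by move=> i Pi; rewrite (zero b q)// ?BE// mulr0.
have {A0 An0}A0 : 0 < A by rewrite lt_neqAle eq_sym An0.
have {B0 Bn0}B0 : 0 < B by rewrite lt_neqAle eq_sym Bn0.
have Ap : 0 < A `^ p^-1 by rewrite powR_gt0.
have Bq : 0 < B `^ q^-1 by rewrite powR_gt0.
rewrite -[leRHS]mulr1 -ler_pdivrMl; last exact: mulr_gt0.
rewrite (big_distrr (A `^ p^-1 * B `^ q^-1)^-1)/= -pq.
have -> : p^-1 + q^-1 = \sum_(i | P i)
    ((a i / A `^ p^-1) `^ p / p + (b i / B `^ q^-1) `^ q / q).
  rewrite big_split/= -!mulr_suml; congr (_ + _).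
  - rewrite (eq_bigr (fun i => a i `^ p / A)) => [|i Pi].
      by rewrite -mulr_suml AE divff ?gt_eqF// mul1r.
    by rewrite powRM ?invr_ge0 ?(ltW Ap) ?a0// -powR_inv1 ?(ltW Ap)//
      powRAC powRKV ?(ltW A0)// powR_inv1 ?ltW.
  - rewrite (eq_bigr (fun i => b i `^ q / B)) => [|i Pi].
      by rewrite -mulr_suml BE divff ?gt_eqF// mul1r.
    by rewrite powRM ?invr_ge0 ?(ltW Bq) ?b0// -powR_inv1 ?(ltW Bq)//
      powRAC powRKV ?(ltW B0)// powR_inv1 ?ltW.
apply: ler_sum => i Pi.
rewrite invfM mulrACA ![_^-1 * _]mulrC.
by apply: conjugate_powR; rewrite ?divr_ge0 ?a0 ?b0 ?ltW.
Qed.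

(** Remove the largest value first: all the others are then at most [k]
    times it, so that the sum is dominated by V + k V + k^2 V + .... *)
Lemma geometric_sum (T : finType) (S : {set T}) (v : T -> R) (k V : R) :
  0 <= k < 1 -> 0 <= V -> {in S, forall t, 0 <= v t <= V} ->
  {in S &, forall t u, t != u -> v t <= k * v u \/ v u <= k * v t} ->
  \sum_(x in S) v x <= V / (1 - k).
Proof.
move=> /andP[k0 k1]; have k1' : 0 < 1 - k by rewrite subr_gt0.
move: {2}#|S| (erefl #|S|) => m; elim: m S V => [|m IHm] S V.
  by move=> /eqP; rewrite cards_eq0 => /eqP-> V0 _ _; rewrite big_set0 divr_ge0// ltW.
move=> Sm V0 vV vk.
have [x0 x0S] : exists x : T, x \in S by apply/card_gt0P; rewrite Sm.
case: (arg_maxP v (x0S : (fun i => i \in S) x0)) => x /= xS xmax.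
have vx : 0 <= v x by have /andP[] := vV _ xS.
rewrite (big_setD1 x)//=.
have h : \sum_(i in S :\ x) v i <= k * v x / (1 - k).
  apply: IHm.
  - by move: Sm; rewrite (cardsD1 x S) xS => -[].
  - exact: mulr_ge0.
  - move=> y; rewrite !inE => /andP[yx yS]; have /andP[vy _] := vV _ yS.
    rewrite vy/=; have [//|vxk] := vk _ _ yS xS yx.
    have := xmax _ yS => /= vyx.
    have vx0 : v x * (1 - k) <= 0 by rewrite mulrBr mulr1 subr_le0 (le_trans vxk)// [leRHS]mulrC ler_wpM2l.
    have -> : v x = 0.
      by apply/eqP; rewrite eq_le vx andbT -(pmulr_lle0 _ k1').
    rewrite mulr0; apply: (le_trans vyx).
    by rewrite -(pmulr_lle0 _ k1').
  - by move=> y z; rewrite !inE => /andP[_ yS] /andP[_ zS]; exact: vk.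
apply: (le_trans (lerD (lexx _) h)).
rewrite -{1}[v x](mulfK (lt0r_neq0 k1')) -mulrDl ler_pM2r ?invr_gt0//.
have /andP[_ vxV] := vV _ xS.
by apply: le_trans vxV; rewrite mulrBr mulr1 [k * _]mulrC subrK.
Qed.

End powers.

(** * Laminar families and principal cubes *)

Section dyadic_floor.
Context {R : realType}.
Implicit Types s t : R.

(** The largest integral power of 2 that is at most [t], for [t] positive. *)
Definition dyadic_floor t : R := expR (ln 2 * (Num.floor (ln t / ln 2))%:~R).

Let ln2_gt0 : 0 < ln 2 :> R. Proof. by rewrite ln_gt0// ltr1n. Qed.

Lemma dyadic_floor_gt0 t : 0 < dyadic_floor t.
Proof. exact: expR_gt0. Qed.

Lemma dyadic_floor_le t : 0 < t -> dyadic_floor t <= t.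
Proof.
move=> t0; rewrite [leRHS]expR_lnE// ler_expR mulrC -ler_pdivlMr//.
exact: floor_le_tmp.
Qed.

Lemma lt_dyadic_floor t : 0 < t -> t < 2 * dyadic_floor t.
Proof.
move=> t0; rewrite [ltLHS]expR_lnE// {1}[2](@expR_lnE R)// -expRD ltr_expR.
rewrite -[X in X + _]mulr1 -mulrDr mulrC -ltr_pdivrMr//.
by rewrite addrC -[1%R]/(1%:~R) -intrD floorD1_gt.
Qed.

Lemma dyadic_floor_jump s t : dyadic_floor s < dyadic_floor t ->
  2 * dyadic_floor s <= dyadic_floor t.
Proof.
rewrite ltr_expR ltr_pM2l// ltr_int => st.
rewrite {1}[2](@expR_lnE R)// -expRD ler_expR.
rewrite -[X in X + _]mulr1 -mulrDr ler_pM2l//.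
by rewrite -[1%R]/(1%:~R) -intrD ler_int addrC -ltzD1 ltrD2r.
Qed.

End dyadic_floor.

Section laminar.
Context {R : realType} {T : finType}.
Implicit Types (D : {set {set T}}) (v : {set T} -> R) (F G Q : {set T}).

(** The combinatorics of dyadic cubes. Nonemptiness makes all masses of
    members positive, so that averages are meaningful. *)
Definition laminar D :=
  {in D &, forall Q Q', [|| Q \subset Q', Q' \subset Q | [disjoint Q & Q']]}
  /\ {in D, forall Q, (0 < #|Q|)%N}.

Lemma laminarS D D' : D' \subset D -> laminar D -> laminar D'.
Proof.
move=> /fintype.subsetP D'D [lamD neD]; split => [Q Q' /D'D QD /D'D Q'D|Q /D'D].
- exact: lamD.
- exact: neD.
Qed.

Lemma laminar_mem D x Q Q' : laminar D -> Q \in D -> Q' \in D ->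
  x \in Q -> x \in Q' -> (Q \subset Q') || (Q' \subset Q).
Proof.
move=> [lamD _] QD Q'D xQ xQ'; have := lamD _ _ QD Q'D; rewrite orbA.
case/orP => // /pred0P /(_ x) /=; by rewrite xQ xQ'.
Qed.

(** The stopping cubes of [v], here as the cubes that set a new record of
    [v] on the way down, instead of generation by generation. *)
Definition principal D v : {set {set T}} :=
  [set F in D | [forall (Q | Q \in D), (F \proper Q) ==> (v Q < v F)]].

Lemma principalP D v F : F \in principal D v ->
  F \in D /\ forall Q, Q \in D -> F \proper Q -> v Q < v F.
Proof.
rewrite inE => /andP[FD /forall_inP FP]; split=> // Q QD FQ.
by have := FP _ QD; rewrite FQ.
Qed.

(** A largest cube above [Q] with value at least [v Q] is a record. *)
Lemma principal_above D v Q : Q \in D ->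
  exists F, [/\ F \in principal D v, Q \subset F & v Q <= v F].
Proof.
move=> QD; pose U := [set F in D | (Q \subset F) && (v Q <= v F)].
have QU : Q \in U by rewrite inE QD subxx lexx.
case: (@arg_maxnP _ Q (fun F => F \in U) (fun F => #|F|) QU) => F /= FU Fmax.
move: (FU); rewrite inE => /and3P[FD QF vQF]; exists F; split => //.
rewrite inE FD; apply/forall_inP => G GD; apply/implyP => FG.
rewrite ltNge; apply/negP => vFG.
have /Fmax : G \in U.
  by rewrite inE GD (fintype.subset_trans QF (proper_sub FG)) (le_trans vQF).
by rewrite /= leqNgt proper_card.
Qed.

(** The smallest principal cube above [Q]; by [stopP] the default value is
    never taken on a member of a laminar family. *)
Definition stop D v Q : {set T} :=
  odflt Q [pick F in principal D v | (Q \subset F) &&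
    [forall (G | G \in principal D v), (Q \subset G) ==> (F \subset G)]].

(** The smallest principal cube is inside the one of [principal_above], so
    its value is at least as large. *)
Lemma stopP D v Q : laminar D -> Q \in D ->
  [/\ stop D v Q \in principal D v, Q \subset stop D v Q,
      v Q <= v (stop D v Q) &
      forall G, G \in principal D v -> Q \subset G -> stop D v Q \subset G].
Proof.
move=> lamD QD; have [F0 [F0P QF0 vQF0]] := principal_above v QD.
have [x xQ] : exists x : T, x \in Q by apply/card_gt0P; case: lamD => _; exact.
suff [F [FP QF Fmin]] : exists F, [/\ F \in principal D v, Q \subset F &
    forall G, G \in principal D v -> Q \subset G -> F \subset G].
  rewrite /stop; case: pickP => [G|/(_ F)]; last first.
    rewrite FP QF/=; move/negP => []; apply/forall_inP => G GP.
    by apply/implyP; exact: Fmin.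
  move=> /andP[GP /andP[QG /forall_inP Gmin]]; split => //=; last first.
    by move=> H HP QH; have := Gmin _ HP; rewrite QH.
  have := Gmin _ F0P; rewrite QF0 => GF0.
  have [->//|GneF0] := eqVneq G F0; apply: (le_trans vQF0); apply: ltW.
  have [_] := principalP GP; apply; first by have [] := principalP F0P.
  by rewrite finset.properEneq GneF0.
case: (@arg_minnP _ F0 (fun F => (F \in principal D v) && (Q \subset F))
  (fun F => #|F|)); first by rewrite F0P.
move=> F /andP[FP QF] Fmin; exists F; split=> // G GP QG.
have FD : F \in D by have [] := principalP FP.
have GD : G \in D by have [] := principalP GP.
have /orP[//|GF] := laminar_mem lamD FD GD (fintype.subsetP QF _ xQ) (fintype.subsetP QG _ xQ).
have : (#|F| <= #|G|)%N by apply: Fmin; rewrite GP.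
by move=> FG; rewrite (eqP (_ : G == F)) ?subxx// eqEcard GF.
Qed.

End laminar.

(** * Carleson embedding and the maximal function *)

Section finite_sums.
Context {R : realType}.

Lemma sum_at_most_once (I J : finType) (P : pred I) (Q : I -> pred J)
    (S : pred J) (h : J -> R) :
  (forall j, S j -> 0 <= h j) ->
  (forall i j, P i -> Q i j -> S j) ->
  (forall i i' j, P i -> P i' -> Q i j -> Q i' j -> i = i') ->
  \sum_(i | P i) \sum_(j | Q i j) h j <= \sum_(j | S j) h j.
Proof.
move=> h0 QS PQ1.
rewrite (exchange_big_dep S)//=.
apply: ler_sum => j Sj.
have [i0 /andP[Pi0 Qi0]|noi] := pickP (fun i => P i && Q i j).
  rewrite (big_pred1 i0)// => i; apply/andP/eqP => [[Pi Qij]|->//].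
  exact: PQ1 Qij Qi0.
by rewrite big_pred0// h0.
Qed.

Lemma sum_powR_le (I : finType) (P : pred I) (a : I -> R) (t : R) :
  1 <= t -> (forall i, P i -> 0 <= a i) ->
  \sum_(i | P i) a i `^ t <= (\sum_(i | P i) a i) `^ t.
Proof.
move=> t1 a0; have t0 : 0 < t by exact: lt_le_trans t1.
have S0 : 0 <= \sum_(i | P i) a i by exact: sumr_ge0.
rewrite -[leRHS]mulr_powRB1// mulr_suml; apply: ler_sum => i Pi.
rewrite -mulr_powRB1 ?a0// ler_wpM2l ?a0// ler_powRl ?subr_ge0 ?a0//.
by rewrite (bigD1 i)//= lerDl sumr_ge0// => j /andP[Pj _]; exact: a0.
Qed.

Lemma hoelder_weighted (I : finType) (P : pred I) (w a b : I -> R) (p q : R) :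
  0 < p -> 0 < q -> p^-1 + q^-1 = 1 ->
  (forall i, P i -> 0 <= w i) ->
  (forall i, P i -> 0 <= a i) -> (forall i, P i -> 0 <= b i) ->
  \sum_(i | P i) w i * (a i * b i) <=
  (\sum_(i | P i) w i * a i `^ p) `^ p^-1 *
  (\sum_(i | P i) w i * b i `^ q) `^ q^-1.
Proof.
move=> p0 q0 pq w0 a0 b0.
have := @hoelder_sum _ _ P (fun i => w i `^ p^-1 * a i)
  (fun i => w i `^ q^-1 * b i) p q p0 q0 pq.
have E r (r0 : 0 < r) (c : I -> R) : (forall i, P i -> 0 <= c i) ->
    \sum_(i | P i) (w i `^ r^-1 * c i) `^ r = \sum_(i | P i) w i * c i `^ r.
  move=> c0; apply: eq_bigr => i Pi; rewrite powRM ?powR_ge0 ?c0//.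
  by rewrite powRKV ?w0.
rewrite !E// => H; apply: le_trans (H _ _).
- rewrite le_eqVlt; apply/orP; left; apply/eqP; apply: eq_bigr => i Pi.
  rewrite mulrACA -powRD ?pq ?oner_eq0// powRr1 ?w0//.
- by move=> i Pi; rewrite mulr_ge0 ?powR_ge0 ?a0.
- by move=> i Pi; rewrite mulr_ge0 ?powR_ge0 ?b0.
Qed.

Lemma bigmax_attained (I : finType) (P : pred I) (v : I -> R) :
  \big[Num.max/0]_(i | P i) v i = 0 \/
  exists2 i, P i & \big[Num.max/0]_(i | P i) v i = v i.
Proof.
elim/big_ind : _ => [|x y hx hy|i Pi]; first by left.
- by case: (leP x y) => _.
- by right; exists i.
Qed.

End finite_sums.

Section carleson.
Context {R : realType} {T : finType}.
Implicit Types (D : {set {set T}}) (F G Q : {set T}) (m f g : T -> R).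

Definition mass m Q : R := \sum_(x in Q) m x.

Definition mean m f Q : R := (\sum_(x in Q) m x * f x) / mass m Q.

Lemma mass_ge0 m Q : (forall x, 0 < m x) -> 0 <= mass m Q.
Proof. by move=> m0; apply: sumr_ge0 => x _; exact: ltW. Qed.

Lemma mass_gt0 m Q : (forall x, 0 < m x) -> (0 < #|Q|)%N -> 0 < mass m Q.
Proof.
move=> m0 /card_gt0P[x xQ]; rewrite /mass (big_setD1 x)//= ltr_pwDl//.
by apply: sumr_ge0 => y _; exact: ltW.
Qed.

Lemma ler_mass m Q Q' : (forall x, 0 < m x) -> Q \subset Q' ->
  mass m Q <= mass m Q'.
Proof.
move=> m0 QQ'; rewrite /mass [leRHS](big_setID Q)/= (finset.setIidPr QQ') lerDl.
by apply: sumr_ge0 => x _; exact: ltW.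
Qed.

Lemma mean_ge0 m f Q : (forall x, 0 < m x) -> (forall x, 0 <= f x) ->
  0 <= mean m f Q.
Proof.
move=> m0 f0; apply: divr_ge0; last exact: mass_ge0.
by apply: sumr_ge0 => x _; rewrite mulr_ge0// ltW.
Qed.

(** The sum of the geometric series of ratio 2^-(p-1), which appears
    because averages at least double from a principal cube to a smaller
    one. *)
Definition carleson_const (p : R) : R := (1 - 2 `^ (- (p - 1)))^-1.

Lemma powR2N_lt1 (e : R) : 0 < e -> 0 <= 2 `^ (- e) < 1.
Proof.
move=> e0; rewrite powR_ge0/= powRN invf_lt1 ?powR_gt0//.
have := @gt0_ltr_powR _ _ e0 1 2; rewrite powR1; apply; rewrite ?nnegrE//.
by rewrite ltr1n.
Qed.

Lemma carleson_const_gt0 (p : R) : 1 < p -> 0 < carleson_const p.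
Proof.
move=> p1; have p0 : 0 < p - 1 by rewrite subr_gt0.
by rewrite invr_gt0 subr_gt0; have /andP[] := powR2N_lt1 p0.
Qed.

Section principal_cubes.
Variables (D : {set {set T}}) (s f : T -> R).
Hypothesis lamD : laminar D.
Hypothesis s0 : forall x, 0 < s x.
Hypothesis f0 : forall x, 0 <= f x.
Hypothesis mean0 : {in D, forall Q, 0 < mean s f Q}.

(** Rounding averages to powers of 2 makes the records at least double
    from one principal cube to the next. *)
Definition level Q : R := dyadic_floor (mean s f Q).
Local Notation v := level.
Local Notation P := (principal D v).

Lemma level_gt0 Q : 0 < v Q. Proof. exact: dyadic_floor_gt0. Qed.

(** The principal cubes through a point are nested, and [v] at least
    doubles along them. *)
Lemma chain_level_sum (e V : R) (x : T) : 0 < e -> 0 <= V ->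
  (forall F, F \in P -> x \in F -> v F <= V) ->
  \sum_(F in P | x \in F) v F `^ e <= V `^ e / (1 - 2 `^ (- e)).
Proof.
move=> e0 V0 vV; have e0' := ltW e0.
rewrite (eq_bigl (fun F => F \in [set F in P | x \in F])); last first.
  by move=> F; rewrite !inE.
apply: geometric_sum; [exact: powR2N_lt1|exact: powR_ge0| |].
  move=> F; rewrite inE => /andP[FP xF]; rewrite powR_ge0/= ler_powRl//.
  - exact/ltW/level_gt0.
  - exact: vV.
have key F G : F \in P -> G \in P -> F \proper G ->
    v G `^ e <= 2 `^ (- e) * v F `^ e.
  move=> FP GP FG; rewrite mulrC powRN ler_pdivlMr ?powR_gt0//.
  rewrite -powRM ?(ltW (level_gt0 _))// ler_powRl ?mulr_ge0 ?(ltW (level_gt0 _))//.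
  rewrite mulrC; apply: dyadic_floor_jump.
  by have [_] := principalP FP; apply => //; have [] := principalP GP.
move=> F G; rewrite !inE => /andP[FP xF] /andP[GP xG] FG.
have FP' : F \in P by rewrite inE.
have GP' : G \in P by rewrite inE.
have [FD _] := principalP FP'; have [GD _] := principalP GP'.
have /orP[sFG|sGF] := laminar_mem lamD FD GD xF xG.
- by right; apply: key => //; rewrite finset.properEneq FG.
- by left; apply: key => //; rewrite finset.properEneq eq_sym FG.
Qed.

Definition level_max x : R := \big[Num.max/0]_(F in P | x \in F) v F.

Lemma level_max_ge0 x : 0 <= level_max x.
Proof. by rewrite /level_max; elim/big_ind : _ => // [a b a0 b0|F _];
  [rewrite le_max a0|exact/ltW/level_gt0]. Qed.

Lemma level_max_le x F : F \in P -> x \in F -> v F <= level_max x.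
Proof. by move=> FP xF; apply: le_bigmax_cond; rewrite FP. Qed.

Lemma level_max_powR p : 0 < p ->
  \sum_x s x * level_max x `^ p <= \sum_(F in P) v F `^ p * mass s F.
Proof.
move=> p0; rewrite (eq_bigr (fun F => \sum_(x in F) s x * v F `^ p)); last first.
  by move=> F _; rewrite mulrC mulr_suml.
rewrite (exchange_big_dep predT)//=; apply: ler_sum => x _.
rewrite -mulr_sumr ler_pM2l// /level_max.
have [->|[F /andP[FP xF] ->]] :=
  bigmax_attained (fun F => (F \in P) && (x \in F)) v.
  by rewrite powR0 ?gt_eqF//; apply: sumr_ge0 => F _; exact: powR_ge0.
rewrite (bigD1 F) ?FP//= lerDl; apply: sumr_ge0 => G _; exact: powR_ge0.
Qed.

(** Call A the left-hand side and N the sum on the right. Writing one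
    factor [v F] as at most the average of [f], A is at most the pairing
    of [f] with the sums of v(F)^(p-1) over the principal cubes through a
    point; these sums are geometric, hence comparable with their largest
    term, and the norm of that term is again bounded by A. Thus A <= C
    N^(1/p) A^(1/p'), from which A can be divided out. *)
Lemma carleson_embedding p : 1 < p ->
  \sum_(F in P) v F `^ p * mass s F <=
  carleson_const p `^ p * \sum_x s x * f x `^ p.
Proof.
move=> p1; have p0 : 0 < p by rewrite (lt_trans _ p1).
have pB0 : 0 < p - 1 by rewrite subr_gt0.
have C0 := carleson_const_gt0 p1.
pose p' := p / (p - 1).
have p'0 : 0 < p' by rewrite divr_gt0.
have pp' : p^-1 + p'^-1 = 1 by rewrite /p' invf_div; field; rewrite gt_eqF.
move AE : (\sum_(F in P) v F `^ p * mass s F) => A.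
move NE : (\sum_x s x * f x `^ p) => N.
have N0 : 0 <= N.
  by rewrite -NE; apply: sumr_ge0 => x _; rewrite mulr_ge0 ?powR_ge0// ltW.
have A0 : 0 <= A.
  by rewrite -AE; apply: sumr_ge0 => F _; rewrite mulr_ge0 ?powR_ge0 ?mass_ge0.
have [->|An0] := eqVneq A 0; first by rewrite mulr_ge0// powR_ge0.
have {A0 An0}A0 : 0 < A by rewrite lt_neqAle eq_sym An0.
have H1 : A <= \sum_x s x * f x * \sum_(F in P | x \in F) v F `^ (p - 1).
  have -> : \sum_x s x * f x * \sum_(F in P | x \in F) v F `^ (p - 1) =
      \sum_(F in P) v F `^ (p - 1) * \sum_(x in F) s x * f x.
    under [RHS]eq_bigr do rewrite mulr_sumr.
    rewrite [RHS](exchange_big_dep predT)//=; apply: eq_bigr => x _.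
    by rewrite mulr_sumr; apply: eq_bigr => F _; rewrite mulrC.
  rewrite -AE; apply: ler_sum => F FP.
  have FD : F \in D by have [] := principalP FP.
  have F0 : 0 < mass s F by apply: mass_gt0 => //; case: lamD => _; exact.
  rewrite -mulr_powRB1 ?(ltW (level_gt0 _))// [v F * _]mulrC -mulrA.
  rewrite ler_wpM2l ?powR_ge0// -ler_pdivlMr//.
  by apply: dyadic_floor_le; exact: mean0.
have H2 : A <= carleson_const p * \sum_x s x * (f x * level_max x `^ (p - 1)).
  apply: (le_trans H1); rewrite mulr_sumr; apply: ler_sum => x _.
  rewrite mulrCA -mulrA ler_wpM2l ?(ltW (s0 _))// mulrCA ler_wpM2l//.
  rewrite mulrC; apply: chain_level_sum => //; first exact: level_max_ge0.
  by move=> F FP xF; exact: level_max_le.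
have H3 : A <= carleson_const p * (N `^ p^-1 * A `^ p'^-1).
  apply: (le_trans H2); rewrite ler_pM2l//.
  apply: (le_trans (hoelder_weighted p0 p'0 pp' _ _ _)).
  - by move=> x _; exact: ltW.
  - by move=> x _; exact: f0.
  - by move=> x _; exact: powR_ge0.
  rewrite NE ler_wpM2l ?powR_ge0// ler_powRl ?invr_ge0 ?(ltW p'0)//.
    by apply: sumr_ge0 => x _; rewrite mulr_ge0 ?powR_ge0// ltW.
  rewrite -AE; apply: le_trans (level_max_powR p0).
  apply: ler_sum => x _; rewrite -powRrM /p' mulrCA divff ?gt_eqF//.
  by rewrite mulr1.
have H4 : A `^ p^-1 <= carleson_const p * N `^ p^-1.
  have -> : A `^ p^-1 = A / A `^ p'^-1.
    rewrite -[LHS](mulfK (lt0r_neq0 (powR_gt0 p'^-1 A0))).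
    by rewrite -powRD ?pp' ?oner_eq0// powRr1 ?(ltW A0).
  by rewrite ler_pdivrMr ?powR_gt0// -mulrA.
rewrite -[N](powRKV p0)// -powRM ?(ltW C0) ?powR_ge0//.
rewrite -[leLHS](powRKV p0) ?(ltW A0)//.
by apply: ler_powRl => //; [exact: ltW|exact: powR_ge0].
Qed.

End principal_cubes.

(** An average is less than twice its rounding, hence less than twice the
    value of a principal cube above: [2 * level_max] is a majorant, with
    norm given by [carleson_embedding]. Cubes of mean zero are left out
    because their rounding is meaningless. *)
Lemma doob_maximal D (s f : T -> R) (p : R) : laminar D ->
  (forall x, 0 < s x) -> (forall x, 0 <= f x) -> 1 < p ->
  exists a : T -> R, [/\ forall x, 0 <= a x,
    forall Q x, Q \in D -> x \in Q -> mean s f Q <= a x &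
    \sum_x s x * a x `^ p <=
      (2 * carleson_const p) `^ p * \sum_x s x * f x `^ p].
Proof.
move=> lamD s0 f0 p1; have p0 : 0 < p by rewrite (lt_trans _ p1).
pose D' := [set Q in D | 0 < mean s f Q].
have D'D : D' \subset D by apply/fintype.subsetP => Q; rewrite inE => /andP[].
have lamD' := laminarS D'D lamD.
have mean0 : {in D', forall Q, 0 < mean s f Q}.
  by move=> Q; rewrite inE => /andP[].
pose a := level_max D' s f.
have a0 x : 0 <= a x by exact: level_max_ge0.
exists (fun x => 2 * a x); split => [x|Q x QD xQ|].
- by rewrite mulr_ge0.
- have [m0|m0] := ltP 0 (mean s f Q); last by rewrite (le_trans m0)// mulr_ge0.
  have QD' : Q \in D' by rewrite inE QD.
  have [SP QS vS _] := stopP (level s f) lamD' QD'.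
  apply: (le_trans (ltW (lt_dyadic_floor m0))).
  rewrite ler_pM2l//; apply: (le_trans vS).
  by apply: level_max_le => //; exact: (fintype.subsetP QS).
- rewrite powRM ?(ltW (carleson_const_gt0 _))// -mulrA.
  under eq_bigr do rewrite powRM// mulrCA.
  rewrite -mulr_sumr ler_pM2l ?powR_gt0//.
  apply: (le_trans (level_max_powR _ _ _ _)) => //.
  exact: carleson_embedding.
Qed.

End carleson.

(** * Two-weight testing for positive dyadic operators *)

Section embedding_half.
Context {R : realType} {T : finType}.
Implicit Types (F G Q : {set T}).
Variables (D : {set {set T}}) (s o f g : T -> R) (c : {set T} -> R).
Variables (p q q' L K : R).
Hypothesis lamD : laminar D.
Hypothesis s0 : forall x, 0 < s x.
Hypothesis o0 : forall x, 0 < o x.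
Hypothesis f0 : forall x, 0 <= f x.
Hypothesis g0 : forall x, 0 <= g x.
Hypothesis c0 : forall Q, 0 <= c Q.
Hypothesis p1 : 1 < p.
Hypothesis pq : p <= q.
Hypothesis q'0 : 0 < q'.
Hypothesis qq' : q^-1 + q'^-1 = 1.
Hypothesis L0 : 0 <= L.
Hypothesis K0 : 0 <= K.
Hypothesis mean0 : {in D, forall Q, 0 < mean s f Q}.
Hypothesis dominated : {in D, forall Q,
  mean o g Q `^ q' * mass o Q <= L * (mean s f Q `^ p * mass s Q)}.
Hypothesis testing : {in D, forall F,
  \sum_x o x * (\sum_(Q in D | (x \in Q) && (Q \subset F)) c Q / mass o Q) `^ q
  <= (K * mass s F `^ p^-1) `^ q}.

Local Notation v := (level s f).
Local Notation P := (principal D v).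
Local Notation st := (stop D v).

Let p0 : 0 < p. Proof. exact: lt_trans p1. Qed.
Let q0 : 0 < q. Proof. exact: lt_le_trans pq. Qed.

Let stP Q : Q \in D -> [/\ st Q \in P, Q \subset st Q, v Q <= v (st Q) &
  forall G, G \in P -> Q \subset G -> st Q \subset G].
Proof. exact: stopP. Qed.

Let PD F : F \in P -> F \in D.
Proof. by case/principalP. Qed.

Let mo0 Q : Q \in D -> 0 < mass o Q.
Proof. by move=> QD; apply: mass_gt0 => //; case: lamD => _; exact. Qed.

(** The part of the operator made of the cubes whose smallest principal
    cube is [F]. *)
Let t F x := \sum_(Q in D | (st Q == F) && (x \in Q)) c Q / mass o Q.

Let t0 F x : 0 <= t F x.
Proof.
apply: sumr_ge0 => Q /andP[QD _]; rewrite divr_ge0//; exact/ltW/mo0.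
Qed.

Let t_out F x : x \notin F -> t F x = 0.
Proof.
move=> xF; rewrite /t big1// => Q /andP[QD /andP[/eqP QF xQ]].
have [_ /fintype.subsetP QS _ _] := stP QD; move: xF.
by rewrite -QF QS.
Qed.

Let t_norm F : F \in P ->
  \sum_x o x * t F x `^ q <= (K * mass s F `^ p^-1) `^ q.
Proof.
move=> FP; apply: le_trans (testing (PD FP)); apply: ler_sum => x _.
rewrite ler_pM2l// ler_powRl ?(ltW q0)// /t.
rewrite [leRHS](bigID (fun Q => st Q == F))/= [leLHS](eq_bigl (fun Q =>
  [&& Q \in D, x \in Q & Q \subset F] && (st Q == F))); last first.
  move=> Q; case QD : (Q \in D) => //=.
  have [_ QS _ _] := stP QD.
  by have [<-|] := eqVneq (st Q) F; rewrite ?QS ?andbT ?andbF.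
rewrite lerDl; apply: sumr_ge0 => Q /andP[/andP[QD _] _].
by rewrite divr_ge0//; exact/ltW/mo0.
Qed.

(** The principal cubes just below [F]. *)
Let child F G := [&& G \in P, G \proper F &
  [forall (H | H \in P), (G \proper H) ==> (F \subset H)]].

Let childP F G : child F G -> [/\ G \in P, G \proper F &
  forall H, H \in P -> G \proper H -> F \subset H].
Proof.
move=> /and3P[GP GF /forall_inP H]; split => // I IP GI.
by have := H _ IP; rewrite GI.
Qed.

(** The points of [F] that lie in no smaller principal cube. *)
Let core F x := (x \in F) && [forall (G | G \in P), (x \in G) ==> (F \subset G)].

Let coreP F x : core F x -> x \in F /\ forall G, G \in P -> x \in G -> F \subset G.
Proof.
move=> /andP[xF /forall_inP H]; split => // G GP xG.
by have := H _ GP; rewrite xG.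
Qed.

Let cover F x : F \in P -> x \in F ->
  core F x \/ exists2 G, child F G & x \in G.
Proof.
move=> FP xF; have [|] := boolP (core F x); first by left.
rewrite /core xF/= => /forall_inPn[G0 G0P]; rewrite negb_imply => /andP[xG0 FG0].
have comp G H : G \in P -> H \in P -> x \in G -> x \in H ->
    (G \subset H) || (H \subset G).
  by move=> GP HP; exact: (laminar_mem lamD (PD GP) (PD HP)).
have G0F : G0 \proper F.
  by rewrite properE FG0 andbT; have := comp _ _ FP G0P xF xG0; rewrite (negbTE FG0).
right; pose B := fun G => [&& G \in P, x \in G & G \proper F].
have BG0 : B G0 by rewrite /B G0P xG0.
case: (@arg_maxnP _ G0 B (fun G => #|G|) BG0) => G /and3P[GP xG GF] Gmax.
exists G => //; rewrite /child GP GF/=; apply/forall_inP => H HP.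
apply/implyP => GH; have xH := fintype.subsetP (proper_sub GH) _ xG.
have [//|FH] := boolP (F \subset H).
have HF : H \proper F.
  by rewrite properE FH andbT; have := comp _ _ FP HP xF xH; rewrite (negbTE FH).
have : (#|H| <= #|G|)%N by apply: Gmax; rewrite /B HP xH.
by rewrite leqNgt proper_card.
Qed.

(** A cube of [t F] inside a child of [F] would have that child, and not
    [F], above it; so the cubes of [t F] that meet a child contain it. *)
Let t_child F G x : F \in P -> child F G -> x \in G ->
  t F x = \sum_(Q in D | (st Q == F) && (G \subset Q)) c Q / mass o Q.
Proof.
move=> FP /childP[GP GF Gmax] xG; apply: eq_bigl => Q.
case QD : (Q \in D) => //=; have [SP QS _ Smin] := stP QD.
have [SF|//] := eqVneq (st Q) F; rewrite /=.
apply/idP/idP => [xQ|/fintype.subsetP/(_ _ xG)//].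
have /orP[//|QG] := laminar_mem lamD (PD GP) QD xG xQ.
have := Smin _ GP QG; rewrite SF => FG.
by move: GF; rewrite properE FG andbF.
Qed.

(** The constant value of [t F] on the child [G]. *)
Let tau F G := \sum_(Q in D | (st Q == F) && (G \subset Q)) c Q / mass o Q.

Let tau0 F G : 0 <= tau F G.
Proof.
apply: sumr_ge0 => Q /andP[QD _]; rewrite divr_ge0//; exact/ltW/mo0.
Qed.

Let core_mass F := \sum_(x | core F x) o x * g x `^ q'.
Let child_mass F := \sum_(G | child F G) mass s G * mean s f G `^ p.

(** Hölder's inequality on the core, and on the children after replacing
    [g] by its averages, which costs nothing because [t F] is constant on
    them. There [dominated] exchanges the averages of [g] for those of
    [f]. *)
Let pairing_at F : F \in P ->
  \sum_x o x * (t F x * g x) <=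
  K * mass s F `^ p^-1 *
    (core_mass F `^ q'^-1 + (L * child_mass F) `^ q'^-1).
Proof.
move=> FP; rewrite mulrDr.
have normF : (\sum_x o x * t F x `^ q) `^ q^-1 <= K * mass s F `^ p^-1.
  rewrite le_powRV ?invr_gt0//; last first.
  - by rewrite mulr_ge0// powR_ge0.
  - by apply: sumr_ge0 => x _; rewrite mulr_ge0 ?powR_ge0// ltW.
  by rewrite invrK; exact: t_norm.
have Ksp : 0 <= K * mass s F `^ p^-1 by rewrite mulr_ge0// powR_ge0.
have split_le : \sum_x o x * (t F x * g x) <=
    \sum_(x | core F x) o x * (t F x * g x) +
    \sum_(G | child F G) \sum_(x in G) o x * (t F x * g x).
  rewrite (exchange_big_dep predT)//= [X in _ <= X + _]big_mkcond/= -big_split/=.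
  apply: ler_sum => x _.
  have og : 0 <= o x * (t F x * g x) by rewrite mulr_ge0 ?mulr_ge0// ltW.
  have [xF|xF] := boolP (x \in F); last first.
    rewrite (t_out xF) mul0r mulr0 addr_ge0//; first by case: ifP.
    by apply: sumr_ge0.
  have [cF|[G GF xG]] := cover FP xF.
    by rewrite cF lerDl sumr_ge0.
  rewrite ler_wpDl//; first by case: ifP.
  by rewrite (bigD1 G) ?GF//= lerDl sumr_ge0.
apply: (le_trans split_le); apply: lerD.
  apply: (le_trans (hoelder_weighted q0 q'0 qq' _ _ _)) => //.
    by move=> x _; exact: ltW.
  rewrite ler_wpM2r ?powR_ge0//; apply: le_trans normF.
  rewrite ler_powRl ?invr_ge0 ?(ltW q0)//.
    by apply: sumr_ge0 => x _; rewrite mulr_ge0 ?powR_ge0// ltW.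
  rewrite [leRHS](bigID (core F))/= lerDl.
  by apply: sumr_ge0 => x _; rewrite mulr_ge0 ?powR_ge0// ltW.
rewrite (eq_bigr (fun G => mass o G * (tau F G * mean o g G))); last first.
  move=> G GF; have [GP _ _] := childP GF.
  under eq_bigr => x xG do rewrite (t_child FP GF xG) mulrCA.
  by rewrite -mulr_sumr mulrCA [mass o G * _]mulrC divfK ?lt0r_neq0 ?mo0 ?PD.
apply: (le_trans (hoelder_weighted q0 q'0 qq' _ _ _)).
- by move=> G /childP[GP _ _]; exact/ltW/mo0/PD.
- by move=> G _; exact: tau0.
- by move=> G _; exact: mean_ge0.
apply: ler_pM; rewrite ?powR_ge0//.
- apply: le_trans normF; rewrite ler_powRl ?invr_ge0 ?(ltW q0)//.
    apply: sumr_ge0 => G /childP[GP _ _]; rewrite mulr_ge0 ?powR_ge0//.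
    exact/ltW/mo0/PD.
  rewrite (eq_bigr (fun G => \sum_(x in G) o x * t F x `^ q)); last first.
    move=> G GF; rewrite mulr_suml; apply: eq_bigr => x xG.
    by rewrite (t_child FP GF xG).
  apply: sum_at_most_once => //.
    by move=> x _; rewrite mulr_ge0 ?powR_ge0// ltW.
  move=> G H x /childP[GP GF Gm] /childP[HP HF Hm] xG xH.
  apply/eqP; rewrite finset.eqEsubset.
  have /orP[sGH|sHG] := laminar_mem lamD (PD GP) (PD HP) xG xH.
  - have [//|nGH] := eqVneq G H; first by move=> ->; rewrite subxx.
    have /(Gm _ HP) FH : G \proper H by rewrite finset.properEneq nGH.
    by move: HF; rewrite properE FH andbF.
  - have [//|nHG] := eqVneq H G; first by move=> ->; rewrite subxx.
    have /(Hm _ GP) FG : H \proper G by rewrite finset.properEneq nHG.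
    by move: GF; rewrite properE FG andbF.
- rewrite ler_powRl ?invr_ge0 ?(ltW q'0)//.
    apply: sumr_ge0 => G /childP[GP _ _]; rewrite mulr_ge0 ?powR_ge0//.
    exact/ltW/mo0/PD.
  rewrite mulr_sumr; apply: ler_sum => G /childP[GP _ _].
  by rewrite mulrC [mass s G * _]mulrC; exact: dominated (PD GP).
Qed.

Let core_mass_sum : \sum_(F in P) core_mass F <= \sum_x o x * g x `^ q'.
Proof.
apply: (@sum_at_most_once _ _ _ _ _ predT) => //.
  by move=> x _; rewrite mulr_ge0 ?powR_ge0// ltW.
move=> F G x FP GP /coreP[xF Fm] /coreP[xG Gm].
by apply/eqP; rewrite finset.eqEsubset Fm// Gm.
Qed.

Let child_mass_sum : \sum_(F in P) child_mass F <=
  \sum_(F in P) mass s F * mean s f F `^ p.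
Proof.
apply: sum_at_most_once.
- by move=> F _; rewrite mulr_ge0 ?powR_ge0 ?mass_ge0.
- by move=> F G _ /childP[].
move=> F H G FP HP /childP[GP GF Fm] /childP[_ GH Hm].
by apply/eqP; rewrite finset.eqEsubset Fm// Hm.
Qed.

Let Nf := \sum_x s x * f x `^ p.
Let Ng := \sum_x o x * g x `^ q'.

(** Sorting cubes by their smallest principal cube replaces the average of
    [f] by the constant 2 v(F), up to which the sum is the pairing of [t
    F] with [g]. By [pairing_at] this is controlled by the testing
    condition on [F], by the core masses of [g], whose supports are
    disjoint, and by averages of [f] on principal cubes; the latter are
    summed by [carleson_embedding]. *)
Lemma embedding_half :
  \sum_(Q in D) c Q * (mean s f Q * mean o g Q) <=
  2 * K * (carleson_const p * Nf `^ p^-1) *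
  (Ng `^ q'^-1 + (L * (2 * carleson_const p) `^ p * Nf) `^ q'^-1).
Proof.
have C0 := carleson_const_gt0 p1.
have Nf0 : 0 <= Nf.
  by apply: sumr_ge0 => x _; rewrite mulr_ge0 ?powR_ge0// ltW.
have core0 F : 0 <= core_mass F.
  by apply: sumr_ge0 => x _; rewrite mulr_ge0 ?powR_ge0// ltW.
have child0 F : 0 <= child_mass F.
  by apply: sumr_ge0 => G _; rewrite mulr_ge0 ?powR_ge0 ?mass_ge0.
have lv0 F : 0 <= v F by exact/ltW/level_gt0.
have carl := carleson_embedding lamD s0 f0 mean0 p1.
have Hv : (\sum_(F in P) (v F * mass s F `^ p^-1) `^ q) `^ q^-1 <=
    carleson_const p * Nf `^ p^-1.
  have E F : (v F * mass s F `^ p^-1) `^ q = (v F `^ p * mass s F) `^ (q / p).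
    rewrite !powRM ?powR_ge0 ?mass_ge0// -!powRrM.
    by congr (_ `^ _ * _ `^ _); field; rewrite gt_eqF.
  under eq_bigr do rewrite E.
  have h : \sum_(F in P) (v F `^ p * mass s F) `^ (q / p) <=
      (carleson_const p `^ p * Nf) `^ (q / p).
    apply: (le_trans (sum_powR_le _ _)).
    - by rewrite ler_pdivlMr// mul1r.
    - by move=> F _; rewrite mulr_ge0 ?powR_ge0 ?mass_ge0.
    - rewrite ler_powRl ?divr_ge0 ?(ltW p0) ?(ltW q0)//.
      by apply: sumr_ge0 => F _; rewrite mulr_ge0 ?powR_ge0 ?mass_ge0.
  apply: (le_trans (ler_powRl _ _ h)).
  - by rewrite invr_ge0 ltW.
  - by apply: sumr_ge0 => F _; exact: powR_ge0.
  rewrite -powRrM (_ : q / p / q = p^-1); last by field; rewrite !gt_eqF.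
  by rewrite powRM ?powR_ge0// powRVK// ltW.
have step1 : \sum_(Q in D) c Q * (mean s f Q * mean o g Q) <=
    \sum_(F in P) 2 * v F * \sum_x o x * (t F x * g x).
  rewrite (partition_big st (mem P))/=; last by move=> Q /stP[].
  apply: ler_sum => F FP.
  have -> : \sum_x o x * (t F x * g x) =
      \sum_(Q in D | st Q == F) c Q * mean o g Q.
    under eq_bigr => x _ do rewrite mulrCA mulr_suml.
    rewrite (exchange_big_dep (fun Q => (Q \in D) && (st Q == F)))/=; last first.
      by move=> x Q _ /andP[-> /andP[->]].
    apply: eq_bigr => Q /andP[QD QF].
    rewrite (eq_bigl (fun x => x \in Q)); last first.
      by move=> x; rewrite QD QF.
    rewrite -mulr_sumr; rewrite /mean; field.
    by rewrite lt0r_neq0// mo0.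
  rewrite mulr_sumr; apply: ler_sum => Q /andP[QD /eqP QF].
  rewrite [leLHS]mulrCA [leRHS]mulrC [leLHS]mulrC.
  apply: ler_wpM2l; first by rewrite mulr_ge0// mean_ge0.
  apply: (le_trans (ltW (lt_dyadic_floor (mean0 QD)))); rewrite ler_pM2l//.
  by rewrite -QF; have [] := stP QD.
apply: (le_trans step1).
have step2 : \sum_(F in P) 2 * v F * \sum_x o x * (t F x * g x) <=
  \sum_(F in P) 2 * K * ((v F * mass s F `^ p^-1) *
    (core_mass F `^ q'^-1) + (v F * mass s F `^ p^-1) *
    (L * child_mass F) `^ q'^-1).
  apply: ler_sum => F FP.
  apply: (le_trans (ler_wpM2l _ (pairing_at FP))); first by rewrite mulr_ge0.
  by rewrite le_eqVlt; apply/orP; left; apply/eqP; ring.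
apply: (le_trans step2).
rewrite -mulr_sumr -[leRHS]mulrA ler_wpM2l ?mulr_ge0// big_split/= mulrDr.
have vs0 F : 0 <= v F * mass s F `^ p^-1 by rewrite mulr_ge0 ?powR_ge0.
have fold (h : {set T} -> R) N : (forall F, 0 <= h F) -> \sum_(F in P) h F <= N ->
    \sum_(F in P) v F * mass s F `^ p^-1 * h F `^ q'^-1 <=
    carleson_const p * Nf `^ p^-1 * N `^ q'^-1.
  move=> h0 hN.
  apply: (le_trans (hoelder_sum q0 q'0 qq' _ _)) => //.
    by move=> F _; exact: powR_ge0.
  apply: ler_pM; rewrite ?powR_ge0// ler_powRl ?invr_ge0 ?(ltW q'0)//.
    by apply: sumr_ge0 => F _; exact: powR_ge0.
  by under eq_bigr do rewrite powRKV//.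
apply: lerD; apply: fold => //.
- by move=> F; rewrite mulr_ge0.
- rewrite -mulr_sumr -mulrA ler_wpM2l//.
  apply: (le_trans child_mass_sum).
  rewrite powRM ?(ltW C0)// -mulrA; apply: le_trans (ler_wpM2l _ carl).
  + rewrite mulr_sumr; apply: ler_sum => F FP.
    rewrite mulrC mulrA ler_wpM2r ?mass_ge0// -powRM//.
    rewrite ler_powRl ?(ltW p0) ?mean_ge0//.
    exact/ltW/lt_dyadic_floor/mean0/PD.
  + exact: powR_ge0.
Qed.

End embedding_half.

Section bilinear_embedding.
Context {R : realType} {T : finType}.
Implicit Types (F G Q : {set T}) (p q : R).

Definition embedding_const p q' : R :=
  2 * carleson_const p * (1 + ((2 * carleson_const p) `^ p) `^ q'^-1).

Lemma embedding_const_gt0 p q' : 1 < p -> 0 < embedding_const p q'.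
Proof.
move=> p1; have C0 := carleson_const_gt0 p1.
by rewrite mulr_gt0 ?mulr_gt0// ltr_pwDl// powR_ge0.
Qed.

Lemma weighted_sum_eq0 (s f : T -> R) (p : R) Q : (forall x, 0 < s x) ->
  \sum_x s x * f x `^ p = 0 -> mean s f Q = 0.
Proof.
move=> s0 N0; rewrite /mean big1 ?mul0r// => x _.
have /(psumr_eq0P (F := fun x => s x * f x `^ p)) :
    forall x, true -> 0 <= s x * f x `^ p.
  by move=> y _; rewrite mulr_ge0 ?powR_ge0// ltW.
move=> /(_ N0 x isT)/eqP; rewrite mulf_eq0 gt_eqF//= => /eqP/powR_eq0_eq0 ->.
by rewrite mulr0.
Qed.

(** [embedding_half] for the cubes on which [f] dominates [g], at the
    ratio that makes the two energies of equal size. *)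
Let half (D : {set {set T}}) (s o f g : T -> R) (c : {set T} -> R)
    (p q q' K Nf Ng : R) :
  laminar D -> (forall x, 0 < s x) -> (forall x, 0 < o x) ->
  (forall x, 0 <= f x) -> (forall x, 0 <= g x) -> (forall Q, 0 <= c Q) ->
  1 < p -> p <= q -> 0 < q' -> q^-1 + q'^-1 = 1 -> 0 <= K ->
  {in D, forall F,
    \sum_x o x * (\sum_(Q in D | (x \in Q) && (Q \subset F)) c Q / mass o Q) `^ q
    <= (K * mass s F `^ p^-1) `^ q} ->
  \sum_x s x * f x `^ p = Nf -> \sum_x o x * g x `^ q' = Ng ->
  0 < Nf -> 0 < Ng ->
  \sum_(Q in D | (0 < mean s f Q) && (mean o g Q `^ q' * mass o Q <=
     Ng / Nf * (mean s f Q `^ p * mass s Q))) c Q * (mean s f Q * mean o g Q) <=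
  K * embedding_const p q' * (Nf `^ p^-1 * Ng `^ q'^-1).
Proof.
move=> lamD s0 o0 f0 g0 c0 p1 pq q'0 qq' K0 test fE gE Nf0 Ng0.
have q0 : 0 < q by rewrite (lt_le_trans _ pq)// (lt_trans _ p1).
pose D' := [set Q in D | (0 < mean s f Q) && (mean o g Q `^ q' * mass o Q <=
     Ng / Nf * (mean s f Q `^ p * mass s Q))].
have D'D : D' \subset D by apply/fintype.subsetP => Q; rewrite inE => /andP[].
rewrite (eq_bigl (fun Q => Q \in D')); last by move=> Q; rewrite inE.
apply: (le_trans (@embedding_half _ _ D' s o f g c p q q' (Ng / Nf) K
  _ _ _ _ _ _ _ _ _ _ _ _ _ _ _)) => //.
- exact: laminarS lamD.
- by rewrite divr_ge0// ltW.
- by move=> Q; rewrite inE => /and3P[].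
- by move=> Q; rewrite inE => /and3P[].
- move=> F FD'; have FD := fintype.subsetP D'D _ FD'.
  apply: le_trans (test _ FD); apply: ler_sum => x _.
  rewrite ler_pM2l// ler_powRl ?(ltW q0)//.
    by apply: sumr_ge0 => Q _; rewrite divr_ge0 ?mass_ge0.
  rewrite [leRHS](bigID (fun Q => Q \in D'))/= [leLHS](eq_bigl (fun Q =>
    [&& Q \in D, x \in Q & Q \subset F] && (Q \in D'))); last first.
    move=> Q; have [QD'|] := boolP (Q \in D'); last by rewrite andbF.
    by rewrite (fintype.subsetP D'D _ QD')/= andbT.
  by rewrite lerDl sumr_ge0// => Q _; rewrite divr_ge0 ?mass_ge0.
rewrite fE gE [Ng / Nf * _ * Nf]mulrAC divfK ?lt0r_neq0//.
have C0 := carleson_const_gt0 p1.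
rewrite [(Ng * _) `^ _]powRM ?powR_ge0 ?(ltW Ng0)//.
by rewrite le_eqVlt; apply/orP; left; apply/eqP; rewrite /embedding_const; ring.
Qed.

(** On every cube one of the two normalized energies dominates the other.
    Both cases are instances of [half], the second one with the two
    weights, the two functions and the dual exponents exchanged. *)
Lemma bilinear_embedding (D : {set {set T}}) (s o f g : T -> R)
    (c : {set T} -> R) (p p' q q' K1 K2 : R) :
  laminar D -> (forall x, 0 < s x) -> (forall x, 0 < o x) ->
  (forall x, 0 <= f x) -> (forall x, 0 <= g x) -> (forall Q, 0 <= c Q) ->
  1 < p -> p <= q -> 1 < q' -> 0 < p' ->
  p^-1 + p'^-1 = 1 -> q^-1 + q'^-1 = 1 -> 0 <= K1 -> 0 <= K2 ->
  {in D, forall F,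
    \sum_x o x * (\sum_(Q in D | (x \in Q) && (Q \subset F)) c Q / mass o Q) `^ q
    <= (K1 * mass s F `^ p^-1) `^ q} ->
  {in D, forall F,
    \sum_x s x * (\sum_(Q in D | (x \in Q) && (Q \subset F)) c Q / mass s Q) `^ p'
    <= (K2 * mass o F `^ q'^-1) `^ p'} ->
  \sum_(Q in D) c Q * (mean s f Q * mean o g Q) <=
  (K1 * embedding_const p q' + K2 * embedding_const q' p) *
  ((\sum_x s x * f x `^ p) `^ p^-1 * (\sum_x o x * g x `^ q') `^ q'^-1).
Proof.
move=> lamD s0 o0 f0 g0 c0 p1 pq q'1 p'0 pp' qq' K10 K20 test1 test2.
have p0 : 0 < p by rewrite (lt_trans _ p1).
have q0 : 0 < q by rewrite (lt_le_trans _ pq).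
have q'0 : 0 < q' by rewrite (lt_trans _ q'1).
have q'p' : q' <= p'.
  rewrite -lef_pV2 ?posrE//.
  have -> : p'^-1 = 1 - p^-1 by rewrite -pp' addrC addKr.
  have -> : q'^-1 = 1 - q^-1 by rewrite -qq' addrC addKr.
  by rewrite lerD2l lerN2 lef_pV2.
move fE : (\sum_x s x * f x `^ p) => Nf.
move gE : (\sum_x o x * g x `^ q') => Ng.
have Nf_ge0 : 0 <= Nf.
  by rewrite -fE; apply: sumr_ge0 => x _; rewrite mulr_ge0 ?powR_ge0// ltW.
have Ng_ge0 : 0 <= Ng.
  by rewrite -gE; apply: sumr_ge0 => x _; rewrite mulr_ge0 ?powR_ge0// ltW.
have e1 := embedding_const_gt0 q' p1; have e2 := embedding_const_gt0 p q'1.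
have rhs0 : 0 <= (K1 * embedding_const p q' + K2 * embedding_const q' p) *
    (Nf `^ p^-1 * Ng `^ q'^-1).
  apply: mulr_ge0; last by apply: mulr_ge0; exact: powR_ge0.
  apply: addr_ge0.
    exact: (mulr_ge0 K10 (ltW e1)).
  exact: (mulr_ge0 K20 (ltW e2)).
have [Nf00|Nf0] := eqVneq Nf 0.
  rewrite big1 => [|Q _]; last first.
    by rewrite (weighted_sum_eq0 Q s0 (etrans fE Nf00)) mul0r mulr0.
  exact: rhs0.
have [Ng00|Ng0] := eqVneq Ng 0.
  rewrite big1 => [|Q _]; last first.
    by rewrite (weighted_sum_eq0 Q o0 (etrans gE Ng00)) !mulr0.
  exact: rhs0.
have {Nf_ge0}Nf0 : 0 < Nf by rewrite lt_neqAle eq_sym Nf0.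
have {Ng_ge0}Ng0 : 0 < Ng by rewrite lt_neqAle eq_sym Ng0.
have H1 := half lamD s0 o0 f0 g0 c0 p1 pq q'0 qq' K10 test1 fE gE Nf0 Ng0.
have H2 := half lamD o0 s0 g0 f0 c0 q'1 q'p' p0 _ K20 test2 gE fE Ng0 Nf0.
rewrite mulrDl; apply: le_trans (lerD H1 _); last first.
  by rewrite [X in _ * X]mulrC; apply: H2; rewrite addrC.
rewrite [X in _ <= _ + X]big_mkcondr/= [X in _ <= X + _]big_mkcondr/=.
rewrite -big_split/=; apply: ler_sum => Q QD.
have ms : 0 < mass s Q by apply: mass_gt0 => //; case: lamD => _; exact.
have mo : 0 < mass o Q by apply: mass_gt0 => //; case: lamD => _; exact.
have ef : 0 <= mean s f Q by exact: mean_ge0.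
have eg : 0 <= mean o g Q by exact: mean_ge0.
have ceg : 0 <= c Q * (mean s f Q * mean o g Q) by apply: mulr_ge0 => //; exact: mulr_ge0.
have ceg' : 0 <= c Q * (mean o g Q * mean s f Q) by apply: mulr_ge0 => //; exact: mulr_ge0.
have [f00|fn0] := eqVneq (mean s f Q) 0.
  by rewrite f00 !(mul0r, mulr0) !if_same addr0.
have [g00|gn0] := eqVneq (mean o g Q) 0.
  by rewrite g00 !(mul0r, mulr0) !if_same addr0.
have fp : 0 < mean s f Q by rewrite lt_neqAle eq_sym fn0.
have gp : 0 < mean o g Q by rewrite lt_neqAle eq_sym gn0.
rewrite fp gp /=.
case: ifPn => [_|]; first by rewrite lerDl; case: ifP.
rewrite -ltNge => /ltW H; rewrite ifT ?add0r 1?[X in c Q * X]mulrC//.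
rewrite -(ler_pM2l (divr_gt0 Ng0 Nf0)); apply: (le_trans H).
by rewrite !mulrA divfK ?lt0r_neq0// divff ?lt0r_neq0// mul1r.
Qed.

End bilinear_embedding.

(** * Testing sums of a Muckenhoupt pair *)

Section chain_powers.
Context {R : realType} {T : finType}.
Implicit Types (D S : {set {set T}}) (F G Q : {set T}).

(** The mean value inequality for the power N + 1. *)
Lemma exprD_le (a b : R) N : 0 <= a -> 0 <= b ->
  (a + b) ^+ N.+1 <= b ^+ N.+1 + N.+1%:R * (a * (a + b) ^+ N).
Proof.
move=> a0 b0; have ab0 : 0 <= a + b by exact: addr_ge0.
elim: N => [|N IHN]; first by rewrite !expr1 expr0 mulr1 mul1r addrC.
rewrite exprS mulrDl.
have H : b * (a + b) ^+ N.+1 <=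
    b ^+ N.+2 + N.+1%:R * (a * (a + b) ^+ N.+1).
  apply: (le_trans (ler_wpM2l b0 IHN)); rewrite mulrDr -exprS lerD2l.
  rewrite mulrCA ler_wpM2l// mulrCA ler_wpM2l// exprS ler_wpM2r ?exprn_ge0//.
  by rewrite lerDr.
apply: (le_trans (lerD (lexx _) H)).
by rewrite le_eqVlt; apply/orP; left; apply/eqP; rewrite -[in RHS]natr1; ring.
Qed.

(** The discrete form of the fact that the primitive of (N + 1) z Z^N is
    Z^(N+1) when Z' = z: remove the largest set and apply [exprD_le]. *)
Lemma chain_sum_expr S (z : {set T} -> R) N :
  (forall Q, 0 <= z Q) ->
  {in S &, forall Q G, (Q \subset G) || (G \subset Q)} ->
  (\sum_(Q in S) z Q) ^+ N.+1 <=
  N.+1%:R * \sum_(Q in S) z Q * (\sum_(G in S | G \subset Q) z G) ^+ N.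
Proof.
move=> z0; move: {2}#|S| (erefl #|S|) => k; elim: k S => [|k IHk] S.
  move=> /eqP; rewrite cards_eq0 => /eqP-> _.
  by rewrite !big_set0 expr0n mulr0.
move=> Sk chS; have [M0 M0S] : exists Q : {set T}, Q \in S.
  by apply/card_gt0P; rewrite Sk.
case: (@arg_maxnP _ M0 (fun Q => Q \in S) (fun Q => #|Q|) M0S) => M /= MS Mmax.
have SM Q : Q \in S -> Q \subset M.
  move=> QS; have /orP[//|MQ] := chS _ _ QS MS.
  have := Mmax _ QS; move=> /= QM.
  by have /eqP-> : M == Q by rewrite eqEcard MQ.
have IH : (\sum_(Q in S :\ M) z Q) ^+ N.+1 <= N.+1%:R *
    \sum_(Q in S :\ M) z Q * (\sum_(G in S :\ M | G \subset Q) z G) ^+ N.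
  apply: IHk; first by move: Sk; rewrite (cardsD1 M S) MS => -[].
  by move=> Q G; rewrite !inE => /andP[_ QS] /andP[_ GS]; exact: chS.
rewrite (big_setD1 M)//= [X in _ <= _ * X](big_setD1 M)//=.
apply: (le_trans (exprD_le _ _ _)) => //; first exact: sumr_ge0.
rewrite mulrDr addrC; apply: lerD.
  rewrite ler_wpM2l// ler_wpM2l// le_eqVlt; apply/orP; left; apply/eqP.
  congr (_ ^+ _); rewrite -(big_setD1 M)//=; apply: eq_bigl => Q.
  by case QS : (Q \in S); rewrite //= SM.
apply: (le_trans IH); rewrite ler_wpM2l//; apply: ler_sum => Q QSM.
rewrite ler_wpM2l// lerXn2r ?nnegrE ?sumr_ge0//.
rewrite [leLHS]big_mkcondr [leRHS]big_mkcondr/= [leRHS](big_setD1 M)//= lerDr.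
by case: ifP.
Qed.

(** The cubes through a point form a chain, so that [chain_sum_expr]
    applies at each point; exchanging the sums gives the power N over
    smaller cubes. *)
Lemma iterated_chain_sum D (o : T -> R) (z : {set T} -> R) N F :
  laminar D -> (forall x, 0 < o x) -> (forall Q, 0 <= z Q) ->
  \sum_(x in F) o x * (\sum_(Q in D | (x \in Q) && (Q \subset F)) z Q) ^+ N.+1
  <= N.+1%:R * \sum_(Q in D | Q \subset F) z Q *
    \sum_(x in Q) o x * (\sum_(G in D | (x \in G) && (G \subset Q)) z G) ^+ N.
Proof.
move=> lamD o0 z0.
under [X in _ <= _ * X]eq_bigr do rewrite mulr_sumr.
rewrite (exchange_big_dep (fun x => x \in F))/=; last first.
  by move=> Q x /andP[_ /fintype.subsetP QF] /QF.
rewrite mulr_sumr; apply: ler_sum => x xF.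
pose S := [set Q in D | (x \in Q) && (Q \subset F)].
have chS : {in S &, forall Q G, (Q \subset G) || (G \subset Q)}.
  move=> Q G; rewrite !inE => /and3P[QD xQ _] /and3P[GD xG _].
  exact: (laminar_mem lamD QD GD xQ xG).
have H := chain_sum_expr N z0 chS.
rewrite (eq_bigl (fun Q => Q \in S)); last by move=> Q; rewrite inE.
apply: (le_trans (ler_wpM2l (ltW (o0 x)) H)); rewrite mulrCA.
rewrite ler_wpM2l// mulr_sumr.
rewrite [leLHS](eq_bigl (fun Q => [&& Q \in D, Q \subset F & x \in Q])); last first.
  by move=> Q; rewrite inE [(_ \subset _) && _]andbC.
rewrite [leRHS](eq_bigl (fun Q => [&& Q \in D, Q \subset F & x \in Q])); last first.
  by move=> Q; rewrite andbA.
apply: ler_sum => Q /and3P[QD QF xQ].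
rewrite mulrCA ler_wpM2l// ler_wpM2l ?(ltW (o0 _))//.
rewrite lerXn2r ?nnegrE ?sumr_ge0//.
rewrite [leLHS](eq_bigl (fun G => [&& G \in D, x \in G & G \subset Q])) //.
move=> G; rewrite inE; case: (G \in D) => //=; case: (x \in G) => //=.
by case GQ : (G \subset Q); rewrite ?andbF ?andbT// (fintype.subset_trans GQ).
Qed.

(** The sums over the cubes through a given point are geometric. *)
Lemma nested_sum D (o : T -> R) (v : {set T} -> R) k F :
  laminar D -> (forall x, 0 < o x) -> (forall Q, 0 <= v Q) -> 0 <= k < 1 ->
  {in D &, forall Q G, Q \proper G -> v Q <= k * v G} -> F \in D ->
  \sum_(Q in D | Q \subset F) v Q * mass o Q <= v F / (1 - k) * mass o F.
Proof.
move=> lamD o0 v0 k01 vk FD.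
rewrite (eq_bigr (fun Q => \sum_(x in Q) v Q * o x)); last first.
  by move=> Q _; rewrite mulr_sumr.
rewrite (exchange_big_dep (fun x => x \in F))/=; last first.
  by move=> Q x /andP[_ /fintype.subsetP QF] /QF.
rewrite [leRHS]mulr_sumr; apply: ler_sum => x xF.
rewrite -mulr_suml ler_wpM2r ?(ltW (o0 _))//.
rewrite (eq_bigl (fun Q => Q \in [set Q in D | (Q \subset F) && (x \in Q)])); last first.
  by move=> Q; rewrite inE andbA.
have /andP[k0 k1] := k01.
apply: geometric_sum => // [Q|Q G].
- rewrite inE => /and3P[QD QF xQ]; rewrite v0/=.
  have [->//|nQF] := eqVneq Q F.
  have /(vk _ _ QD FD) H : Q \proper F by rewrite finset.properEneq nQF.
  by apply: (le_trans H); rewrite ler_piMl// ltW.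
- rewrite !inE => /and3P[QD _ xQ] /and3P[GD _ xG] nQG.
  have /orP[sQG|sGQ] := laminar_mem lamD QD GD xQ xG.
  + by left; apply: vk => //; rewrite finset.properEneq nQG.
  + by right; apply: vk => //; rewrite finset.properEneq eq_sym nQG.
Qed.

End chain_powers.

Section monomials.
Context {R : realType} {T : finType}.
Implicit Types (F G Q : {set T}).
Variables (D : {set {set T}}) (m s o : T -> R).
Hypothesis lamD : laminar D.
Hypothesis m0 : forall x, 0 < m x.
Hypothesis s0 : forall x, 0 < s x.
Hypothesis o0 : forall x, 0 < o x.
Hypothesis halving : {in D &, forall Q G, Q \proper G ->
  2 * mass m Q <= mass m G}.
(** m(Q)^a o(Q)^b s(Q)^c, as one exponential so that exponents combine
    linearly and no sign has to be followed. *)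
Definition monomial Q (a b c : R) : R :=
  expR (a * ln (mass m Q) + b * ln (mass o Q) + c * ln (mass s Q)).

Lemma monomial_ge0 Q a b c : 0 <= monomial Q a b c.
Proof. exact: expR_ge0. Qed.

Lemma monomialM Q a b c a' b' c' :
  monomial Q a b c * monomial Q a' b' c' =
  monomial Q (a + a') (b + b') (c + c').
Proof. by rewrite /monomial -expRD; congr expR; ring. Qed.

Let mp (w : T -> R) Q : (forall x, 0 < w x) -> Q \in D -> 0 < mass w Q.
Proof. by move=> w0 QD; apply: mass_gt0 => //; case: lamD => _; exact. Qed.

Lemma monomialE Q a b c : Q \in D ->
  monomial Q a b c = mass m Q `^ a * mass o Q `^ b * mass s Q `^ c.
Proof.
move=> QD; rewrite /powR !gt_eqF ?mp// -!expRD//.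
Qed.

Let powR_split (x e : R) : 0 < x -> x `^ e = x * x `^ (e - 1).
Proof.
move=> x0; rewrite -{2}(powRr1 (ltW x0)) -powRD; last by rewrite (gt_eqF x0) implybT.
by congr (_ `^ _); ring.
Qed.

Lemma powR_volume_decay (e : R) : 0 < e ->
  {in D &, forall Q G, Q \proper G ->
    mass m Q `^ e <= 2 `^ (- e) * mass m G `^ e}.
Proof.
move=> e0 Q G QD GD QG; rewrite mulrC powRN ler_pdivlMr ?powR_gt0//.
rewrite -powRM ?mass_ge0// ler_powRl ?(ltW e0) ?mulr_ge0 ?mass_ge0//.
by rewrite mulrC; exact: halving.
Qed.

(** The ratios X = o(Q)/o(F) and Y = s(Q)/s(F) are at most 1 and b + c is
    at least 1, so X^b Y^c <= X + Y. The monomial is thus replaced by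
    terms that are additive in one of the two measures, and the positive
    power of the volume makes their sum geometric. *)
Lemma monomial_sum (e b c : R) F : 0 < e -> 0 <= b -> 0 <= c -> 1 <= b + c ->
  F \in D ->
  \sum_(Q in D | Q \subset F) monomial Q e b c <=
  2 / (1 - 2 `^ (- e)) * monomial F e b c.
Proof.
move=> e0 b0 c0 bc FD.
have k01 := powR2N_lt1 e0.
have step Q : Q \in D -> Q \subset F -> monomial Q e b c <=
    mass m Q `^ e * mass o Q * (mass o F `^ (b - 1) * mass s F `^ c) +
    mass m Q `^ e * mass s Q * (mass o F `^ b * mass s F `^ (c - 1)).
  move=> QD QF; rewrite monomialE// -!mulrA -mulrDr ler_wpM2l ?powR_ge0//.
  have oQ := mp o0 QD; have sQ := mp s0 QD.
  have oF := mp o0 FD; have sF := mp s0 FD.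
  set X := mass o Q / mass o F; set Y := mass s Q / mass s F.
  have X1 : 0 <= X <= 1.
    by rewrite /X divr_ge0 ?mass_ge0//= ler_pdivrMr// mul1r ler_mass.
  have Y1 : 0 <= Y <= 1.
    by rewrite /Y divr_ge0 ?mass_ge0//= ler_pdivrMr// mul1r ler_mass.
  have XY : X `^ b * Y `^ c <= X + Y.
    wlog XY : X Y X1 Y1 b c b0 c0 bc / X <= Y => [H|].
      have [XY|/ltW YX] := leP X Y; first exact: H.
      by rewrite mulrC addrC; apply: H => //; rewrite addrC.
    move: X1 Y1 => /andP[X0 X1] /andP[Y0 Y1].
    have [Y00|Yn0] := eqVneq Y 0.
      have X00 : X = 0 by apply/eqP; rewrite eq_le X0 -Y00 XY.
      rewrite X00 Y00 addr0; have [b00|bn0] := eqVneq b 0.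
        have cn0 : c != 0 by apply/eqP => c00; move: bc; rewrite b00 c00 addr0 ler10.
        by rewrite (powR0 cn0) mulr0.
      by rewrite (powR0 bn0) mul0r.
    have Yp : 0 < Y by rewrite lt_neqAle eq_sym Yn0.
    apply: (@le_trans _ _ (Y `^ b * Y `^ c)).
      by rewrite ler_wpM2r ?powR_ge0// ler_powRl.
    rewrite -powRD; last by rewrite Yn0 implybT.
    apply: (@le_trans _ _ Y); last by rewrite lerDr.
    by apply: ge1r_powR; rewrite ?Yp.
  have -> : mass o Q `^ b * mass s Q `^ c =
      X `^ b * Y `^ c * (mass o F `^ b * mass s F `^ c).
    rewrite mulrACA -!powRM ?mass_ge0 ?divfK ?lt0r_neq0 ?divr_ge0 ?mass_ge0//.
  apply: (le_trans (ler_wpM2r _ XY)); first by rewrite mulr_ge0 ?powR_ge0.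
  rewrite mulrDl le_eqVlt; apply/orP; left; apply/eqP; congr (_ + _).
  - by rewrite (powR_split b oF) /X; field; exact: lt0r_neq0.
  - by rewrite (powR_split c sF) /Y; field; exact: lt0r_neq0.
apply: (@le_trans _ _ (\sum_(Q in D | Q \subset F)
   (mass m Q `^ e * mass o Q * (mass o F `^ (b - 1) * mass s F `^ c) +
    mass m Q `^ e * mass s Q * (mass o F `^ b * mass s F `^ (c - 1))))).
  by apply: ler_sum => Q /andP[QD QF]; exact: step.
rewrite big_split/= -!mulr_suml.
have v0 Q : 0 <= mass m Q `^ e by exact: powR_ge0.
have N (w : T -> R) : (forall x, 0 < w x) ->
    \sum_(Q in D | Q \subset F) mass m Q `^ e * mass w Q <=
    mass m F `^ e / (1 - 2 `^ (- e)) * mass w F.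
  by move=> w0; apply: nested_sum => //; exact: powR_volume_decay.
apply: (le_trans (lerD (ler_wpM2r _ (N _ o0)) (ler_wpM2r _ (N _ s0)))).
- by rewrite mulr_ge0 ?powR_ge0.
- by rewrite mulr_ge0 ?powR_ge0.
rewrite monomialE// [in leRHS](powR_split b (mp o0 FD)) le_eqVlt.
apply/orP; left; apply/eqP.
have -> : mass o F `^ b = mass o F * mass o F `^ (b - 1).
  exact: powR_split (mp o0 FD).
have -> : mass s F `^ c = mass s F * mass s F `^ (c - 1).
  exact: powR_split (mp s0 FD).
by ring.
Qed.

End monomials.

Section testing.
Context {R : realType} {T : finType}.
Implicit Types (F G Q : {set T}).
Variables (D : {set {set T}}) (m s o : T -> R) (A rho : R).
Hypothesis lamD : laminar D.
Hypothesis m0 : forall x, 0 < m x.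
Hypothesis s0 : forall x, 0 < s x.
Hypothesis o0 : forall x, 0 < o x.
Hypothesis halving : {in D &, forall Q G : {set T}, Q \proper G ->
  2 * mass m Q <= mass m G}.
Hypothesis A0 : 0 < A.
Hypothesis muckenhoupt : {in D, forall Q : {set T},
  mass o Q / mass m Q * (mass s Q / mass m Q) `^ rho <= A}.

Local Notation M := (monomial m s o).

Let monomial_eq Q a b c a' b' c' : a = a' -> b = b' -> c = c' ->
  M Q a b c = M Q a' b' c'.
Proof. by move=> -> -> ->. Qed.

Let mp (w : T -> R) Q : (forall x, 0 < w x) -> Q \in D -> 0 < mass w Q.
Proof. by move=> w0 QD; apply: mass_gt0 => //; case: lamD => _; exact. Qed.

Let Apow a b : A `^ (a + b) = A `^ a * A `^ b.
Proof. by rewrite powRD// (gt_eqF A0) implybT. Qed.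

(** The power theta of the Muckenhoupt condition, which trades masses of
    the two weights against volume. *)
Lemma monomial_trade Q a b c theta : 0 <= theta -> Q \in D ->
  M Q a b c <= A `^ theta * M Q (a + theta * (1 + rho)) (b - theta) (c - theta * rho).
Proof.
move=> th0 QD; have mQ := mp m0 QD; have oQ := mp o0 QD; have sQ := mp s0 QD.
have H : ln (mass o Q) - ln (mass m Q) + rho * (ln (mass s Q) - ln (mass m Q))
    <= ln A.
  rewrite -!ln_div ?posrE// -ln_powR -lnM ?posrE ?divr_gt0 ?powR_gt0 ?divr_gt0//.
  rewrite ler_ln ?posrE//; first exact: muckenhoupt.
  by rewrite mulr_gt0 ?powR_gt0 ?divr_gt0.
rewrite /powR gt_eqF// -expRD ler_expR.
have := ler_wpM2l th0 H; lra.
Qed.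

(** Induction with [iterated_chain_sum]. Each step pays A^theta to make
    the exponent of the volume positive, as [monomial_sum] requires; the
    other hypotheses keep the exponents of the two weights nonnegative,
    with a sum of at least 1, during all the steps. *)
Lemma chain_moment (beta delta theta e f : R) (N : nat) :
  0 < delta * (beta - e - f) + theta * (1 + rho) ->
  theta * (1 + rho) <= delta * (e + f) ->
  0 <= theta -> theta * rho <= delta * f ->
  (forall i, (i <= N)%N -> 0 <= 1 + i%:R * (delta * e - theta)) ->
  forall i F, (i <= N)%N -> F \in D ->
  \sum_(x in F) o x * (\sum_(Q in D | (x \in Q) && (Q \subset F))
     M Q (delta * (beta - e - f)) (delta * e) (delta * f)) ^+ i <=
  (\prod_(j < i) (j.+1%:R * (2 / (1 - 2 `^ (- (j.+1%:R *
     (delta * (beta - e - f) + theta * (1 + rho)))))))) * A `^ (i%:R * theta) *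
  M F (i%:R * (delta * (beta - e - f) + theta * (1 + rho)))
    (1 + i%:R * (delta * e - theta)) (i%:R * (delta * f - theta * rho)).
Proof.
set a1 := delta * (beta - e - f) + theta * (1 + rho).
move=> a10 bc th0 c0 b0; elim=> [|i IHi] F iN FD.
  under eq_bigr do rewrite expr0 mulr1.
  rewrite big_ord0 !mul0r powRr0 !mul1r addr0 (monomialE lamD m0 s0 o0 _ _ _ FD) !powRr0 mul1r mulr1.
  by rewrite powRr1// mass_ge0.
have k0 : 0 <= 2 / (1 - 2 `^ (- (i.+1%:R * a1))) :> R.
  have /andP[_ k1] := @powR2N_lt1 R (i.+1%:R * a1) (mulr_gt0 (ltr0Sn _ _) a10).
  by rewrite divr_ge0// subr_ge0 ltW.
set z := fun Q => M Q (delta * (beta - e - f)) (delta * e) (delta * f).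
have z0 Q : 0 <= z Q by exact: monomial_ge0.
apply: (le_trans (iterated_chain_sum i F lamD o0 z0)).
rewrite big_ord_recr/=.
set P := \prod_(j < i) _.
have P0 : 0 <= P.
  apply: prodr_ge0 => j _; rewrite mulr_ge0// divr_ge0// subr_ge0.
  have /andP[_ k1] := @powR2N_lt1 R (j.+1%:R * a1) (mulr_gt0 (ltr0Sn _ _) a10).
  by rewrite ltW.
have step : \sum_(Q in D | Q \subset F) z Q *
    (\sum_(x in Q) o x * (\sum_(G in D | (x \in G) && (G \subset Q)) z G) ^+ i) <=
    P * A `^ (i.+1%:R * theta) *
    \sum_(Q in D | Q \subset F) M Q (i.+1%:R * a1) (1 + i.+1%:R * (delta * e - theta))
      (i.+1%:R * (delta * f - theta * rho)).
  rewrite mulr_sumr; apply: ler_sum => Q /andP[QD QF].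
  apply: (le_trans (ler_wpM2l (z0 _) (IHi Q (ltnW iN) QD))).
  rewrite mulrCA -!mulrA ler_wpM2l// /z monomialM.
  have -> : A `^ (i.+1%:R * theta) = A `^ (i%:R * theta) * A `^ theta.
    by rewrite -Apow -natr1; congr (_ `^ _); ring.
  rewrite -mulrA ler_wpM2l ?powR_ge0//.
  apply: (le_trans (monomial_trade _ _ _ th0 QD)).
  rewrite ler_wpM2l ?powR_ge0// le_eqVlt; apply/orP; left; apply/eqP.
  by apply: monomial_eq; rewrite -natr1 /a1; ring.
apply: (le_trans (ler_wpM2l _ step)); first by rewrite ler0n.
rewrite (_ : P * (i.+1%:R * (2 / (1 - 2 `^ (- (i.+1%:R * a1))))) *
   A `^ (i.+1%:R * theta) * M F (i.+1%:R * a1)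
     (1 + i.+1%:R * (delta * e - theta)) (i.+1%:R * (delta * f - theta * rho)) =
   i.+1%:R * (P * A `^ (i.+1%:R * theta) * ((2 / (1 - 2 `^ (- (i.+1%:R * a1)))) *
     M F (i.+1%:R * a1) (1 + i.+1%:R * (delta * e - theta))
       (i.+1%:R * (delta * f - theta * rho))))); last by ring.
rewrite ler_wpM2l ?ler0n// ler_wpM2l ?mulr_ge0 ?powR_ge0//.
apply: monomial_sum => //.
- by rewrite mulr_gt0.
- exact: b0.
- by rewrite mulr_ge0// subr_ge0.
- rewrite -addrA lerDl -mulrDr mulr_ge0//; move: bc; lra.
Qed.

End testing.

Section testing_bound.
Context {R : realType}.

(** For an integer N > q, the terms are written as powers z_Q^(N/q), and
    since N/q > 1 the q-th power of their sum is at most the N-th power of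
    the sum of the z_Q, to which [iterated_chain_sum] and [chain_moment]
    apply. Slightly more than kappa / N is paid at each of the first N - 1
    steps, and the last one spends exactly what is left of kappa, which
    makes the exponents of the volume and of [o] vanish. *)
Lemma testing_bound (beta q e f rho kappa : R) :
  0 < beta -> 1 < q -> e <= 0 -> 0 < rho -> kappa = 1 + q * e -> 0 < kappa ->
  q * f - kappa * rho = 1 + q * beta ->
  exists2 C : R, 0 < C &
  forall (T : finType) (D : {set {set T}}) (m s o : T -> R) (A : R),
  laminar D -> (forall x, 0 < m x) -> (forall x, 0 < s x) ->
  (forall x, 0 < o x) ->
  {in D &, forall Q G : {set T}, Q \proper G -> 2 * mass m Q <= mass m G} ->
  0 < A ->
  {in D, forall Q : {set T},
     mass o Q / mass m Q * (mass s Q / mass m Q) `^ rho <= A} ->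
  {in D, forall F : {set T},
    \sum_(x in F) o x * (\sum_(Q in D | (x \in Q) && (Q \subset F))
      mass m Q `^ beta * (mass o Q / mass m Q) `^ e *
      (mass s Q / mass m Q) `^ f) `^ q <=
    C * A `^ kappa * \sum_(Q in D | Q \subset F) mass s Q `^ (1 + q * beta)}.
Proof.
move=> beta0 q1 e0 rho0 kE kappa0 id.
have q0 : 0 < q by exact: lt_trans q1.
have [k qk] : exists k, q < k.+1%:R.
  by exists (Num.truncn q); exact: truncnS_gt.
pose N := k.+1; have qN : q < N%:R := qk.
have N0 : 0 < N%:R :> R by exact: lt_trans qN.
have N2 : 1 < N%:R :> R by exact: lt_trans qN.
pose y := e + f - beta.
have yE : q * y = kappa * (1 + rho) by rewrite /y; move: id; rewrite kE; lra.
have y0 : 0 < y by rewrite -(pmulr_rgt0 _ q0) yE mulr_gt0// addr_gt0.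
(* The relative excess of theta over kappa / N: positive for the volume
   exponents, and small for the three other conditions of chain_moment. *)
have [h [h0 h1 h2 h3]] : exists h : R, [/\ 0 < h, h * y <= beta,
    h * (kappa * rho) <= 1 & (N%:R - 1) * h <= 1].
  have kr0 : 0 < kappa * rho by rewrite mulr_gt0.
  have N10 : 0 < N%:R - 1 :> R by rewrite subr_gt0.
  exists (Num.min (beta / y) (Num.min (kappa * rho)^-1 (N%:R - 1)^-1)); split.
  - by rewrite !lt_min !invr_gt0 divr_gt0// kr0 N10.
  - by rewrite -ler_pdivlMr// ge_min lexx.
  - by rewrite -ler_pdivlMr// div1r !ge_min lexx orbT.
  - by rewrite mulrC -ler_pdivlMr// div1r !ge_min lexx !orbT.
pose delta := q / N%:R; pose theta := (1 + h) * kappa / N%:R.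
have delta0 : 0 < delta by rewrite divr_gt0.
have delta1 : delta <= 1 by rewrite ler_pdivrMr// mul1r ltW.
have dN : delta * N%:R = q by rewrite divfK// gt_eqF.
have tN : theta * N%:R = (1 + h) * kappa by rewrite divfK// gt_eqF.
have th0 : 0 <= theta by rewrite divr_ge0 ?(ltW N0)// mulr_ge0 ?ltW// addr_gt0.
have dVq : delta^-1 * q = N%:R by rewrite /delta; field; rewrite !gt_eqF.
clearbody delta theta.
have byN (u v : R) : (u <= v) = (u * N%:R <= v * N%:R) by rewrite ler_pM2r.
have C1 : 0 < delta * (beta - e - f) + theta * (1 + rho).
  rewrite -(pmulr_lgt0 _ N0).
  rewrite (_ : _ * N%:R = delta * N%:R * (- y) + theta * N%:R * (1 + rho)); last first.
    by rewrite /y; ring.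
  have -> : theta * N%:R * (1 + rho) = (1 + h) * (q * y) by rewrite tN yE; ring.
  have -> : delta * N%:R * - y + (1 + h) * (q * y) = h * (q * y) by rewrite dN; ring.
  by rewrite mulr_gt0// mulr_gt0.
have C2 : theta * (1 + rho) <= delta * (e + f).
  rewrite byN (_ : theta * (1 + rho) * N%:R = theta * N%:R * (1 + rho)); last by ring.
  rewrite tN (_ : delta * (e + f) * N%:R = delta * N%:R * (e + f)); last by ring.
  rewrite dN -mulrA -yE mulrCA ler_pM2l//; move: h1; rewrite /y; lra.
have C3 : theta * rho <= delta * f.
  rewrite byN (_ : theta * rho * N%:R = theta * N%:R * rho); last by ring.
  rewrite tN (_ : delta * f * N%:R = delta * N%:R * f); last by ring.
  rewrite dN; have := mulr_gt0 q0 beta0; move: h2 id; lra.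
have de0 : delta * e <= 0 by rewrite pmulr_rle0.
have C4' : (N%:R - 1) * theta <= kappa.
  rewrite byN (_ : _ * N%:R = (N%:R - 1) * (theta * N%:R)); last by ring.
  rewrite tN mulrA [leRHS]mulrC ler_wpM2r ?(ltW kappa0)//; move: h3; lra.
have C4 i : (i <= N.-1)%N -> 0 <= 1 + i%:R * (delta * e - theta).
  move=> iN; have i0 : 0 <= i%:R :> R by [].
  have iN' : i%:R <= N%:R - 1 :> R by rewrite lerBrDr natr1 ler_nat.
  have : (N%:R - 1) * (delta * e - theta) <= i%:R * (delta * e - theta).
    by rewrite ler_wnM2r// subr_le0 (le_trans de0).
  have : (N%:R - 1) * (delta * e) = q * e - delta * e.
    by rewrite -dN; ring.
  by move: C4' de0; rewrite kE; lra.
set a1 := delta * (beta - e - f) + theta * (1 + rho) in C1.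
pose P : R := \prod_(j < N.-1) (j.+1%:R * (2 / (1 - 2 `^ (- (j.+1%:R * a1))))).
have P0 : 0 < P.
  apply: prodr_gt0 => j _; rewrite mulr_gt0// divr_gt0// subr_gt0.
  by have /andP[_] := @powR2N_lt1 R (j.+1%:R * a1) (mulr_gt0 (ltr0Sn _ _) C1).
exists (N%:R * P); first exact: mulr_gt0.
move=> T D m s o A lamD m0 s0 o0 halving A0 muck F FD.
have mp (w : T -> R) Q : (forall x, 0 < w x) -> Q \in D -> 0 < mass w Q.
  by move=> w0 QD; apply: mass_gt0 => //; case: lamD => _; exact.
pose z Q := monomial m s o Q (delta * (beta - e - f)) (delta * e) (delta * f).
have z0 Q : 0 <= z Q by exact: monomial_ge0.
have uE Q : Q \in D -> mass m Q `^ beta * (mass o Q / mass m Q) `^ e *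
    (mass s Q / mass m Q) `^ f = z Q `^ delta^-1.
  move=> QD; have mQ := mp _ _ m0 QD; have oQ := mp _ _ o0 QD; have sQ := mp _ _ s0 QD.
  rewrite /z /monomial -expRM {1 2 3}/powR !gt_eqF ?divr_gt0// -!expRD !ln_div ?posrE//.
  by congr expR; field; rewrite gt_eqF.
have H1 : \sum_(x in F) o x * (\sum_(Q in D | (x \in Q) && (Q \subset F))
      mass m Q `^ beta * (mass o Q / mass m Q) `^ e *
      (mass s Q / mass m Q) `^ f) `^ q <=
    \sum_(x in F) o x * (\sum_(Q in D | (x \in Q) && (Q \subset F)) z Q) ^+ N.
  apply: ler_sum => x _; rewrite ler_wpM2l ?(ltW (o0 _))//.
  under eq_bigr => Q /andP[QD _] do rewrite uE//.
  rewrite -powR_mulrn ?sumr_ge0// -dVq powRrM ler_powRl ?(ltW q0)//.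
    by apply: sumr_ge0 => Q _; exact: powR_ge0.
  by apply: sum_powR_le => //; rewrite invf_ge1.
apply: (le_trans H1); apply: (le_trans (iterated_chain_sum N.-1 F lamD o0 z0)).
rewrite -!mulrA ler_wpM2l//.
have Apow (a b : R) : A `^ (a + b) = A `^ a * A `^ b.
  by rewrite powRD// (gt_eqF A0) implybT.
rewrite !mulr_sumr; apply: ler_sum => Q /andP[QD QF].
have H2 := chain_moment lamD m0 s0 o0 halving A0 muck C1 C2 th0 C3 C4
  (leqnn N.-1) QD.
apply: (le_trans (ler_wpM2l (z0 Q) H2)); rewrite -/a1 -/P.
rewrite mulrCA -!mulrA ler_wpM2l ?(ltW P0)// /z monomialM.
have N1 : N.-1%:R = N%:R - 1 :> R by rewrite -[N in RHS]prednK// -natr1 addrK.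
pose theta' := kappa - N.-1%:R * theta.
have th'0 : 0 <= theta' by rewrite /theta' N1 subr_ge0.
have -> : kappa = N.-1%:R * theta + theta' by rewrite /theta'; ring.
rewrite Apow -!mulrA ler_wpM2l ?powR_ge0//.
apply: (le_trans (monomial_trade lamD m0 s0 o0 A0 muck _ _ _ th'0 QD)).
rewrite ler_wpM2l ?powR_ge0// le_eqVlt; apply/orP; left; apply/eqP.
have -> : mass s Q `^ (1 + q * beta) = monomial m s o Q 0 0 (1 + q * beta).
  by rewrite (monomialE lamD m0 s0 o0 _ _ _ QD) !powRr0 !mul1r.
have -> : delta * (beta - e - f) + N.-1%:R * a1 + theta' * (1 + rho) = 0.
  rewrite (_ : _ + _ = delta * N%:R * (beta - e - f) + kappa * (1 + rho)).
    by rewrite dN -yE /y; ring.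
  by rewrite /theta' N1 /a1; ring.
have -> : delta * e + (1 + N.-1%:R * (delta * e - theta)) - theta' = 0.
  rewrite (_ : _ - _ = 1 + delta * N%:R * e - kappa); first by rewrite dN kE; ring.
  by rewrite /theta' N1; ring.
have -> : delta * f + N.-1%:R * (delta * f - theta * rho) - theta' * rho =
    1 + q * beta.
  rewrite (_ : _ - _ = delta * N%:R * f - kappa * rho); first by rewrite dN id.
  by rewrite /theta' N1; ring.
by [].
Qed.

End testing_bound.

Section decay.
Context {R : realType}.

(** By (1 - d)^e <= exp(- e d) <= 1 / (1 + e d). *)
Lemma one_sub_powR (e d : R) : 0 < e -> 0 < d <= 1 ->
  (1 - (1 - d) `^ e)^-1 <= (1 + e) / e * d^-1.
Proof.
move=> e0 /andP[d0 d1]; have ed0 : 0 < e * d by exact: mulr_gt0.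
have H : (1 - d) `^ e <= (1 + e * d)^-1.
  apply: (@le_trans _ _ (expR (- d) `^ e)).
    by apply: (ler_powRl (ltW e0) _ (expR_ge1Dx (- d))); rewrite subr_ge0.
  rewrite -expRM mulNr expRN lef_pV2 ?posrE ?expR_gt0 ?addr_gt0//.
  by rewrite mulrC expR_ge1Dx.
have K : e / (1 + e) * d <= 1 - (1 - d) `^ e.
  apply: (@le_trans _ _ (1 - (1 + e * d)^-1)); last by rewrite lerD2l lerN2.
  have -> : 1 - (1 + e * d)^-1 = e * d / (1 + e * d).
    by field; rewrite gt_eqF// addr_gt0.
  rewrite mulrAC ler_pM2l// lef_pV2 ?posrE ?addr_gt0// lerD2l.
  by rewrite ler_piMr// ltW.
rewrite -[leRHS]invrK lef_pV2 ?posrE.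
- by rewrite invfM invrK invf_div.
- by apply: lt_le_trans K; rewrite mulr_gt0 ?divr_gt0 ?addr_gt0.
- by rewrite invr_gt0 mulr_gt0 ?invr_gt0 ?divr_gt0 ?addr_gt0.
Qed.

Context {T : finType}.
Variables (D : {set {set T}}) (m s o : T -> R) (A rho : R).
Hypothesis lamD : laminar D.
Hypothesis m0 : forall x, 0 < m x.
Hypothesis s0 : forall x, 0 < s x.
Hypothesis o0 : forall x, 0 < o x.
Hypothesis halving : {in D &, forall Q G : {set T}, Q \proper G ->
  2 * mass m Q <= mass m G}.
Hypothesis rho0 : 0 < rho.
Hypothesis muckenhoupt : {in D, forall Q : {set T},
  mass o Q / mass m Q * (mass s Q / mass m Q) `^ rho <= A}.
Hypothesis pointwise : forall x, m x `^ (1 + rho) <= o x * s x `^ rho.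
Implicit Types (F G Q E : {set T}).

Let mp (w : T -> R) Q : (forall x, 0 < w x) -> Q \in D -> 0 < mass w Q.
Proof. by move=> w0 QD; apply: mass_gt0 => //; case: lamD => _; exact. Qed.

Lemma mass_hoelder E : mass m E `^ (1 + rho) <= mass o E * mass s E `^ rho.
Proof.
have r1 : 0 < 1 + rho by exact: addr_gt0.
have q0 : 0 < (1 + rho) / rho by exact: divr_gt0.
have pq : (1 + rho)^-1 + ((1 + rho) / rho)^-1 = 1.
  by field; rewrite !gt_eqF.
have := @hoelder_sum _ _ (fun x => x \in E) (fun x => o x `^ (1 + rho)^-1)
  (fun x => s x `^ (rho / (1 + rho))) _ _ r1 q0 pq.
move=> H.
have {}H : mass m E <= mass o E `^ (1 + rho)^-1 * mass s E `^ (rho / (1 + rho)).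
  apply: (@le_trans _ _ (\sum_(x in E) o x `^ (1 + rho)^-1 * s x `^ (rho / (1 + rho)))).
    apply: ler_sum => x _.
    rewrite -[leLHS](powRVK r1) ?(ltW (m0 _))// powRrM -powRM ?powR_ge0 ?(ltW (o0 _))//.
    by apply: ler_powRl; rewrite ?invr_ge0 ?(ltW r1) ?powR_ge0.
  apply: (le_trans (H _ _)) => [x _|x _|]; rewrite ?powR_ge0//.
  rewrite le_eqVlt; apply/orP; left; apply/eqP.
  congr (_ `^ _ * _).
    by apply: eq_bigr => x _; rewrite powRKV// ltW.
  rewrite invf_div; congr (_ `^ _); apply: eq_bigr => x _.
  rewrite -powRrM (_ : _ * _ = 1) ?powRr1 ?(ltW (s0 _))//.
  by field; rewrite !gt_eqF.
apply: (le_trans (ler_powRl _ _ H)); rewrite ?(ltW r1) ?mass_ge0//.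
rewrite powRM ?powR_ge0// powRKV ?mass_ge0// -powRrM divfK// gt_eqF//.
Qed.

(** Apply [mass_hoelder] to the cube [F] itself. *)
Lemma muckenhoupt_ge1 F : F \in D -> 1 <= A.
Proof.
move=> FD; apply: le_trans (muckenhoupt FD).
have mF := mp m0 FD; have sF := mp s0 FD.
rewrite powRM ?mass_ge0 ?invr_ge0 ?mass_ge0// -powR_inv1 ?mass_ge0// mulrACA.
have -> : mass m F `^ (-1) * (mass m F `^ (-1)) `^ rho =
    (mass m F `^ (1 + rho))^-1.
  rewrite -powRrM -powRD ?(gt_eqF mF) ?implybT// -powRN.
  by congr (_ `^ _); ring.
by rewrite ler_pdivlMr ?powR_gt0// mul1r; exact: mass_hoelder.
Qed.

Let delta := (2 `^ (1 + rho) * A) `^ (- rho^-1).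

(** The part of [G] outside [Q] has at least half of the volume. By
    Hölder's inequality and the Muckenhoupt condition it has at least the
    fraction [delta] of the mass of [G]. *)
Lemma mass_decay : {in D &, forall Q G, Q \proper G ->
  mass s Q <= (1 - delta) * mass s G}.
Proof.
move=> Q G QD GD QG; have A1 := muckenhoupt_ge1 QD.
have A0 : 0 < A by exact: lt_le_trans A1.
have mG := mp m0 GD; have sG := mp s0 GD; have oG := mp o0 GD.
have massD (w : T -> R) : mass w G = mass w Q + mass w (G :\: Q).
  by rewrite /mass (big_setID Q)/= (finset.setIidPr (proper_sub QG)).
set E := G :\: Q in massD.
have mE : mass m G / 2 <= mass m E.
  by have := halving QD GD QG; rewrite (massD m); lra.
have EG : E \subset G by exact: finset.subsetDl.
have sE0 : 0 <= mass s E by exact: mass_ge0.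
have H : (mass m G / 2) `^ (1 + rho) <= mass o G * mass s E `^ rho.
  apply: (le_trans (ler_powRl _ _ mE)).
  - by rewrite ltW// addr_gt0.
  - by rewrite divr_ge0// ltW.
  apply: (le_trans (mass_hoelder E)); rewrite ler_wpM2r ?powR_ge0//.
  exact: ler_mass.
have K : mass o G * mass s G `^ rho <= A * mass m G `^ (1 + rho).
  rewrite -ler_pdivrMr ?powR_gt0//; apply: le_trans (muckenhoupt GD).
  rewrite powRM ?mass_ge0 ?invr_ge0 ?mass_ge0// -powR_inv1 ?mass_ge0// mulrACA.
  rewrite -powRrM -powRD ?(gt_eqF mG) ?implybT// -powRN le_eqVlt.
  by apply/orP; left; apply/eqP; congr (_ * _ `^ _); ring.
have dE : delta * mass s G <= mass s E.
  have sEr : (delta * mass s G) `^ rho <= mass s E `^ rho.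
    rewrite powRM ?powR_ge0 ?mass_ge0// /delta -powRrM mulNr mulVf ?gt_eqF//.
    rewrite powR_inv1; last by apply: mulr_ge0; [exact: powR_ge0|exact: ltW].
    rewrite mulrC ler_pdivrMr ?mulr_gt0 ?powR_gt0// -(ler_pM2l oG).
    apply: (le_trans K).
    have mG2 : mass m G `^ (1 + rho) = 2 `^ (1 + rho) * (mass m G / 2) `^ (1 + rho).
      rewrite -powRM//; first by congr (_ `^ _); field.
      by apply: divr_ge0 => //; exact: mass_ge0.
    rewrite mG2 (_ : mass o G * _ = A * (2 `^ (1 + rho) * (mass o G * mass s E `^ rho))).
      by rewrite ler_pM2l// ler_pM2l ?powR_gt0.
    by ring.
  have := ler_powRl (_ : 0 <= rho^-1) _ sEr.
  by rewrite !powRVK// ?mulr_ge0 ?powR_ge0 ?mass_ge0//; apply;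
    rewrite ?powR_ge0// invr_ge0 ltW.
by move: (massD s) dE; lra.
Qed.

(** By [mass_decay] the sum is geometric with ratio (1 - delta)^(eta - 1).
    Its value is of order 1 / delta, which is the factor A^(1/rho). *)
Lemma powR_mass_sum eta F : 1 < eta -> F \in D ->
  \sum_(Q in D | Q \subset F) mass s Q `^ eta <=
  eta / (eta - 1) * (2 `^ (1 + rho)) `^ rho^-1 * A `^ rho^-1 * mass s F `^ eta.
Proof.
move=> eta1 FD; have A1 := muckenhoupt_ge1 FD.
have A0 : 0 < A by exact: lt_le_trans A1.
have e0 : 0 < eta - 1 by rewrite subr_gt0.
have eta0 : 0 < eta by exact: lt_trans eta1.
have P0 : 0 < 2 `^ (1 + rho) * A by rewrite mulr_gt0 ?powR_gt0.
have d0 : 0 < delta by rewrite powR_gt0.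
have d1 : delta <= 1.
  rewrite /delta powRN invf_le1 ?powR_gt0//.
  rewrite -[leLHS](@powRr0 R (2 `^ (1 + rho) * A)).
  apply: ler_powR; last by rewrite invr_ge0 ltW.
  rewrite -[leLHS]mulr1; apply: ler_pM => //.
  rewrite -[leLHS](@powRr0 R 2); apply: ler_powR; first by rewrite ler1n.
  by rewrite ltW// addr_gt0.
have k01 : 0 <= (1 - delta) `^ (eta - 1) < 1.
  rewrite powR_ge0/=; have := @gt0_ltr_powR _ _ e0 (1 - delta) 1.
  by rewrite powR1; apply; rewrite ?nnegrE; lra.
rewrite (eq_bigr (fun Q => mass s Q `^ (eta - 1) * mass s Q)); last first.
  by move=> Q _; rewrite mulrC mulr_powRB1// mass_ge0.
apply: (le_trans (nested_sum lamD s0 _ k01 _ FD)) => [Q|Q G QD GD QG|].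
- exact: powR_ge0.
- rewrite -powRM ?mass_ge0//; last by lra.
  by apply: ler_powRl; rewrite ?mass_ge0 ?(ltW e0)//; exact: mass_decay.
have := @one_sub_powR (eta - 1) delta e0; rewrite d0 d1 => /(_ isT) H.
rewrite mulrAC [_ * mass s F]mulrC mulr_powRB1 ?mass_ge0// mulrC.
rewrite ler_wpM2r ?powR_ge0//; apply: (le_trans H).
rewrite /delta powRN invrK powRM ?powR_ge0 ?(ltW A0)// mulrA.
by rewrite (_ : 1 + (eta - 1) = eta)//; ring.
Qed.

End decay.

(** * The weighted bound on a finite dyadic family *)

Section discrete_bound.
Context {R : realType}.

(** The discrete form of the weight condition: [m] stands for the volume
    of the leaves, [o] for the integral of w^q and [s] for that of the
    dual weight. The last clause is Hölder's inequality on a leaf, from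
    which [mass_hoelder] obtains the inequality on all sets of leaves. *)
Definition muckenhoupt_family (T : finType) (D : {set {set T}}) (m s o : T -> R)
    (A rho : R) :=
  [/\ laminar D, [/\ forall x, 0 < m x, forall x, 0 < s x & forall x, 0 < o x],
    {in D &, forall Q G : {set T}, Q \proper G -> 2 * mass m Q <= mass m G},
    {in D, forall Q : {set T},
      mass o Q / mass m Q * (mass s Q / mass m Q) `^ rho <= A} &
    forall x, m x `^ (1 + rho) <= o x * s x `^ rho].

(** The root of order rho of the condition. It turns the second testing
    condition into an instance of the first. *)
Lemma muckenhoupt_family_sym (T : finType) (D : {set {set T}})
    (m s o : T -> R) (A rho : R) : 0 < rho ->
  muckenhoupt_family D m s o A rho ->
  muckenhoupt_family D m o s (A `^ rho^-1) rho^-1.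
Proof.
move=> rho0 [lamD [m0 s0 o0] halving muck point]; split => //.
- move=> Q QD; have := muck _ QD; rewrite mulrC => H.
  rewrite -[mass s Q / _](powRVK rho0) ?divr_ge0 ?mass_ge0// -powRM.
  + apply: ler_powRl => //; first by rewrite invr_ge0 ltW.
    by apply: mulr_ge0; [exact: powR_ge0|rewrite divr_ge0 ?mass_ge0].
  + exact: powR_ge0.
  + by rewrite divr_ge0 ?mass_ge0.
- move=> x; have rV : 0 <= rho^-1 by rewrite invr_ge0 ltW.
  have := ler_powRl rV (powR_ge0 _ _) (point x).
  rewrite powRM ?powR_ge0 ?(ltW (o0 _))// powRVK ?(ltW (s0 _))// mulrC.
  by rewrite -powRrM mulrDl mul1r divff ?gt_eqF// addrC.
Qed.

(** [testing_bound] leaves a sum of powers of s(Q) with exponent larger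
    than 1, and [powR_mass_sum] adds 1 / rho to the exponent of A. *)
Lemma testing_estimate (beta q e f rho kappa : R) :
  0 < beta -> 1 < q -> e <= 0 -> 0 < rho -> kappa = 1 + q * e -> 0 < kappa ->
  q * f - kappa * rho = 1 + q * beta ->
  exists2 C : R, 0 < C &
  forall (T : finType) (D : {set {set T}}) (m s o : T -> R) (A : R),
  muckenhoupt_family D m s o A rho ->
  {in D, forall F : {set T},
    \sum_x o x * (\sum_(Q in D | (x \in Q) && (Q \subset F))
      mass m Q `^ beta * (mass o Q / mass m Q) `^ e *
      (mass s Q / mass m Q) `^ f) `^ q <=
    C * A `^ (kappa + rho^-1) * mass s F `^ (1 + q * beta)}.
Proof.
move=> beta0 q1 e0 rho0 kE kappa0 id; have q0 : 0 < q by exact: lt_trans q1.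
have [C C0 H] := testing_bound beta0 q1 e0 rho0 kE kappa0 id.
set eta := 1 + q * beta in H *.
have eta1 : 1 < eta by rewrite ltrDl mulr_gt0.
pose C' := eta / (eta - 1) * (2 `^ (1 + rho)) `^ rho^-1.
have C'0 : 0 < C'.
  by rewrite mulr_gt0 ?powR_gt0// divr_gt0 ?subr_gt0// (lt_trans _ eta1).
exists (C * C'); first exact: mulr_gt0.
move=> T D m s o A [lamD [m0 s0 o0] halving muck point] F FD.
have A1 := muckenhoupt_ge1 lamD m0 s0 o0 rho0 muck point FD.
have A0 : 0 < A by exact: lt_le_trans A1.
rewrite (bigID (fun x => x \in F))/= [X in _ + X]big1 ?addr0; last first.
  move=> x xF; rewrite big_pred0 ?powR0 ?mulr0 ?gt_eqF// => Q.
  apply/negbTE; apply/negP => /and3P[_ xQ /fintype.subsetP QF].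
  by move: xF; rewrite QF.
apply: (le_trans (H _ _ _ _ _ _ lamD m0 s0 o0 halving A0 muck _ FD)).
have := powR_mass_sum lamD m0 s0 o0 halving rho0 muck point eta1 FD.
rewrite -/C' => H2.
have CA : 0 <= C * A `^ kappa by rewrite mulr_ge0 ?powR_ge0// ltW.
apply: (le_trans (ler_wpM2l CA H2)).
rewrite powRD ?(gt_eqF A0) ?implybT// le_eqVlt; apply/orP; left; apply/eqP.
by ring.
Qed.

(** Let a be the maximal function of phi / s with respect to s. The
    r-average of phi on a cube is at most a power of s(Q) / m(Q) times the
    s-average of psi = a^(1/r), and the norm of psi in L^p(s) is at most a
    multiple of that of (phi / s)^(1/r). For the sum S of the resulting
    terms, the sum of S^q is the pairing of the dyadic operator with g =
    S^(q-1), to which [bilinear_embedding] applies. Its two testing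
    conditions hold with constants A^((1 + 1/rho)/q) and A^(1/q + 1/p') by
    [testing_estimate]; the maximum of the two exponents is [gamma]. *)
Lemma discrete_bound (beta r p q : R) :
  0 < beta -> 1 <= r -> r < p -> 0 < q -> q^-1 = p^-1 - beta ->
  let rho := q * (r^-1 - p^-1) in
  let gamma := Num.max ((1 + rho^-1) / q) (q^-1 + (1 - p^-1)) in
  exists2 C : R, 0 < C &
  forall (T : finType) (D : {set {set T}}) (m s o : T -> R) (A : R)
      (phi : T -> R),
  muckenhoupt_family D m s o A rho -> (forall x, 0 <= phi x) ->
  \sum_x o x * (\sum_(Q in D | x \in Q)
     mass m Q `^ beta * (mass phi Q / mass m Q) `^ r^-1) `^ q <=
  (C * A `^ gamma * (\sum_x s x * (phi x / s x) `^ (p / r)) `^ p^-1) `^ q.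
Proof.
move=> beta0 r1 rp q0 qE rho gamma.
have r0 : 0 < r by exact: lt_le_trans r1.
have p0 : 0 < p by exact: lt_trans rp.
have p1 : 1 < p by exact: le_lt_trans rp.
have pq : p <= q.
  by rewrite -lef_pV2 ?posrE// qE lerBlDr lerDl ltW.
have q1 : 1 < q by exact: lt_le_trans pq.
have pt1 : 1 < p / r by rewrite ltr_pdivlMr// mul1r.
pose p' := p / (p - 1); pose q' := q / (q - 1).
have p'0 : 0 < p' by rewrite divr_gt0// subr_gt0.
have q'0 : 0 < q' by rewrite divr_gt0// subr_gt0.
have p'V : p'^-1 = 1 - p^-1 by rewrite invf_div; field; rewrite gt_eqF.
have q'V : q'^-1 = 1 - q^-1 by rewrite invf_div; field; rewrite gt_eqF.
have pp' : p^-1 + p'^-1 = 1 by rewrite p'V; ring.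
have qq' : q^-1 + q'^-1 = 1 by rewrite q'V; ring.
have q'1 : 1 < q' by rewrite -ltf_pV2 ?posrE// invr1 q'V gtrBl invr_gt0.
have p'1 : 1 < p' by rewrite -ltf_pV2 ?posrE// invr1 p'V gtrBl invr_gt0.
have d0 : 0 < r^-1 - p^-1 by rewrite subr_gt0 ltf_pV2 ?posrE.
have rho0 : 0 < rho by rewrite mulr_gt0.
have rhoV0 : 0 < rho^-1 by rewrite invr_gt0.
have qp : q / p = 1 + q * beta.
  by rewrite -[p^-1](subrK beta) -qE mulrDr divff ?gt_eqF.
have p'q' : p' / q' = 1 + p' * beta.
  rewrite q'V qE (_ : 1 - (p^-1 - beta) = p'^-1 + beta); last by rewrite p'V; ring.
  by rewrite mulrDr divff ?gt_eqF.
have [C1 C10 T1] := @testing_estimate beta q 0 r^-1 rho 1 beta0 q1 (lexx _) rho0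
  ltac:(by rewrite mulr0 addr0) ltr01
  ltac:(by rewrite -qp mul1r /rho; ring).
have rV1 : r^-1 - 1 <= 0 by rewrite subr_le0 invf_le1.
have kE : p' * (r^-1 - p^-1) = 1 + p' * (r^-1 - 1).
  have -> : r^-1 - p^-1 = p'^-1 + (r^-1 - 1) by rewrite p'V; ring.
  by rewrite mulrDr divff ?gt_eqF.
have id2 : p' * 1 - p' * (r^-1 - p^-1) * rho^-1 = 1 + p' * beta.
  rewrite -p'q' q'V /rho invfM mulrA; rewrite [_ / q * _]mulrC mulrA.
  by rewrite (_ : p' * (r^-1 - p^-1) = (r^-1 - p^-1) * p') ?mulKf ?gt_eqF//; ring.
have [C2 C20 T2] := @testing_estimate beta p' (r^-1 - 1) 1 rho^-1
  (p' * (r^-1 - p^-1)) beta0 p'1 rV1 rhoV0 kE (mulr_gt0 p'0 d0) id2.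
pose C3 := ((2 * carleson_const (p / r)) `^ (p / r)) `^ p^-1.
have C30 : 0 < C3.
  by rewrite powR_gt0// powR_gt0// mulr_gt0// carleson_const_gt0.
have [E1 E1E E10] : exists2 E, E = embedding_const p q' & 0 < E.
  by exists (embedding_const p q'); [reflexivity | exact: (embedding_const_gt0 q' p1)].
have [E2 E2E E20] : exists2 E, E = embedding_const q' p & 0 < E.
  by exists (embedding_const q' p); [reflexivity | exact: (embedding_const_gt0 p q'1)].
have C1q : 0 < C1 `^ q^-1 by rewrite powR_gt0.
have C2p : 0 < C2 `^ p'^-1 by rewrite powR_gt0.
exists ((C1 `^ q^-1 * E1 + C2 `^ p'^-1 * E2) * C3).
  by apply: mulr_gt0 => //; apply: addr_gt0; apply: mulr_gt0.
move=> T D m s o A phi fam phi0; move: (fam) => [lamD [m0 s0 o0] halving muck point].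
have [->|[F0 F0D]] := finset.set_0Vmem D.
  rewrite big1 ?powR_ge0// => x _; rewrite big_pred0 ?powR0 ?mulr0 ?gt_eqF//.
  by move=> Q; rewrite inE.
have A1 := muckenhoupt_ge1 lamD m0 s0 o0 rho0 muck point F0D.
have A0 : 0 < A by exact: lt_le_trans A1.
pose f x := phi x / s x.
have f0 x : 0 <= f x by rewrite divr_ge0// ltW.
have [a [a0 aQ aS]] := doob_maximal lamD s0 f0 pt1.
pose psi x := a x `^ r^-1.
have psi0 x : 0 <= psi x by exact: powR_ge0.
pose u Q := mass m Q `^ beta * (mass s Q / mass m Q) `^ r^-1.
have u0 Q : 0 <= u Q by rewrite mulr_ge0 ?powR_ge0.
have mp (w : T -> R) Q : (forall x, 0 < w x) -> Q \in D -> 0 < mass w Q.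
  by move=> w0 QD; apply: mass_gt0 => //; case: lamD => _; exact.
pose S x := \sum_(Q in D | x \in Q) u Q * mean s psi Q.
have S0 x : 0 <= S x.
  by apply: sumr_ge0 => Q _; rewrite mulr_ge0// mean_ge0.
pose N := \sum_x o x * S x `^ q.
have N0 : 0 <= N by apply: sumr_ge0 => x _; rewrite mulr_ge0 ?powR_ge0// ltW.
have dominate : \sum_x o x * (\sum_(Q in D | x \in Q)
     mass m Q `^ beta * (mass phi Q / mass m Q) `^ r^-1) `^ q <= N.
  apply: ler_sum => x _; rewrite ler_wpM2l ?(ltW (o0 _))//.
  apply: ler_powRl; rewrite ?(ltW q0)//.
    by apply: sumr_ge0 => Q _; rewrite mulr_ge0 ?powR_ge0.
  apply: ler_sum => Q /andP[QD xQ]; have sQ := mp _ _ s0 QD; have mQ := mp _ _ m0 QD.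
  have fQ : mean s f Q = mass phi Q / mass s Q.
    rewrite /mean; congr (_ / _); apply: eq_bigr => y _.
    by rewrite /f mulrC divfK// gt_eqF.
  have -> : mass phi Q / mass m Q = mass s Q / mass m Q * mean s f Q.
    by rewrite fQ; field; rewrite !gt_eqF.
  have Y0 : 0 <= mass s Q / mass m Q by rewrite divr_ge0// ltW.
  rewrite (powRM _ Y0 (mean_ge0 _ s0 f0)) mulrA; apply: ler_wpM2l; first exact: u0.
  rewrite {2}/mean ler_pdivlMr// mulrC mulr_suml; apply: ler_sum => y yQ.
  rewrite ler_wpM2l ?(ltW (s0 _))//; apply: ler_powRl.
  - by rewrite invr_ge0 ltW.
  - exact: mean_ge0.
  - exact: aQ.
apply: (le_trans dominate).
pose c Q := u Q * mass o Q.
have c0 Q : 0 <= c Q by rewrite mulr_ge0// mass_ge0.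
have coE Q : Q \in D -> c Q / mass o Q = u Q.
  by move=> QD; rewrite /c mulfK// lt0r_neq0// mp.
pose g x := S x `^ (q - 1).
have g0 x : 0 <= g x by exact: powR_ge0.
have pairing : \sum_(Q in D) c Q * (mean s psi Q * mean o g Q) = N.
  rewrite /N (eq_bigr (fun x => \sum_(Q in D | x \in Q)
      u Q * mean s psi Q * (o x * g x))); last first.
    by move=> x _; rewrite -mulr_suml -/(S x) /g mulrCA mulr_powRB1.
  rewrite [RHS](exchange_big_dep (fun Q => Q \in D))/=; last first.
    by move=> x Q _ /andP[].
  apply: eq_bigr => Q QD; rewrite (eq_bigl (fun x => x \in Q)); last first.
    by move=> x; rewrite QD.
  rewrite -mulr_sumr /c {2}/mean; field.
  by rewrite lt0r_neq0// mp.
pose K1 := C1 `^ q^-1 * A `^ ((1 + rho^-1) / q).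
pose K2 := C2 `^ p'^-1 * A `^ (q^-1 + p'^-1).
have K10 : 0 <= K1 by rewrite mulr_ge0 ?powR_ge0.
have K20 : 0 <= K2 by rewrite mulr_ge0 ?powR_ge0.
have test1 : {in D, forall F : {set T},
    \sum_x o x * (\sum_(Q in D | (x \in Q) && (Q \subset F)) c Q / mass o Q) `^ q
    <= (K1 * mass s F `^ p^-1) `^ q}.
  move=> F FD; apply: le_trans (le_trans (T1 _ _ _ _ _ _ fam _ FD) _).
    apply: ler_sum => x _; rewrite ler_wpM2l ?(ltW (o0 _))//.
    rewrite le_eqVlt; apply/orP; left; apply/eqP; congr (_ `^ _).
    apply: eq_bigr => Q /andP[QD _]; rewrite coE// powRr0 mulr1.
    by rewrite /u.
  rewrite /K1 powRM ?mulr_ge0 ?powR_ge0// powRM ?powR_ge0// powRKV ?(ltW C10)//.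
  by rewrite -powRrM divfK ?gt_eqF// -powRrM -qp [q / p]mulrC.
have test2 : {in D, forall F : {set T},
    \sum_x s x * (\sum_(Q in D | (x \in Q) && (Q \subset F)) c Q / mass s Q) `^ p'
    <= (K2 * mass o F `^ q'^-1) `^ p'}.
  move=> F FD; have fam' := muckenhoupt_family_sym rho0 fam.
  apply: le_trans (le_trans (T2 _ _ _ _ _ _ fam' _ FD) _).
    apply: ler_sum => x _; rewrite ler_wpM2l ?(ltW (s0 _))//.
    rewrite le_eqVlt; apply/orP; left; apply/eqP; congr (_ `^ _).
    apply: eq_bigr => Q /andP[QD _].
    have mQ := mp _ _ m0 QD; have oQ := mp _ _ o0 QD; have sQ := mp _ _ s0 QD.
    rewrite powRr1 ?divr_ge0 ?mass_ge0//.
    have Y0 : 0 < mass s Q / mass m Q by rewrite divr_gt0.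
    rewrite powRD ?(gt_eqF Y0) ?implybT// powRN powRr1 ?(ltW Y0)//.
    by rewrite /c /u; field; rewrite !gt_eqF.
  rewrite /K2 powRM ?mulr_ge0 ?powR_ge0// powRM ?powR_ge0// powRKV ?(ltW C20)//.
  rewrite invrK -!powRrM -p'q' [q'^-1 * p']mulrC.
  rewrite (_ : rho^-1 * _ = (q^-1 + p'^-1) * p')//.
  rewrite mulrDr mulVf ?gt_eqF// mulrDl mulVf ?gt_eqF//; congr (_ + _).
  rewrite /rho; have := lt0r_neq0 d0; move: (r^-1 - p^-1) => d dn.
  by field; rewrite dn gt_eqF.
have gN : \sum_x o x * g x `^ q' = N.
  apply: eq_bigr => x _; rewrite /g -powRrM /q' mulrCA divff ?mulr1//.
  by rewrite gt_eqF// subr_gt0.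
clearbody g.
have B := bilinear_embedding lamD s0 o0 psi0 g0 c0 p1 pq q'1 p'0 pp' qq' K10 K20
  test1 test2.
rewrite pairing gN -E1E -E2E in B.
pose X := \sum_x s x * (phi x / s x) `^ (p / r).
have X0 : 0 <= X by apply: sumr_ge0 => x _; rewrite mulr_ge0 ?powR_ge0// ltW.
have psiX : (\sum_x s x * psi x `^ p) `^ p^-1 <= C3 * X `^ p^-1.
  rewrite -powRM ?powR_ge0//; apply: ler_powRl.
  - by rewrite invr_ge0 ltW.
  - by apply: sumr_ge0 => x _; rewrite mulr_ge0 ?powR_ge0// ltW.
  apply: le_trans aS; rewrite le_eqVlt; apply/orP; left; apply/eqP.
  by apply: eq_bigr => x _; rewrite /psi -powRrM [r^-1 * p]mulrC.
have KK : K1 * E1 + K2 * E2 <= (C1 `^ q^-1 * E1 + C2 `^ p'^-1 * E2) * A `^ gamma.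
  rewrite mulrDl; apply: lerD; rewrite /K1 /K2 mulrAC.
  - apply: ler_wpM2l; first by rewrite ltW// mulr_gt0.
    by apply: ler_powR => //; rewrite le_max lexx.
  - apply: ler_wpM2l; first by rewrite ltW// mulr_gt0.
    by apply: ler_powR => //; rewrite le_max p'V lexx orbT.
have main : N `^ q^-1 <= (C1 `^ q^-1 * E1 + C2 `^ p'^-1 * E2) * C3 * A `^ gamma *
    X `^ p^-1.
  have [N00|Nn0] := eqVneq N 0.
    rewrite N00 powR0 ?invr_eq0 ?gt_eqF// !mulr_ge0 ?powR_ge0//.
    by apply: addr_ge0; apply: mulr_ge0; rewrite ?powR_ge0//; exact: ltW.
  have Np : 0 < N by rewrite lt_neqAle eq_sym Nn0.
  have -> : N `^ q^-1 = N / N `^ q'^-1.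
    rewrite -[LHS](mulfK (lt0r_neq0 (powR_gt0 q'^-1 Np))).
    by rewrite -powRD ?qq' ?oner_eq0// powRr1.
  have NV0 : 0 < N `^ q'^-1 by exact: powR_gt0.
  rewrite ler_pdivrMr; last exact: NV0.
  apply: (le_trans B); rewrite mulrA; apply: ler_wpM2r; first exact: powR_ge0.
  have sum0 : 0 <= K1 * E1 + K2 * E2.
    by apply: addr_ge0; apply: mulr_ge0; [exact: K10|exact: ltW E10|
      exact: K20|exact: ltW E20].
  apply: (le_trans (ler_pM sum0 (powR_ge0 _ _) KK psiX)).
  by rewrite le_eqVlt; apply/orP; left; apply/eqP; ring.
apply: (le_trans _ (ler_powRl (ltW q0) (powR_ge0 _ _) main)).
by rewrite (powRKV q0 N0).
Qed.

End discrete_bound.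

(** * Integrals and null sets *)

Section null_sets.
Local Open Scope classical_set_scope.
Local Open Scope ereal_scope.
Context d (T : measurableType d) (R : realType).
Variable mu : {measure set T -> \bar R}.
Import HBNNSimple.

(** The integral of a nonnegative function is a supremum over simple
    functions below it. Such a function for f, set to zero on N, is below
    g and has the same integral; so f and g can be any functions. *)
Lemma le_integral_null (f g : T -> \bar R) (N : set T) :
  measurable N -> mu N = 0 -> (forall x, 0 <= f x) -> (forall x, 0 <= g x) ->
  (forall x, ~ N x -> f x <= g x) -> \int[mu]_x f x <= \int[mu]_x g x.
Proof.
move=> mN N0 f0 g0 fg; rewrite !ge0_integralTE//.
apply: ge_ereal_sup => _ /= [h hf <-].
have mNC : measurable (~` N) by exact: measurableC.
pose h' := proj_nnsfun h mNC.
have h'E x : h' x = (h \_ (~` N)) x by rewrite mrestrict.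
apply: le_trans (_ : sintegral mu h' <= _); last first.
  apply: ereal_sup_ubound => /=; exists h' => // x.
  rewrite h'E patchE; case: ifPn => [/set_mem xN|_]; last exact: g0.
  by rewrite (le_trans (hf x))// fg.
rewrite -!integralT_nnsfun (ge0_negligible_integral mN)//; last 2 first.
- exact/measurable_EFinP.
- by move=> x _; rewrite lee_fin.
rewrite setTD (integral_mkcond (~` N)) le_eqVlt; apply/orP; left; apply/eqP.
by apply: eq_integral => x _; rewrite h'E !patchE; case: ifP.
Qed.

Lemma le_integral_nullD (f g : T -> \bar R) (N D : set T) :
  measurable N -> mu N = 0 -> (forall x, 0 <= f x) -> (forall x, 0 <= g x) ->
  (forall x, ~ N x -> D x -> f x <= g x) ->
  \int[mu]_(x in D) f x <= \int[mu]_(x in D) g x.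
Proof.
move=> mN N0 f0 g0 fg; rewrite integral_mkcond [leRHS]integral_mkcond.
apply: (le_integral_null mN N0) => [x|x|x Nx]; rewrite ?patchE.
- by case: ifP.
- by case: ifP.
- by case: ifPn => // /set_mem; exact: fg.
Qed.

Lemma eq_integral_nullD (f g : T -> \bar R) (N D : set T) :
  measurable N -> mu N = 0 -> (forall x, 0 <= f x) -> (forall x, 0 <= g x) ->
  (forall x, ~ N x -> D x -> f x = g x) ->
  \int[mu]_(x in D) f x = \int[mu]_(x in D) g x.
Proof.
move=> mN N0 f0 g0 fg; apply/eqP; rewrite eq_le.
by apply/andP; split; apply: (le_integral_nullD mN N0) => // x Nx Dx; rewrite fg.
Qed.

Lemma abse_integral_le (f : T -> \bar R) :
  `| \int[mu]_x f x | <= \int[mu]_x `| f x |.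
Proof.
have bound (a b c : \bar R) : 0 <= a -> 0 <= b -> a <= c -> b <= c -> `|a - b| <= c.
  move=> a0 b0 ac bc; have [->|cy] := eqVneq c +oo; first exact: leey.
  have cfin : c \is a fin_num.
    by rewrite ge0_fin_numE ?ltey// (le_trans a0).
  have afin : a \is a fin_num.
    by rewrite ge0_fin_numE// (le_lt_trans ac)// ltey.
  have bfin : b \is a fin_num.
    by rewrite ge0_fin_numE// (le_lt_trans bc)// ltey.
  rewrite -(fineK afin) -(fineK bfin) -(fineK cfin) in a0 b0 ac bc *.
  rewrite !lee_fin in a0 b0 ac bc *; rewrite ler_norml; apply/andP; split; lra.
have S0 : measurable (set0 : set T) by exact: measurable0.
have mu0 : mu set0 = 0 by exact: measure0.
rewrite integralE; apply: bound.
- by apply: integral_ge0.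
- by apply: integral_ge0.
- apply: (le_integral_null S0 mu0) => // x _.
  by rewrite funeposE ge_max abse_ge0 lee_abs.
- apply: (le_integral_null S0 mu0) => // x _.
  by rewrite funenegE ge_max abse_ge0 -abseN lee_abs.
Qed.

End null_sets.

Section borel_version.
Local Open Scope classical_set_scope.
Context {R : realType} {n : nat}.
Local Notation mu := (lebesgue_rV R n).

Let q (k : nat) : R := ratr (odflt 0 (unpickle k : option rat)).

Let q_between (x y : R) : x < y -> exists k, x < q k < y.
Proof.
move=> /rat_in_itvoo[t]; rewrite in_itv/= => xty.
by exists (pickle t); rewrite /q pickleK.
Qed.

(** For rational t, the set where f > t is Borel up to a Borel null set.
    The union N of these countably many null sets is null, and f has Borel
    level sets off N. *)
Lemma borel_version (f : 'rV[R]_n -> R) : lebesgue_measurable f ->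
  exists2 N : set 'rV[R]_n, measurable N /\ mu N = 0%E &
    measurable_fun [set: 'rV[R]_n]
      (fun x => if x \in N then 0 else f x : measurableTypeR R).
Proof.
move=> mf.
have cut (k : nat) : exists AN : set 'rV[R]_n * set 'rV[R]_n,
    [/\ measurable AN.1, measurable AN.2, mu AN.2 = 0%E &
    forall x, ~ AN.2 x -> (AN.1 x <-> q k < f x)].
  have mI : measurable (`]q k, +oo[%classic : set (measurableTypeR R)).
    exact: measurable_itv.
  have [A mA [N [N' [mN' N'0 NN']] AN]] := mf _ mI.
  exists (A, N'); split => // x /= N'x.
  have -> : (q k < f x) = ((f @^-1` `]q k, +oo[) x) :> Prop.
    by rewrite /= in_itv/= andbT.
  by rewrite -AN; split; [left|case=> // /NN'].
have [AN ANP] := choice cut.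
pose N0 := \bigcup_k (AN k).2.
have mN0 : measurable N0.
  by apply: bigcupT_measurable => k; have [] := ANP k.
have N00 : mu N0 = 0%E.
  apply/negligibleP => //; apply: negligible_bigcup => k.
  by apply/negligibleP; have [] := ANP k.
exists N0; first by split.
have step (k : nat) : measurable [set x | q k < if x \in N0 then 0 else f x].
  have [mA mN _ AE] := ANP k.
  have -> : [set x | q k < if x \in N0 then 0 else f x] =
      ((AN k).1 `&` ~` N0) `|` (N0 `&` [set x | q k < 0 :> R]).
    apply/seteqP; split => x /=.
      case: ifPn => [/set_mem N0x t0|]; first by right.
      rewrite notin_setE => N0x tf; left; split => //.
      by apply/AE => // Nx; apply: N0x; exists k.
    move=> [[Ax N0x]|[N0x t0]]; last by rewrite mem_set.
    by rewrite memNset//; apply/AE => // Nx; apply: N0x; exists k.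
  apply: measurableU.
    by apply: measurableI => //; exact: measurableC.
  apply: measurableI => //.
  have [t0|t0] := pselect (q k < 0).
    by rewrite (_ : [set _ | _] = setT)//; apply/seteqP; split.
  by rewrite (_ : [set _ | _] = set0)//; apply/seteqP; split.
apply: (measurability (@RGenOInfty.G R)).
  exact: RGenOInfty.measurableE.
move=> _ [_ [x ->] <-]; rewrite setTI.
have -> : (fun y => if y \in N0 then 0 else f y) @^-1` `]x, +oo[ =
    \bigcup_(k in [set k | x < q k])
      [set y | q k < if y \in N0 then 0 else f y].
  apply/seteqP; split => y /=.
    rewrite in_itv/= andbT => /q_between[k /andP[xk ky]].
    by exists k.
  by move=> [k /= xk ky]; rewrite in_itv/= andbT (lt_trans xk).
by apply: bigcup_measurable => k _; exact: step.
Qed.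

End borel_version.

(** * Reflections of the space *)

Section reflection.
Local Open Scope classical_set_scope.
Context {R : realType}.

Lemma measurable_reflect1 (c : R) :
  measurable_fun [set: measurableTypeR R]
    (fun t : measurableTypeR R => c - t : measurableTypeR R).
Proof. by apply: measurable_funB. Qed.

Lemma lebesgue_reflect1 (c : R) (A : set (measurableTypeR R)) : measurable A ->
  lebesgue_measure ((fun t : measurableTypeR R => c - t : measurableTypeR R) @^-1` A)
  = lebesgue_measure A :> \bar R.
Proof.
move=> mA; pose phi := fun t : measurableTypeR R => c - t : measurableTypeR R.
pose phim := isMeasurableFun.Build _ _ _ _ phi (measurable_reflect1 c).
pose phiM : {mfun measurableTypeR R >-> measurableTypeR R} := HB.pack phi phim.
apply/esym.
rewrite (@lebesgue_measure_unique _ (pushforward (@lebesgue_measure R) phiM))//.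
move=> _ [[a b] _ <-]; rewrite /= /pushforward.
have -> : phi @^-1` `]a, b]%classic = `[c - b, c - a[%classic.
  by apply/seteqP; split => x /=; rewrite !in_itv/= /phi; lra.
rewrite !lebesgue_measure_itv/= !lte_fin.
have -> : (c - b < c - a) = (a < b) by rewrite ltrD2l ltrN2.
by case: ifP => // _; rewrite -!EFinB; congr EFin; ring.
Qed.

Lemma measurable_reflect n (x : 'rV[R]_n) :
  measurable_fun [set: 'rV[R]_n] (fun y => x - y).
Proof.
apply: measurable_fun_rVP => i.
rewrite (_ : _ \o _ = (fun t : measurableTypeR R => x ord0 i - t : measurableTypeR R)
    \o rV_coord i); last by apply/funext => y /=; rewrite /rV_coord !mxE.
apply: measurableT_comp; first exact: measurable_reflect1.
exact: measurable_rV_coord.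
Qed.

(** Induction on the dimension: the measure is the product of a
    one-dimensional one with that of the lower dimension, the reflection
    acts on each factor, and product measures are unique. *)
Lemma lebesgue_rV_reflect n (x : 'rV[R]_n) (A : set 'rV[R]_n) : measurable A ->
  lebesgue_rV R n ((fun y => x - y) @^-1` A) = lebesgue_rV R n A.
Proof.
elim: n x A => [|n IHn] x A mA.
  congr (lebesgue_rV R 0 _); apply/seteqP.
  by split => y /=; rewrite (_ : x - y = y)//; apply/rowP => -[].
pose x0 := x ord0 ord0; pose x' : 'rV[R]_n := (rV_uncons x).2.
pose psi (z : measurableTypeR R * 'rV[R]_n) : measurableTypeR R * 'rV[R]_n :=
  (x0 - z.1, x' - z.2).
have mpsi : measurable_fun [set: _] psi.
  apply: measurable_fun_pair => /=.
    exact: (measurableT_comp (measurable_reflect1 x0)).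
  exact: (measurableT_comp (measurable_reflect x')).
pose psim := isMeasurableFun.Build _ _ _ _ psi mpsi.
pose psiM : {mfun _ >-> _} := HB.pack psi psim.
rewrite /= /lebesgue_cons /pushforward.
rewrite (@product_measure_unique _ _ _ _ _ (@lebesgue_measure R) (lebesgue_rV R n)
  (pushforward (@lebesgue_measure R \x lebesgue_rV R n)%E psiM))//.
  rewrite /= /pushforward; congr (product_measure1 _ _ _).
  have psiE z : x - rV_cons (psi z) = rV_cons z.
    apply/rowP => i; rewrite 2!mxE.
    have [j ->|->] := unliftP ord0 i; rewrite ?rV_consS ?rV_cons0 /= /x0 /x' /= ?mxE; ring.
  by apply/seteqP; split => z /=; rewrite psiE.
move=> B C mB mC; rewrite /= /pushforward.
have -> : psi @^-1` (B `*` C) =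
  ((fun t : measurableTypeR R => x0 - t : measurableTypeR R) @^-1` B) `*`
  ((fun y => x' - y) @^-1` C) by [].
rewrite product_measure1E.
- by congr (_ * _)%E; [exact: lebesgue_reflect1|exact: IHn].
- by rewrite -[X in measurable X]setTI; exact: measurable_reflect1.
- by rewrite -[X in measurable X]setTI; exact: measurable_reflect.
rewrite -[X in measurable X]setTI; apply: measurable_rV_cons => //.
by rewrite -[X in measurable X]setTI; exact: measurable_reflect.
Qed.

Lemma ge0_integral_reflect n (x : 'rV[R]_n) (f : 'rV[R]_n -> \bar R) :
  measurable_fun setT f -> (forall y, (0 <= f y)%E) ->
  (\int[lebesgue_rV R n]_y f (x - y)%R = \int[lebesgue_rV R n]_y f y)%E.
Proof.
move=> mf f0; pose phi := fun y : 'rV[R]_n => x - y.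
pose phim := isMeasurableFun.Build _ _ _ _ phi (measurable_reflect x).
pose phiM : {mfun _ >-> _} := HB.pack phi phim.
transitivity (\int[pushforward (lebesgue_rV R n) phiM]_y f y)%E.
  rewrite (ge0_integral_pushforward (measurable_reflect x))//.
apply: eq_measure_integral => A mA _.
by rewrite /= /pushforward lebesgue_rV_reflect.
Qed.

End reflection.

(** * The kernel on shells *)

Section ereal_powers.
Context {R : realType}.
Local Open Scope ereal_scope.

Lemma lee_poweRl (r : R) (x y : \bar R) : (0 <= r)%R -> 0 <= x -> x <= y ->
  x `^ r <= y `^ r.
Proof.
move=> r0 x0 xy; apply: gt0_ler_poweR => //; rewrite in_itv/= leey andbT//.
exact: le_trans xy.
Qed.

Lemma poweRKV (r : R) (x : \bar R) : (0 < r)%R -> 0 <= x -> (x `^ r^-1) `^ r = x.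
Proof. by move=> r0 x0; rewrite -poweRrM mulVf ?gt_eqF// poweRe1. Qed.

Lemma poweRVK (r : R) (x : \bar R) : (0 < r)%R -> 0 <= x -> (x `^ r) `^ r^-1 = x.
Proof. by move=> r0 x0; rewrite -poweRrM divff ?gt_eqF// poweRe1. Qed.

End ereal_powers.

Section hoelder_integral.
Local Open Scope ereal_scope.
Context d (T : measurableType d) (R : realType).
Variable mu : {measure set T -> \bar R}.

Lemma measurable_fun_powRl (f : T -> R) (p : R) :
  measurable_fun setT f -> measurable_fun setT (fun x => f x `^ p)%R.
Proof. by move=> mf; exact: (measurableT_comp (measurable_powR p)). Qed.

Lemma hoelder_integral (D : set T) (f g : T -> R) (p q : R) :
  measurable D -> measurable_fun setT f -> measurable_fun setT g ->
  (forall x, 0 <= f x)%R -> (forall x, 0 <= g x)%R ->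
  (0 < p)%R -> (0 < q)%R -> (p^-1 + q^-1 = 1)%R ->
  \int[mu]_(x in D) (f x * g x)%:E <=
  (\int[mu]_(x in D) (f x `^ p)%:E) `^ p^-1 *
  (\int[mu]_(x in D) (g x `^ q)%:E) `^ q^-1.
Proof.
move=> mD mf mg f0 g0 p0 q0 pq.
pose F x := (f x * \1_D x)%R; pose G x := (g x * \1_D x)%R.
have mF : measurable_fun setT F by apply: measurable_funM.
have mG : measurable_fun setT G by apply: measurable_funM.
have H := hoelder mu mF mG p0 q0 pq.
have norm (h : T -> R) (s : R) : (0 < s)%R -> (forall x, 0 <= h x)%R ->
    'N[mu]_s%:E[EFin \o (fun x => h x * \1_D x)%R] =
    (\int[mu]_(x in D) (h x `^ s)%:E) `^ s^-1.
  move=> s0 h0; rewrite unlock /=; congr (_ `^ _).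
  rewrite [RHS]integral_mkcond; apply: eq_integral => x _.
  rewrite patchE indicE; case: (x \in D); rewrite ?mulr1 ?mulr0 /=.
    by rewrite ger0_norm.
  by rewrite normr0 powR0// gt_eqF.
apply: le_trans (le_trans H _).
  rewrite Lnorm1 integral_mkcond le_eqVlt; apply/orP; left; apply/eqP.
  apply: eq_integral => x _; rewrite patchE /F /G /= indicE.
  case: (x \in D); rewrite ?mulr1 ?mulr0/= ?normr0//.
  by rewrite ger0_norm// mulr_ge0.
by rewrite !norm.
Qed.

End hoelder_integral.

Section euclidean_geometry.
Local Open Scope classical_set_scope.
Context {R : realType} {n : nat}.
Local Notation mu := (lebesgue_rV R n).

Lemma measurable_eucl_norm :
  measurable_fun [set: 'rV[R]_n] (@eucl_norm R n : _ -> measurableTypeR R).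
Proof.
apply: (measurableT_comp (f := @Num.sqrt R : measurableTypeR R -> measurableTypeR R)).
  apply: continuous_measurable_fun; exact: sqrt_continuous.
apply: (@measurable_sum _ _ R _ _ (index_enum 'I_n)
  (fun i (x : 'rV[R]_n) => x ord0 i ^+ 2 : R)) => i.
apply: (measurable_funX 2).
exact: measurable_rV_coord.
Qed.

Lemma coord_le_eucl_norm (x : 'rV[R]_n) i : `|x ord0 i| <= eucl_norm x.
Proof.
rewrite -sqrtr_sqr ler_wsqrtr// (bigD1 i)//= lerDl.
by apply: sumr_ge0 => j _; exact: sqr_ge0.
Qed.

Lemma eucl_norm_ge0 (x : 'rV[R]_n) : 0 <= eucl_norm x.
Proof. exact: sqrtr_ge0. Qed.

Lemma eucl_norm_eq0 (x : 'rV[R]_n) : eucl_norm x = 0 -> x = 0.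
Proof.
move=> x0; apply/rowP => i; rewrite !mxE; apply/eqP.
by rewrite -normr_le0 -x0; exact: coord_le_eucl_norm.
Qed.

Lemma measurable_rV_box (a b : 'rV[R]_n) : measurable (rV_box a b).
Proof.
have -> : rV_box a b =
    \bigcap_(i in [set: 'I_n]) (rV_coord i @^-1` `[a ord0 i, b ord0 i]).
  apply/seteqP; split=> x /= xuv i; last by have := xuv i I; rewrite /= in_itv.
  by move=> _; rewrite /= in_itv; exact: xuv.
apply: fin_bigcap_measurable => // i _; rewrite -[X in measurable X]setTI.
exact: measurable_rV_coord.
Qed.

Definition shell (a b : R) : set 'rV[R]_n := [set x | a < eucl_norm x <= b].

Lemma measurable_shell a b : measurable (shell a b).
Proof.
rewrite (_ : shell a b = @eucl_norm R n @^-1` `]a, b]%classic).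
  by rewrite -[X in measurable X]setTI; exact: measurable_eucl_norm.
by apply/seteqP; split => x; rewrite /shell /= in_itv.
Qed.

Lemma measurable_eucl_ball t : measurable (eucl_ball (0 : 'rV[R]_n) t).
Proof.
rewrite (_ : eucl_ball 0 t = @eucl_norm R n @^-1` `]-oo, t[%classic).
  by rewrite -[X in measurable X]setTI; exact: measurable_eucl_norm.
by apply/seteqP; split => x; rewrite /eucl_ball /= in_itv/= subr0.
Qed.

Lemma eucl_ball_volume t : 0 < t ->
  (mu (eucl_ball (0 : 'rV[R]_n) t) <= ((2 * t) ^+ n)%:E)%E.
Proof.
move=> t0; have box := @lebesgue_rV_box R n (const_mx (- t)) (const_mx t).
have {}box : mu (rV_box (const_mx (- t)) (const_mx t)) = ((2 * t) ^+ n)%:E.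
  rewrite box => [|i]; last by rewrite !mxE; lra.
  congr EFin; rewrite (eq_bigr (fun=> 2 * t)) => [|i _]; last by rewrite !mxE; ring.
  by rewrite prodr_const card_ord.
rewrite -box; apply: le_measure; rewrite ?inE.
- exact: measurable_eucl_ball.
- exact: measurable_rV_box.
move=> x; rewrite /eucl_ball /= subr0 => xt i; rewrite !mxE -ler_norml.
by apply: (le_trans (coord_le_eucl_norm x i)); exact: ltW.
Qed.

End euclidean_geometry.

Lemma hoelder_conjugateE {R : realType} (s : R) : 1 < s ->
  hoelder_conjugate s%:E = (s / (s - 1))%:E.
Proof.
move=> s1; have s0 : 0 < s by exact: lt_trans s1.
rewrite /hoelder_conjugate /= gt_eqF// -EFinD inver.
by rewrite subr_eq0 gt_eqF.
Qed.

Section kernel.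
Local Open Scope classical_set_scope.
Context {R : realType} {n : nat}.
Local Notation mu := (lebesgue_rV R n).
Implicit Types (K g : 'rV[R]_n -> R).

(** [b] bounds the volume by which averages are normalized. A null [B] is
    a separate case, as its average is formed with an infinite factor. *)
Lemma avg_norm_integral_le (s : R) (B : set 'rV[R]_n) f (b c : R) : 0 < s ->
  measurable B -> (mu B <= b%:E)%E -> 0 <= c ->
  (avg_norm s%:E B f <= c%:E)%E ->
  (\int[mu]_(x in B) (`|f x| `^ s)%:E <= (b * c `^ s)%:E)%E.
Proof.
move=> s0 mB Bb c0; rewrite /avg_norm.
set I := (\int[mu]_(x in B) _)%E => H.
have f0 x : (0 <= (`|f x| `^ s)%:E)%E by rewrite lee_fin powR_ge0.
have I0 : (0 <= I)%E by apply: integral_ge0 => x _; exact: f0.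
have Bfin : mu B \is a fin_num.
  by rewrite ge0_fin_numE// (le_lt_trans Bb)// ltry.
have B0 : 0 <= fine (mu B) by rewrite fine_ge0.
rewrite -(fineK Bfin) in H Bb; rewrite lee_fin in Bb.
have [B00|Bn0] := eqVneq (fine (mu B)) 0.
  have muB0 : mu B = 0%E by rewrite -(fineK Bfin) B00.
  have I00 : (I <= \int[mu]_(x in B) 0)%E.
    by apply: (le_integral_nullD mB muB0) => // x nBx /nBx.
  rewrite integral0 in I00; apply: (le_trans I00).
  by rewrite lee_fin mulr_ge0 ?powR_ge0// (le_trans _ Bb)// B00.
have Bp : 0 < fine (mu B) by rewrite lt_neqAle eq_sym Bn0.
rewrite inver (negbTE Bn0) in H.
have J0 : (0 <= (fine (mu B))^-1%:E * I)%E.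
  by apply: mule_ge0 => //; rewrite lee_fin invr_ge0; exact: ltW.
have {}H : ((fine (mu B))^-1%:E * I <= (c `^ s)%:E)%E.
  rewrite -(poweRKV s0 J0) -poweR_EFin; apply: lee_poweRl => //.
    exact: ltW.
  exact: poweR_ge0.
rewrite lee_pdivrMl// in H; apply: (le_trans H).
by rewrite -EFinM lee_fin ler_wpM2r ?powR_ge0.
Qed.

Section bound.
Variables (alpha r : R) (K : 'rV[R]_n -> R) (N : set 'rV[R]_n).
Hypothesis an : alpha < n%:R.
Hypothesis r1 : 1 <= r.
Hypothesis mN : measurable N.
Hypothesis N0 : mu N = 0%E.
Local Notation Kb := (fun x => if x \in N then 0 else K x).
Hypothesis mK : measurable_fun [set: 'rV[R]_n] (Kb : _ -> measurableTypeR R).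

Let mKb : measurable_fun [set: 'rV[R]_n] (fun x => `|Kb x|).
Proof. by apply: measurableT_comp. Qed.

Let Kb_le x : `|Kb x| <= `|K x|.
Proof. by rewrite /=; case: ifP => //; rewrite normr0. Qed.

(** The annulus is closed at its outer radius 2t, but the average is over
    the open ball of this radius: only shells strictly inside are
    controlled. *)
Let shell_sub (t a b : R) (x : 'rV[R]_n) : t <= a -> b < 2 * t -> shell a b x ->
  annulus t x /\ eucl_ball 0 (2 * t) x.
Proof.
move=> ta bt /andP[ax xb]; rewrite /annulus /eucl_ball /= subr0; split.
- by rewrite (le_lt_trans ta ax) (le_trans xb (ltW bt)).
- exact: le_lt_trans bt.
Qed.

Lemma shell_power_bound (s C t a b : R) : 0 < s -> 0 <= C -> 0 < t -> t <= a ->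
  b < 2 * t -> (avg_norm_annulus s%:E t K <= (C * t `^ (alpha - n%:R))%:E)%E ->
  (\int[mu]_(x in shell a b) (`|Kb x| `^ s)%:E <=
    ((4 * t) ^+ n * (C * t `^ (alpha - n%:R)) `^ s)%:E)%E.
Proof.
move=> s0 C0 t0 ta bt H.
have t20 : 0 < 2 * t by rewrite mulr_gt0.
have vol := @eucl_ball_volume R n _ t20.
have c0 : 0 <= C * t `^ (alpha - n%:R) by rewrite mulr_ge0// powR_ge0.
rewrite (_ : 4 * t = 2 * (2 * t)); last by ring.
apply: le_trans (avg_norm_integral_le s0 (measurable_eucl_ball _) vol c0 H).
rewrite integral_mkcond [leRHS]integral_mkcond.
apply: (le_integral_null mN N0) => x; rewrite ?patchE.
- by case: ifP => // _; rewrite lee_fin powR_ge0.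
- by case: ifP => // _; rewrite lee_fin powR_ge0.
move=> _; case: ifPn => [/set_mem xab|_]; last first.
  by case: ifP => // _; rewrite lee_fin powR_ge0.
have [xa xB] := shell_sub ta bt xab.
rewrite (mem_set xB) lee_fin indicE (mem_set xa) mulr1.
by apply: ler_powRl => //; exact: ltW.
Qed.

Lemma shell_sup_bound (C t a b : R) g : 0 <= C -> 0 < t -> t <= a ->
  b < 2 * t -> (avg_norm_annulus +oo%E t K <= (C * t `^ (alpha - n%:R))%:E)%E ->
  measurable_fun [set: 'rV[R]_n] (g : _ -> measurableTypeR R) ->
  (forall x, 0 <= g x) ->
  (\int[mu]_(x in shell a b) (`|Kb x| * g x)%:E <=
    (C * t `^ (alpha - n%:R))%:E * \int[mu]_(x in shell a b) (g x)%:E)%E.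
Proof.
move=> C0 t0 ta bt /ess_supP[N1 [mN1 N10 N1P]] mg g0.
have c0 : 0 <= C * t `^ (alpha - n%:R) by rewrite mulr_ge0// powR_ge0.
rewrite -ge0_integralZl_EFin//; last 3 first.
- exact: measurable_shell.
- by move=> x _; rewrite lee_fin.
- by apply/measurable_EFinP; exact: measurable_funTS.
apply: (le_integral_nullD mN1 N10) => [x|x|x N1x xab].
- by rewrite lee_fin mulr_ge0.
- by rewrite mule_ge0 ?lee_fin.
have [xa xB] := shell_sub ta bt xab.
rewrite -EFinM lee_fin ler_wpM2r//; apply: (le_trans (Kb_le x)).
have [//|nle] := boolP (`|K x| <= C * t `^ (alpha - n%:R)).
exfalso; apply: N1x; apply: N1P => /=.
rewrite lee_fin !indicE (mem_set xa) (mem_set xB) !mulr1.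
exact/negP.
Qed.

Hypothesis size : exists2 C : R, 0 < C & forall t, 0 < t ->
  (avg_norm_annulus (hoelder_conjugate r%:E) t K <=
    (C * t `^ (alpha - n%:R))%:E)%E.

Let shellU (t : R) : 0 < t ->
  [/\ shell t (2 * t) = shell t (3 / 2 * t) `|` shell (3 / 2 * t) (2 * t) :> set 'rV[R]_n &
     [disjoint (shell t (3 / 2 * t) : set 'rV[R]_n) & shell (3 / 2 * t) (2 * t)]].
Proof.
move=> t0; split.
  apply/seteqP; split => x; rewrite /shell /=.
    move=> /andP[tx x2]; case: (leP (eucl_norm x) (3 / 2 * t)) => h.
      by left; rewrite tx.
    by right.
  by case=> /andP[tx x2]; apply/andP; split; lra.
apply/disj_setPS => x [] /andP[_ h] /andP[h' _].
by move: (lt_le_trans h' h); rewrite ltxx.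
Qed.

(** Hölder's inequality with the exponents r' and r, or the essential
    supremum when r = 1. The shell is cut at radius 3t/2, so that its two
    halves are strictly inside the annuli of radii t and 3t/2. *)
Lemma shell_kernel_bound : exists2 C : R, 0 < C &
  forall (t : R) g, 0 < t ->
  measurable_fun [set: 'rV[R]_n] (g : _ -> measurableTypeR R) ->
  (forall x, 0 <= g x) ->
  (\int[mu]_(x in shell t (2 * t)) (`|Kb x| * g x)%:E <=
   (C * t `^ (alpha - n%:R / r))%:E *
   (\int[mu]_(x in shell t (2 * t)) (g x `^ r)%:E) `^ r^-1)%E.
Proof.
have [C C0 H] := size; have r0 : 0 < r by exact: lt_le_trans r1.
have C0' := ltW C0.
have t3 (t : R) : 0 < t -> [/\ 0 < 3 / 2 * t, 3 / 2 * t < 2 * t,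
    2 * t < 2 * (3 / 2 * t) & t <= t].
  by move=> t0; split => //; lra.
have mono (t : R) : 0 < t -> (3 / 2 * t) `^ (alpha - n%:R) <= t `^ (alpha - n%:R).
  move=> t0; have tt : t <= 3 / 2 * t by lra.
  have [t30 _ _ _] := t3 _ t0.
  rewrite -[alpha - _]opprB !powRN lef_pV2 ?posrE ?powR_gt0//.
  by apply: ler_powRl => //; rewrite ?subr_ge0; exact: ltW.
move: r1; rewrite le_eqVlt => /predU1P[r1E|r1'].
  rewrite -r1E hoelder_conjugate1 in H.
  exists (2 * C); first by rewrite mulr_gt0.
  move=> t g t0 mg g0; rewrite -r1E !invr1 mulr1.
  have [t30 t32 t33 tt] := t3 _ t0; have [SU Sd] := shellU t0.
  have gI : (0 <= \int[mu]_(x in shell t (2 * t)) (g x)%:E)%E.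
    by apply: integral_ge0 => x _; rewrite lee_fin.
  rewrite poweRe1; last first.
    by apply: integral_ge0 => x _; rewrite lee_fin powR_ge0.
  under [X in (_ <= _ * X)%E]eq_integral do rewrite powRr1//.
  have mKg : measurable_fun [set: 'rV[R]_n] (fun x => (`|Kb x| * g x)%:E).
    by apply/measurable_EFinP; exact: measurable_funM.
  have sub (a b : R) : shell a b `<=` (shell t (2 * t) : set 'rV[R]_n) ->
      (\int[mu]_(x in shell a b) (g x)%:E <=
       \int[mu]_(x in shell t (2 * t)) (g x)%:E)%E.
    move=> ab; apply: ge0_subset_integral => //; try exact: measurable_shell.
    - by apply/measurable_EFinP; exact: measurable_funTS.
    - by move=> x _; rewrite lee_fin.
  have b1 := @shell_sup_bound C t t (3 / 2 * t) g C0' t0 tt t32 (H _ t0) mg g0.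
  have b2 := @shell_sup_bound C (3 / 2 * t) (3 / 2 * t) (2 * t) g C0' t30 (lexx _)
    t33 (H _ t30) mg g0.
  rewrite {1}SU ge0_integral_setU//; last 4 first.
  - exact: measurable_shell.
  - exact: measurable_shell.
  - exact: measurable_funTS.
  - by move=> x _; rewrite lee_fin mulr_ge0.
  have c0 : 0 <= C * t `^ (alpha - n%:R) by rewrite mulr_ge0// powR_ge0.
  have -> : 2 * C * t `^ (alpha - n%:R) =
    C * t `^ (alpha - n%:R) + C * t `^ (alpha - n%:R) by ring.
  rewrite EFinD ge0_muleDl ?lee_fin//.
  apply: leeD.
    apply: (le_trans b1); apply: lee_wpmul2l.
      by rewrite lee_fin mulr_ge0 ?powR_ge0.
    by apply: sub; rewrite SU; exact: subsetUl.
  apply: (le_trans b2); apply: lee_pmul.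
  - by rewrite lee_fin mulr_ge0 ?powR_ge0.
  - by apply: integral_ge0 => x _; rewrite lee_fin.
  - by rewrite lee_fin ler_wpM2l// mono.
  - by apply: sub; rewrite SU; exact: subsetUr.
pose s := r / (r - 1).
have sB0 : 0 < r - 1 by rewrite subr_gt0.
have s0 : 0 < s by rewrite divr_gt0.
have sE : hoelder_conjugate r%:E = s%:E by exact: hoelder_conjugateE.
have sr : s^-1 + r^-1 = 1 by rewrite /s invf_div; field; rewrite gt_eqF.
rewrite sE in H.
pose D := (4 ^+ n + 6 ^+ n) * C `^ s.
have D0 : 0 < D by rewrite mulr_gt0 ?powR_gt0// addr_gt0// exprn_gt0.
exists (D `^ s^-1); first by rewrite powR_gt0.
move=> t g t0 mg g0.
have [t30 t32 t33 tt] := t3 _ t0; have [SU Sd] := shellU t0.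
have mKp : measurable_fun [set: 'rV[R]_n] (fun x => (`|Kb x| `^ s)%:E).
  by apply/measurable_EFinP; exact: measurable_fun_powRl.
have KbI : (\int[mu]_(x in shell t (2 * t)) (`|Kb x| `^ s)%:E <=
    (D * t `^ (n%:R + (alpha - n%:R) * s))%:E)%E.
  have mS1 := @measurable_shell R n t (3 / 2 * t).
  have mS2 := @measurable_shell R n (3 / 2 * t) (2 * t).
  have pos (x : 'rV[R]_n) : (0 <= (`|Kb x| `^ s)%:E)%E by rewrite lee_fin powR_ge0.
  rewrite SU (ge0_integral_setU mu mS1 mS2 (measurable_funTS mKp) (fun x _ => pos x) Sd).
  have b1 := @shell_power_bound s C t t (3 / 2 * t) s0 C0' t0 tt t32 (H _ t0).
  have b2 := @shell_power_bound s C (3 / 2 * t) (3 / 2 * t) (2 * t) s0 C0' t30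
    (lexx _) t33 (H _ t30).
  apply: (le_trans (leeD b1 b2)); rewrite -EFinD lee_fin.
  rewrite [t `^ (n%:R + _)]powRD; last by rewrite (gt_eqF t0) implybT.
  rewrite powR_mulrn ?(ltW t0)// powRrM /D.
  have TT := ler_powRl (ltW s0) (powR_ge0 _ _) (mono _ t0).
  rewrite (powRM s C0' (powR_ge0 t _)) (powRM s C0' (powR_ge0 (3 / 2 * t) _)).
  rewrite (_ : 4 * (3 / 2 * t) = 6 * t); last by field.
  rewrite !exprMn; move: TT (powR_ge0 C s); move: (_ `^ s) (_ `^ s) (C `^ s).
  move=> T T' Cs TT Cs0; rewrite -subr_ge0.
  rewrite (_ : _ - _ = 6 ^+ n * t ^+ n * (Cs * (T - T'))); last by ring.
  apply: mulr_ge0; first by apply: mulr_ge0; apply: exprn_ge0 => //; exact: ltW.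
  by apply: mulr_ge0 => //; rewrite subr_ge0.
have mS : measurable (shell t (2 * t) : set 'rV[R]_n) by exact: measurable_shell.
have hold := @hoelder_integral _ _ R mu (shell t (2 * t)) (fun x => `|Kb x|) g s r
  mS mKb mg (fun x => normr_ge0 _) g0 s0 r0 sr.
apply: (le_trans hold); apply: lee_wpmul2r; first exact: poweR_ge0.
apply: (le_trans (lee_poweRl _ _ KbI)).
- by rewrite invr_ge0 ltW.
- by apply: integral_ge0 => x _; rewrite lee_fin powR_ge0.
rewrite poweR_EFin lee_fin powRM ?powR_ge0 ?(ltW D0)// -powRrM.
rewrite le_eqVlt; apply/orP; left; apply/eqP; congr (_ * _ `^ _).
rewrite mulrDl -mulrA divff ?gt_eqF// mulr1.
have -> : s^-1 = 1 - r^-1 by rewrite -sr addrK.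
by ring.
Qed.

End bound.
End kernel.

(** * Finite dyadic grids and the one-third trick *)

Section half_open.
Local Open Scope classical_set_scope.
Context {R : realType}.

Definition half_open_cube n (a : 'rV[R]_n) (l : R) : set 'rV[R]_n :=
  [set x | forall i, a ord0 i <= x ord0 i < a ord0 i + l].

Lemma measurable_half_open_cube n (a : 'rV[R]_n) (l : R) :
  measurable (half_open_cube a l).
Proof.
have -> : half_open_cube a l =
    \bigcap_(i in [set: 'I_n]) (rV_coord i @^-1` `[a ord0 i, a ord0 i + l[).
  apply/seteqP; split=> x /= xuv i; last by have := xuv i I; rewrite /= in_itv.
  by move=> _; rewrite /= in_itv; exact: xuv.
apply: fin_bigcap_measurable => // i _; rewrite -[X in measurable X]setTI.
exact: measurable_rV_coord.
Qed.

Lemma half_open_cube_volume n (a : 'rV[R]_n) (l : R) : 0 < l ->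
  lebesgue_rV R n (half_open_cube a l) = (l ^+ n)%:E.
Proof.
move=> l0; elim: n a => [|n IHn] a.
  by rewrite /= diracE mem_set ?expr0// => -[].
pose tl : 'rV[R]_n := \row_i a ord0 (lift ord0 i).
have boxE : @rV_cons R n @^-1` half_open_cube a l =
    `[a ord0 ord0, a ord0 ord0 + l[ `*` half_open_cube tl l.
  apply/seteqP; split=> [x /= xab|x /= [x1 x2] i].
    split; first by rewrite /= in_itv /= -rV_cons0; exact: xab.
    by move=> i; rewrite !mxE -rV_consS; exact: xab.
  have [j ->|->] := unliftP ord0 i.
    by rewrite rV_consS; have := x2 j; rewrite !mxE.
  by rewrite rV_cons0; move: x1; rewrite /= in_itv.
rewrite /= /lebesgue_cons /pushforward boxE product_measure1E//; last first.
  exact: measurable_half_open_cube.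
rewrite IHn exprS EFinM; congr (_ * _)%E.
rewrite [LHS]lebesgue_measure_itv/= lte_fin ltrDl l0 -EFinB.
by congr EFin; ring.
Qed.

End half_open.

Section grid.
Context {R : realType} {n M : nat}.
Variables (a : 'rV[R]_n) (h : R).
Hypothesis h0 : 0 < h.
Hypothesis n0 : (0 < n)%N.
Local Notation mu := (lebesgue_rV R n).
Local Notation index := {ffun 'I_n -> 'I_(2 ^ M)}.
Implicit Types (w : index) (Q : {set index}).

Definition leaf w : set 'rV[R]_n :=
  half_open_cube (\row_i (a ord0 i + (w i)%:R * h)) h.

(** A dyadic cube of generation [j], as the set of leaves whose
    coordinates agree with those of [w] up to the last [j] bits. *)
Definition cell (j : nat) w : {set index} :=
  [set w' : index | [forall i, (w' i %/ 2 ^ j == w i %/ 2 ^ j)%N]].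

Definition dyadic_cubes : {set {set index}} :=
  [set Q | [exists j : 'I_M.+1, exists w, Q == cell j w]].

(** The same cube as a set of points. *)
Definition cell_cube (j : nat) w : set 'rV[R]_n :=
  half_open_cube (\row_i (a ord0 i + (w i %/ 2 ^ j)%:R * (2 ^+ j * h))) (2 ^+ j * h).

Lemma cellP j w w' : reflect (forall i, (w' i %/ 2 ^ j = w i %/ 2 ^ j)%N)
  (w' \in cell j w).
Proof.
by rewrite inE; apply: (iffP forallP) => H i; [exact/eqP|apply/eqP].
Qed.

Lemma mem_cell j w : w \in cell j w. Proof. exact/cellP. Qed.

Lemma cell_eq j w w' : w' \in cell j w -> cell j w' = cell j w.
Proof.
move/cellP => H; apply/setP => z; apply/cellP/cellP => K i; first by rewrite K H.
by rewrite K -H.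
Qed.

Lemma cellS j k w : (j <= k)%N -> cell j w \subset cell k w.
Proof.
move=> jk; apply/fintype.subsetP => z /cellP zw; apply/cellP => i.
by rewrite -(subnKC jk) expnD !divnMA zw.
Qed.

Lemma dyadic_cubesP Q : Q \in dyadic_cubes ->
  exists j w, (j <= M)%N /\ Q = cell j w.
Proof.
rewrite inE => /existsP[j /existsP[w /eqP->]]; exists j, w; split => //.
by rewrite -ltnS.
Qed.

Lemma cell_dyadic j w : (j <= M)%N -> cell j w \in dyadic_cubes.
Proof.
rewrite -ltnS => jM; rewrite inE; apply/existsP; exists (Ordinal jM).
by apply/existsP; exists w.
Qed.

Lemma dyadic_laminar : laminar dyadic_cubes.
Proof.
split=> [Q Q' /dyadic_cubesP[j [w [jM ->]]] /dyadic_cubesP[k [z [kM ->]]]|Q]; last first.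
  move=> /dyadic_cubesP[j [w [_ ->]]].
  by apply/card_gt0P; exists w; exact: mem_cell.
rewrite orbA; have [//|/pred0Pn[y /= /andP[yw yz]]] := boolP [disjoint _ & _].
  by rewrite orbT.
rewrite -(cell_eq yw) -(cell_eq yz) orbF.
by have [jk|/ltnW kj] := leqP j k; apply/orP; [left|right]; exact: cellS.
Qed.

Lemma measurable_leaf w : measurable (leaf w).
Proof. exact: measurable_half_open_cube. Qed.

Lemma leaf_inj w w' x : leaf w x -> leaf w' x -> w = w'.
Proof.
move=> lw lw'; apply/ffunP => i; apply/val_inj/eqP; rewrite eqn_leq.
suff H (u v : index) : leaf u x -> leaf v x -> (u i <= v i)%N by rewrite !H.
move=> /(_ i) /andP[ux _] /(_ i) /andP[_ vx].
have : (u i)%:R * h < (v i).+1%:R * h.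
  rewrite -(ltrD2l (a ord0 i)); move: ux vx; rewrite !mxE => ux vx.
  by rewrite -natr1 mulrDl mul1r addrA (le_lt_trans ux).
by rewrite ltr_pM2r// ltr_nat ltnS.
Qed.

Lemma cell_cubeE j w : (j <= M)%N ->
  cell_cube j w = (\bigcup_(w' in [set` cell j w]) leaf w')%classic.
Proof.
move=> jM; have pj : (0 < 2 ^ j)%N by rewrite expn_gt0.
have powE : 2 ^+ j = (2 ^ j)%:R :> R by rewrite natrX.
apply/seteqP; split => x.
  move=> xc; have x0 i : 0 <= (x ord0 i - a ord0 i) / h.
    have /andP[] := xc i; rewrite !mxE => ax _.
    rewrite divr_ge0 ?(ltW h0)// subr_ge0 (le_trans _ ax)// lerDl.
    by rewrite mulr_ge0// mulr_ge0// ltW.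
  pose k i := Num.truncn ((x ord0 i - a ord0 i) / h).
  have kP i : (k i)%:R <= (x ord0 i - a ord0 i) / h < (k i).+1%:R.
    exact: truncn_itv.
  have kw i : (k i %/ 2 ^ j = w i %/ 2 ^ j)%N.
    have /andP[] := xc i; rewrite !mxE => ax xb.
    have /andP[kx xk] := kP i.
    have A1 : ((w i %/ 2 ^ j) * 2 ^ j)%N%:R < (k i).+1%:R :> R.
      apply: le_lt_trans xk; rewrite ler_pdivlMr// natrM -powE.
      by move: ax; lra.
    have A2 : (k i)%:R < ((w i %/ 2 ^ j).+1 * 2 ^ j)%N%:R :> R.
      apply: le_lt_trans kx _; rewrite ltr_pdivrMr// natrM -powE -natr1.
      by move: xb; lra.
    rewrite !ltr_nat ltnS in A1 A2; apply/eqP; rewrite eqn_leq.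
    by rewrite -ltnS ltn_divLR// A2 leq_divRL.
  have kM i : (k i < 2 ^ M)%N.
    have wM : (w i < 2 ^ (M - j) * 2 ^ j)%N by rewrite -expnD subnK.
    have : (k i %/ 2 ^ j < 2 ^ (M - j))%N by rewrite kw ltn_divLR.
    by rewrite ltn_divLR// -expnD subnK.
  exists [ffun i => Ordinal (kM i)].
    by apply/cellP => i; rewrite ffunE /= kw.
  move=> i; rewrite !mxE ffunE /=; have /andP[kx xk] := kP i.
  rewrite ler_pdivlMr// in kx; rewrite ltr_pdivrMr// -natr1 in xk.
  by apply/andP; split; lra.
move=> [w' /= /cellP ww' xw'] i; rewrite !mxE -ww'.
have /andP[] := xw' i; rewrite !mxE => ax xb.
rewrite mulrA powE -natrM; apply/andP; split.
  apply: le_trans ax; rewrite lerD2l ler_pM2r// ler_nat; exact: leq_divM.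
apply: (lt_le_trans xb); rewrite -!addrA lerD2l -mulrDl.
rewrite -[X in _ + X](mul1r h) -mulrDl ler_pM2r// natr1 -natrD ler_nat.
by rewrite -mulSnr -ltn_divLR.
Qed.

Lemma integral_cell (f : 'rV[R]_n -> \bar R) Q :
  measurable_fun setT f -> (forall x, (0 <= f x)%E) ->
  (\int[mu]_(x in (\bigcup_(w in [set` Q]) leaf w)%classic) f x =
   \sum_(w in Q) \int[mu]_(x in leaf w) f x)%E.
Proof.
move=> mf f0.
have -> : (\bigcup_(w in [set` Q]) leaf w)%classic =
    \big[setU/set0%classic]_(w <- enum Q) leaf w.
  rewrite -bigcup_seq; apply/seteqP; split => x [w wQ xw]; exists w => //.
    by move: wQ; rewrite /= mem_enum.
  by move: wQ; rewrite /= mem_enum.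
rewrite ge0_integral_bigsetU//.
- by rewrite big_enum.
- by move=> w; exact: measurable_leaf.
- exact: enum_uniq.
- by move=> w w' _ _ [x [xw xw']]; exact: leaf_inj xw xw'.
- exact: measurable_funTS.
Qed.

Lemma leaf_volume w : mu (leaf w) = (h ^+ n)%:E.
Proof. exact: half_open_cube_volume. Qed.

Lemma cell_cube_volume j w : mu (cell_cube j w) = ((2 ^+ j * h) ^+ n)%:E.
Proof. by apply: half_open_cube_volume; rewrite mulr_gt0// exprn_gt0. Qed.

Lemma mass_cell j w : (j <= M)%N ->
  mass (fun=> h ^+ n) (cell j w) = (2 ^+ j * h) ^+ n.
Proof.
move=> jM; apply: EFin_inj; rewrite -(cell_cube_volume j w).
have -> : mu (cell_cube j w) = (\int[mu]_(x in cell_cube j w) 1)%E.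
  by rewrite integral_cst ?mul1e//; exact: measurable_half_open_cube.
rewrite cell_cubeE// (integral_cell _ (measurable_cst _) (fun _ => lee01)).
rewrite /mass -sumEFin.
apply: eq_bigr => z _; rewrite integral_cst ?mul1e; last exact: measurable_leaf.
exact/esym/leaf_volume.
Qed.

(** The side at least doubles, and the dimension is positive. *)
Lemma dyadic_halving : {in dyadic_cubes &, forall Q G : {set index}, Q \proper G ->
  2 * mass (fun=> h ^+ n) Q <= mass (fun=> h ^+ n) G}.
Proof.
move=> _ _ /dyadic_cubesP[j [w [jM ->]]] /dyadic_cubesP[k [z [kM ->]]] QG.
have wz : w \in cell k z := fintype.subsetP (proper_sub QG) _ (mem_cell j w).
rewrite -(cell_eq wz) in QG *.
have jk : (j < k)%N.
  rewrite ltnNge; apply: contraL QG => kj; rewrite properE negb_and negbK.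
  by apply/orP; right; exact: cellS.
rewrite !mass_cell// !exprMn mulrA ler_wpM2r ?exprn_ge0 ?(ltW h0)//.
rewrite -!exprM -exprS ler_weXn2l ?ler1n//.
by rewrite -(prednK n0); move: jk; nia.
Qed.

End grid.

Section one_third.
Context {R : realType} {n : nat}.

(** 3 divides no power of 2. *)
Lemma pow2_third (e : nat) (z : int) : 1 / 3 <= `|2 ^+ e / 3 - z%:~R| :> R.
Proof.
have ne : (2 ^ e)%N%:Z - 3 * z != 0.
  rewrite subr_eq0; apply/eqP => H.
  have : (3 %| 2 ^ e)%N.
    have [k zk] : exists k : nat, z = k%:Z.
      by exists `|z|%N; rewrite gez0_abs//; move: H; lia.
    by move: H; rewrite zk -PoszM => -[->]; rewrite dvdn_mulr.
  by rewrite Euclid_dvdX// => /andP[].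
have : 1 <= `|((2 ^ e)%N%:Z - 3 * z)%:~R| :> R.
  by rewrite -intr_norm ler1z -gtz0_ge1 normr_gt0.
rewrite intrB intrM -[(2 ^ e)%N%:Z%:~R]/((2 ^ e)%N%:R) natrX => H.
have -> : 2 ^+ e / 3 - z%:~R = (2 ^+ e - 3%:~R * z%:~R) / 3 :> R by field.
by rewrite normrM [`|3^-1|]ger0_norm ?invr_ge0// ler_pM2r.
Qed.

(** If integers were at distance at most 1/8 from both u and u + d, then d
    would be at distance at most 1/4 from an integer. *)
Lemma one_third_floor (u d : R) :
  (forall z : int, 1 / 3 <= `|d - z%:~R|) ->
  Num.floor (u - 8^-1) = Num.floor (u + 8^-1) \/
  Num.floor (u + d - 8^-1) = Num.floor (u + d + 8^-1).
Proof.
move=> dz.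
have near (v : R) : Num.floor (v - 8^-1) <> Num.floor (v + 8^-1) ->
    `|v - (Num.floor (v + 8^-1))%:~R| <= 8^-1.
  move=> /eqP ne; have le : Num.floor (v - 8^-1) <= Num.floor (v + 8^-1).
    by apply: le_floor; lra.
  have {ne le}lt : Num.floor (v - 8^-1) + 1 <= Num.floor (v + 8^-1).
    by rewrite lezD1 lt_neqAle ne.
  have h1 : v - 8^-1 < (Num.floor (v - 8^-1) + 1)%:~R := floorD1_gt _.
  have h2 : (Num.floor (v + 8^-1))%:~R <= v + 8^-1 := floor_le_tmp _.
  have h3 : (Num.floor (v - 8^-1) + 1)%:~R <= (Num.floor (v + 8^-1))%:~R :> R.
    by rewrite ler_int.
  by rewrite ler_norml; apply/andP; split; lra.
have [->|/eqP/near h1] := eqVneq (Num.floor (u - 8^-1)) (Num.floor (u + 8^-1)).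
  by left.
have [->|/eqP/near h2] := eqVneq (Num.floor (u + d - 8^-1)) (Num.floor (u + d + 8^-1)).
  by right.
exfalso; have := dz (Num.floor (u + d + 8^-1) - Num.floor (u + 8^-1)).
rewrite intrB; move: h1 h2; rewrite !ler_norml => /andP[a1 a2] /andP[b1 b2].
by rewrite leNgt => /negP; apply; rewrite ltr_norml; apply/andP; split; lra.
Qed.

Lemma leafP (M : nat) (a : 'rV[R]_n) h (w : {ffun 'I_n -> 'I_(2 ^ M)}) x :
  leaf a h w x <-> forall i,
    a ord0 i + (w i)%:R * h <= x ord0 i < a ord0 i + (w i)%:R * h + h.
Proof. by split=> H i; have := H i; rewrite !mxE. Qed.

Lemma cell_cubeP (M : nat) (a : 'rV[R]_n) h j (w : {ffun 'I_n -> 'I_(2 ^ M)}) x :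
  cell_cube a h j w x <-> forall i,
    a ord0 i + (w i %/ 2 ^ j)%:R * (2 ^+ j * h) <= x ord0 i <
    a ord0 i + (w i %/ 2 ^ j)%:R * (2 ^+ j * h) + 2 ^+ j * h.
Proof. by split=> H i; have := H i; rewrite !mxE. Qed.

(** The corner of a root cube of side 2^(m + 5), which contains the cube
    |x_i| <= 2^m also after a shift by a third of 2^(m + 3) in the
    coordinates selected by [eps]. *)
Definition corner (m : nat) (eps : {ffun 'I_n -> bool}) : 'rV[R]_n :=
  \row_i (- 2 ^+ (m + 3) - (if eps i then 2 ^+ (m + 3) / 3 else 0)).

(** The cube has side s = 16 * 2^k / 2^m, and the points [y] are at
    distance at most s/8 from [x] in each coordinate. The shift is 2^e/3
    times s for a natural number e, so it is at least s/3 away from the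
    multiples of s by [pow2_third], and in each coordinate at least one of
    the two grids does not cut the interval of length s/4 around x. *)
Lemma one_third_trick (m k : nat) (x : 'rV[R]_n) : (k < m + m)%N ->
  (forall i, `|x ord0 i| <= 2 ^+ m) ->
  exists (eps : {ffun 'I_n -> bool}) (w : {ffun 'I_n -> 'I_(2 ^ (m + m + 5))}),
    leaf (corner m eps) (2 ^- m) w x /\
    forall y : 'rV[R]_n, (forall i, `|y ord0 i - x ord0 i| <= 2 ^+ k.+1 / 2 ^+ m) ->
      cell_cube (corner m eps) (2 ^- m) (k + 4) w y.
Proof.
move=> km xm.
pose e := (m + m - k.+1)%N.
pose h : R := 2 ^- m; pose s : R := 2 ^+ (k + 4) * h.
have h0 : 0 < h by rewrite invr_gt0 exprn_gt0.
have s0 : 0 < s by rewrite mulr_gt0 ?exprn_gt0.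
have sE : 2 ^+ (m + 3) = 2 ^+ e * s :> R.
  rewrite /s /h mulrA -exprD; apply: (canRL (mulfK _)); first by rewrite expf_neq0.
  by rewrite -exprD; congr (_ ^+ _); rewrite /e; lia.
have rE : 2 ^+ k.+1 / 2 ^+ m = 8^-1 * s :> R.
  by rewrite /s /h exprD exprS mulrA; congr (_ * _); field.
pose u i := (x ord0 i + 2 ^+ (m + 3)) / s.
pose eps : {ffun 'I_n -> bool} :=
  [ffun i => Num.floor (u i - 8^-1) != Num.floor (u i + 8^-1)].
pose a := corner m eps.
pose v i := (x ord0 i - a ord0 i) / s.
have vE i : v i = if eps i then u i + 2 ^+ e / 3 else u i.
  rewrite /v /a /corner mxE /u; case: (eps i); last by congr (_ / _); ring.
  rewrite {2}sE; field; exact: lt0r_neq0.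
have vfl i : Num.floor (v i - 8^-1) = Num.floor (v i + 8^-1).
  rewrite vE /eps ffunE; case: eqP => //= ne.
  by have [//|] := one_third_floor (u i) (pow2_third e).
have p0 : 0 < 2 ^+ m :> R by rewrite exprn_gt0.
have p3 : 2 ^+ (m + 3) = 8 * 2 ^+ m :> R by rewrite exprD; ring.
have xa i : 0 <= x ord0 i - a ord0 i < 32 * 2 ^+ m.
  have := xm i; rewrite ler_norml /a /corner mxE p3 => /andP[x1 x2].
  by case: (eps i); apply/andP; split; lra.
have kP i : (Num.truncn ((x ord0 i - a ord0 i) / h))%:R <=
    (x ord0 i - a ord0 i) / h < (Num.truncn ((x ord0 i - a ord0 i) / h)).+1%:R.
  by apply: truncn_itv; rewrite divr_ge0 ?(ltW h0)//; have /andP[] := xa i.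
have kM i : (Num.truncn ((x ord0 i - a ord0 i) / h) < 2 ^ (m + m + 5))%N.
  have /andP[k1 _] := kP i; rewrite -(ltr_nat R); apply: (le_lt_trans k1).
  rewrite ltr_pdivrMr// natrX !exprD; have /andP[_ x2] := xa i.
  rewrite (_ : _ * h = 2 ^+ m * (2 ^+ 5)); last by rewrite /h; field; rewrite gt_eqF.
  by move: x2; lra.
pose w : {ffun 'I_n -> 'I_(2 ^ (m + m + 5))} := [ffun i => Ordinal (kM i)].
have xw : leaf a h w x.
  apply/leafP => i; rewrite ffunE /=; have /andP[k1 k2] := kP i.
  rewrite ler_pdivlMr// in k1; rewrite ltr_pdivrMr// -natr1 in k2.
  by apply/andP; split; lra.
exists eps, w; split => // y yx; apply/cell_cubeP => i; rewrite -/a -/h -/s.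
have k4M : (k + 4 <= m + m + 5)%N by lia.
have xc : cell_cube a h (k + 4) w x.
  by rewrite cell_cubeE//; exists w => //=; exact: mem_cell.
move/cell_cubeP : xc => /(_ i) /andP[]; rewrite -/s.
set c := (w i %/ 2 ^ (k + 4))%N => c1 c2.
have vc : Num.floor (v i) = c%:Z.
  apply: floor_def; rewrite intrD -[c%:Z%:~R]/(c%:R) /v.
  by rewrite ler_pdivlMr// ltr_pdivrMr//; apply/andP; split; lra.
have fc : Num.floor (v i - 8^-1) = c%:Z.
  apply/eqP; rewrite eq_le -{1}vc; apply/andP; split; first by apply: le_floor; lra.
  by rewrite vfl -vc; apply: le_floor; lra.
have f1 : c%:R <= v i - 8^-1.
  by have := floor_le_tmp (v i - 8^-1); rewrite fc.
have f2 : v i + 8^-1 < c%:R + 1.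
  by have := floorD1_gt (v i + 8^-1); rewrite -vfl fc intrD.
have := yx i; rewrite rE ler_norml => /andP[y1 y2].
have vs : v i * s = x ord0 i - a ord0 i by rewrite /v divfK// gt_eqF.
have f1s : c%:R * s <= x ord0 i - a ord0 i - 8^-1 * s.
  by rewrite -vs -mulrBl ler_pM2r.
have f2s : x ord0 i - a ord0 i + 8^-1 * s < (c%:R + 1) * s.
  by rewrite -vs -mulrDl ltr_pM2r.
by apply/andP; split; lra.
Qed.

End one_third.

(** * Masses of a weight on a grid *)

(** Both integrals are positive, so an infinite one would make the product
    infinite. *)
Lemma muckenhoupt_product_finite {R : realType} (J1 J2 : \bar R) (v rho A : R) :
  0 < v -> 0 < rho -> (0 < J1)%E -> (0 < J2)%E ->
  (v%:E * J1 * (v%:E * J2) `^ rho <= A%:E)%E ->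
  [/\ (J1 < +oo)%E, (J2 < +oo)%E & v * fine J1 * (v * fine J2) `^ rho <= A].
Proof.
move=> v0 rho0; have v0' : (0 < v%:E)%E by rewrite lte_fin.
case: J1 => [j1| |]//; case: J2 => [j2| |]// J10 J20.
- by rewrite -!EFinM lee_fin => H; rewrite !ltry.
- by rewrite gt0_muley// poweRyr ?gt_eqF// gt0_muley// mule_gt0.
- by rewrite gt0_muley// gt0_mulye// poweR_gt0// mule_gt0.
- by rewrite !gt0_muley// poweRyr ?gt_eqF.
Qed.

(** A Hölder bound of [c], solved for its first factor. *)
Lemma powR_average_le {R : realType} (c s y a b : R) : 0 <= c -> 0 < s -> 0 <= y ->
  0 < a -> a^-1 + b^-1 = 1 -> c <= y `^ a^-1 * s `^ b^-1 -> s * (c / s) `^ a <= y.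
Proof.
move=> c0 s0 y0 a0 ab /(ler_powRl (ltW a0) c0).
rewrite powRM ?powR_ge0// powRKV// -powRrM.
have -> : b^-1 * a = a - 1 by rewrite -(addKr a^-1 b^-1) ab mulrDl mul1r mulNr mulVf ?gt_eqF// addrC.
rewrite powRB ?powRr1 ?(ltW s0)// ?(gt_eqF s0) ?implybT// => H.
have sp0 : 0 < s `^ a by rewrite powR_gt0.
rewrite powRM ?invr_ge0 ?(ltW s0)// -powR_inv1 ?(ltW s0)// -powRrM mulN1r powRN.
rewrite mulrCA; move: H; rewrite mulrA ler_pdivlMr// => H.
by rewrite mulrA ler_pdivrMr// mulrC.
Qed.

Section weight.
Local Open Scope classical_set_scope.
Context {R : realType} {n : nat}.
Local Notation mu := (lebesgue_rV R n).
Variables (W : 'rV[R]_n -> R) (q e A : R).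
Hypothesis mW : measurable_fun [set: 'rV[R]_n] (W : _ -> measurableTypeR R).
Hypothesis W0 : forall x, 0 < W x.
Hypothesis q0 : 0 < q.
Hypothesis e0 : 0 < e.
Local Notation rho := (q / e).
Hypothesis muckW : forall (c : 'rV[R]_n) (l : R), 0 < l ->
  ((mu (cube c l))^-1 * \int[mu]_(x in cube c l) (W x `^ q)%:E *
   ((mu (cube c l))^-1 * \int[mu]_(x in cube c l) (W x `^ (- e))%:E) `^ rho
   <= A%:E)%E.

Let rho0 : 0 < rho. Proof. exact: divr_gt0. Qed.

Let mWp (s : R) : measurable_fun [set: 'rV[R]_n] (fun x => (W x `^ s)%:E).
Proof. by apply/measurable_EFinP; exact: measurable_fun_powRl. Qed.

Let Wp_ge0 (s : R) x : (0 <= (W x `^ s)%:E)%E.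
Proof. by rewrite lee_fin powR_ge0. Qed.

Let I (s : R) (B : set 'rV[R]_n) := (\int[mu]_(x in B) (W x `^ s)%:E)%E.

Let I_ge0 s B : (0 <= I s B)%E.
Proof. by apply: integral_ge0 => x _; exact: Wp_ge0. Qed.

(** Hölder's inequality for 1 = W^(q/(1+rho)) W^(-q/(1+rho)), with
    exponents 1 + rho and (1 + rho) / rho. *)
Lemma weight_duality (B : set 'rV[R]_n) : measurable B ->
  (mu B <= I q B `^ (1 + rho)^-1 * I (- e) B `^ (rho / (1 + rho)))%E.
Proof.
move=> mB; have r1 : 0 < 1 + rho by exact: addr_gt0.
have r2 : 0 < (1 + rho) / rho by exact: divr_gt0.
have rr : (1 + rho)^-1 + ((1 + rho) / rho)^-1 = 1.
  by have := rho0; move: rho => t t0; field; rewrite !gt_eqF// addr_gt0.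
pose f x := W x `^ (q / (1 + rho)); pose g x := W x `^ (- (q / (1 + rho))).
have := @hoelder_integral _ _ R mu B f g _ _ mB (measurable_fun_powRl _ mW)
  (measurable_fun_powRl _ mW) (fun x => powR_ge0 _ _) (fun x => powR_ge0 _ _) r1 r2 rr.
have -> : (\int[mu]_(x in B) (f x * g x)%:E)%E = mu B.
  rewrite (eq_integral (cst 1%E)) ?integral_cst ?mul1e// => x _.
  by rewrite /f /g -powRD ?subrr ?powRr0// (gt_eqF (W0 x)) implybT.
have -> : (\int[mu]_(x in B) (f x `^ (1 + rho))%:E)%E = I q B.
  by apply: eq_integral => x _; rewrite /f -powRrM divfK// gt_eqF.
have -> : (\int[mu]_(x in B) (g x `^ ((1 + rho) / rho))%:E)%E = I (- e) B.
  apply: eq_integral => x _; rewrite /g -powRrM; congr (_ `^ _)%:E.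
  rewrite mulNr; congr (- _).
  rewrite mulrA divfK ?gt_eqF// invf_div mulrC divfK// gt_eqF//.
by rewrite invf_div.
Qed.

Lemma weight_integral_gt0 (B : set 'rV[R]_n) : measurable B -> (0 < mu B)%E ->
  (0 < I q B)%E /\ (0 < I (- e) B)%E.
Proof.
move=> mB B0; have H := lt_le_trans B0 (weight_duality mB).
have r1 : 0 < 1 + rho by exact: addr_gt0.
split; rewrite lt_neqAle I_ge0 andbT; apply/negP => /eqP E; move: H; rewrite -E.
  by rewrite poweR0r ?invr_eq0 ?gt_eqF// mul0e ltxx.
rewrite poweR0r; first by rewrite mule0 ltxx.
by rewrite gt_eqF// divr_gt0.
Qed.

Lemma cube_volume (c : 'rV[R]_n) l : 0 < l -> mu (cube c l) = (l ^+ n)%:E.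
Proof.
move=> l0; rewrite lebesgue_rV_box => [|i]; last by rewrite !mxE lerDl ltW.
congr EFin; rewrite (eq_bigr (fun=> l)) => [|i _].
  by rewrite prodr_const card_ord.
by rewrite !mxE; ring.
Qed.

Lemma cube_integrals (c : 'rV[R]_n) l : 0 < l ->
  [/\ (0 < I q (cube c l))%E, (I q (cube c l) < +oo)%E,
      (0 < I (- e) (cube c l))%E, (I (- e) (cube c l) < +oo)%E &
      fine (I q (cube c l)) / l ^+ n * (fine (I (- e) (cube c l)) / l ^+ n) `^ rho <= A].
Proof.
move=> l0; have mC : measurable (cube c l) by exact: measurable_rV_box.
have ln0 : 0 < l ^+ n by rewrite exprn_gt0.
have C0 : (0 < mu (cube c l))%E by rewrite cube_volume// lte_fin.
have [I1 I2] := weight_integral_gt0 mC C0.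
have lV : 0 < (l ^+ n)^-1 by rewrite invr_gt0.
have := muckW c l0; rewrite cube_volume// inver gt_eqF// => H.
have [fin1 fin2 {}H] := muckenhoupt_product_finite lV rho0 I1 I2 H.
split; [exact: I1|exact: fin1|exact: I2|exact: fin2|].
by rewrite [_ / l ^+ n]mulrC [fine (I (- e) _) / _]mulrC; exact: H.
Qed.

Section on_grid.
Variables (M : nat) (a : 'rV[R]_n) (h : R).
Hypothesis h0 : 0 < h.
Hypothesis n0 : (0 < n)%N.
Local Notation index := {ffun 'I_n -> 'I_(2 ^ M)}.

Definition leaf_weight (s : R) (w : index) : R :=
  fine (\int[mu]_(x in leaf a h w) (W x `^ s)%:E)%E.

Let half_open_sub (c : 'rV[R]_n) l : half_open_cube c l `<=` cube c l.
Proof.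
by move=> x xc i; have /andP[x1 x2] := xc i; rewrite !mxE x1 ltW.
Qed.

Let leaf_fin (s : R) (w : index) : s = q \/ s = - e ->
  (0 < \int[mu]_(x in leaf a h w) (W x `^ s)%:E < +oo)%E.
Proof.
move=> sE; have mL := @measurable_leaf R n M a h w.
have vL : (0 < mu (leaf a h w))%E by rewrite leaf_volume// lte_fin exprn_gt0.
have [I1 I2] := weight_integral_gt0 mL vL.
have [_ J1 _ J2 _] := cube_integrals (\row_i (a ord0 i + (w i)%:R * h)) h0.
have sub s' : (I s' (leaf a h w) <= I s' (cube (\row_i (a ord0 i + (w i)%:R * h)%R) h))%E.
  apply: ge0_subset_integral => //.
  - exact: measurable_rV_box.
  - exact: measurable_funTS.
  - exact: half_open_sub.
case: sE => ->; apply/andP; split.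
- exact: I1.
- exact: le_lt_trans (sub _) J1.
- exact: I2.
- exact: le_lt_trans (sub _) J2.
Qed.

Lemma leaf_weight_gt0 s w : s = q \/ s = - e -> 0 < leaf_weight s w.
Proof. by move=> /(leaf_fin w) ?; exact: fine_gt0. Qed.

Lemma leaf_weightE s w : s = q \/ s = - e ->
  (\int[mu]_(x in leaf a h w) (W x `^ s)%:E)%E = (leaf_weight s w)%:E.
Proof.
move=> /(leaf_fin w) /andP[I0 Ioo]; rewrite /leaf_weight fineK//.
by rewrite ge0_fin_numE// ltW.
Qed.

(** A cell is a half-open cube, inside a closed cube of the same volume to
    which the condition on [W] applies. The inequality on leaves is
    [weight_duality]. *)
Lemma weight_muckenhoupt_family :
  muckenhoupt_family (@dyadic_cubes n M) (fun=> h ^+ n)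
    (leaf_weight (- e)) (leaf_weight q) A rho.
Proof.
have hn0 : 0 < h ^+ n by rewrite exprn_gt0.
split; first exact: dyadic_laminar.
- split=> [_|w|w]; first by [].
  + by apply: leaf_weight_gt0; right.
  + by apply: leaf_weight_gt0; left.
- exact: dyadic_halving.
- move=> _ /dyadic_cubesP[j [w [jM ->]]].
  have l0 : 0 < 2 ^+ j * h by rewrite mulr_gt0// exprn_gt0.
  pose c : 'rV[R]_n := \row_i (a ord0 i + (w i %/ 2 ^ j)%:R * (2 ^+ j * h)).
  have [J10 J1 J20 J2 JA] := cube_integrals c l0.
  have massE s : s = q \/ s = - e ->
      (mass (leaf_weight s) (cell j w))%:E = I s (cell_cube a h j w).
    move=> sE; rewrite /I (cell_cubeE a h0 w jM) integral_cell//.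
    by rewrite /mass -sumEFin; apply: eq_bigr => z _; rewrite leaf_weightE.
  have mass_le s : s = q \/ s = - e ->
      mass (leaf_weight s) (cell j w) <= fine (I s (cube c (2 ^+ j * h))).
    move=> sE; rewrite -lee_fin massE// fineK; last first.
      by rewrite ge0_fin_numE; [case: sE => ->; [exact: J1|exact: J2]|exact: I_ge0].
    apply: ge0_subset_integral => //.
    - exact: measurable_half_open_cube.
    - exact: measurable_rV_box.
    - exact: measurable_funTS.
    - exact: half_open_sub.
  have mass_ge s : s = q \/ s = - e -> 0 <= mass (leaf_weight s) (cell j w).
    by move=> sE; apply: mass_ge0 => z; exact: leaf_weight_gt0.
  rewrite mass_cell//; apply: le_trans JA.
  have V0 : 0 <= ((2 ^+ j * h) ^+ n)^-1 by rewrite invr_ge0 exprn_ge0// ltW.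
  apply: ler_pM; rewrite ?powR_ge0//.
  + by rewrite mulr_ge0// mass_ge//; left.
  + by apply: ler_wpM2r => //; apply: mass_le; left.
  + apply: ler_powRl; first exact: ltW.
      by rewrite mulr_ge0// mass_ge//; right.
    by apply: ler_wpM2r => //; apply: mass_le; right.
- move=> w; have := weight_duality (@measurable_leaf R n M a h w).
  rewrite leaf_volume// /I leaf_weightE; last by left.
  rewrite leaf_weightE; last by right.
  rewrite !poweR_EFin -EFinM lee_fin => H.
  have r1 : 0 < 1 + rho by exact: addr_gt0.
  have o0 : 0 <= leaf_weight q w by rewrite ltW// leaf_weight_gt0//; left.
  have s0 : 0 <= leaf_weight (- e) w by rewrite ltW// leaf_weight_gt0//; right.
  move: H o0 s0 r1; move: (leaf_weight q w) (leaf_weight (- e) w) rho.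
  move=> o s t H o0 s0 r1; apply: (le_trans (ler_powRl (ltW r1) (ltW hn0) H)).
  by rewrite powRM ?powR_ge0// powRKV// -powRrM divfK// gt_eqF.
Qed.

Variables (G : 'rV[R]_n -> R) (r p X B : R).
Hypothesis mG : measurable_fun [set: 'rV[R]_n] (G : _ -> measurableTypeR R).
Hypothesis G0 : forall x, 0 <= G x.
Hypothesis GB : forall x, G x <= B.
Hypothesis r0 : 0 < r.
Hypothesis rp : r < p.
Hypothesis eE : e^-1 = r^-1 - p^-1.
Hypothesis XE : (\int[mu]_x (G x `^ p * W x `^ p)%:E = X%:E)%E.

Definition leaf_mass (w : index) : R :=
  fine (\int[mu]_(x in leaf a h w) (G x `^ r)%:E)%E.

Let mGr : measurable_fun [set: 'rV[R]_n] (fun x => (G x `^ r)%:E).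
Proof. by apply/measurable_EFinP; exact: measurable_fun_powRl. Qed.

Lemma leaf_massE w :
  (\int[mu]_(x in leaf a h w) (G x `^ r)%:E)%E = (leaf_mass w)%:E.
Proof.
rewrite /leaf_mass fineK// ge0_fin_numE; last first.
  by apply: integral_ge0 => x _; rewrite lee_fin powR_ge0.
have mL := @measurable_leaf R n M a h w.
apply: (@le_lt_trans _ _ (\int[mu]_(x in leaf a h w) (cst (B `^ r)%:E x))%E).
  apply: ge0_le_integral => //.
  - by move=> x _; rewrite lee_fin powR_ge0.
  - exact: measurable_funTS.
  - by move=> x _ /=; rewrite lee_fin ler_powRl// ltW.
rewrite integral_cst//; have vL := leaf_volume a h0 w.
apply: (@le_lt_trans _ _ ((B `^ r)%:E * (h ^+ n)%:E)%E); last by rewrite -EFinM ltry.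
by rewrite -vL.
Qed.

Lemma leaf_mass_ge0 w : 0 <= leaf_mass w.
Proof.
by apply: fine_ge0; apply: integral_ge0 => x _; rewrite lee_fin powR_ge0.
Qed.

(** Hölder's inequality on each leaf, for G^r = (G W)^r W^(-r) with
    exponents p / r and e / r; the leaves are disjoint. *)
Lemma leaf_energy :
  \sum_w leaf_weight (- e) w * (leaf_mass w / leaf_weight (- e) w) `^ (p / r) <= X.
Proof.
have p0 : 0 < p by exact: lt_trans rp.
have pr0 : 0 < p / r by exact: divr_gt0.
have pr1 : 1 < p / r by rewrite ltr_pdivlMr// mul1r.
pose b := p / (p - r).
have prp : 0 < p - r by rewrite subr_gt0.
have b0 : 0 < b by exact: divr_gt0.
have prb : (p / r)^-1 + b^-1 = 1.
  by rewrite /b !invf_div; field; rewrite gt_eqF.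
have eb : r * b = e.
  rewrite -[e]invrK eE.
  have -> : r^-1 - p^-1 = (p - r) / (r * p) by field; rewrite !gt_eqF.
  by rewrite invf_div /b mulrA.
have mGWp : measurable_fun [set: 'rV[R]_n] (fun x => (G x `^ p * W x `^ p)%:E).
  by apply/measurable_EFinP; apply: measurable_funM; exact: measurable_fun_powRl.
have pos x : (0 <= (G x `^ p * W x `^ p)%:E)%E by rewrite lee_fin mulr_ge0 ?powR_ge0.
have leafX (w : index) : (\int[mu]_(x in leaf a h w) (G x `^ p * W x `^ p)%:E <= X%:E)%E.
  rewrite -XE; apply: ge0_subset_integral => //; exact: measurable_leaf.
have step (w : index) : ((leaf_weight (- e) w *
    (leaf_mass w / leaf_weight (- e) w) `^ (p / r))%:E <=
    \int[mu]_(x in leaf a h w) (G x `^ p * W x `^ p)%:E)%E.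
  have s0 : 0 < leaf_weight (- e) w by apply: leaf_weight_gt0; right.
  pose f x := G x `^ r * W x `^ r; pose g x := W x `^ (- r).
  have mf : measurable_fun [set: 'rV[R]_n] (f : _ -> measurableTypeR R).
    by apply: measurable_funM; exact: measurable_fun_powRl.
  have f0 x : 0 <= f x by rewrite mulr_ge0 ?powR_ge0.
  have := @hoelder_integral _ _ R mu (leaf a h w) f g _ _ (measurable_leaf a h w)
    mf (measurable_fun_powRl _ mW) f0 (fun x => powR_ge0 _ _) pr0 b0 prb.
  have -> : (\int[mu]_(x in leaf a h w) (f x * g x)%:E)%E =
      (\int[mu]_(x in leaf a h w) (G x `^ r)%:E)%E.
    apply: eq_integral => x _; rewrite /f /g -mulrA -powRD.
      by rewrite subrr powRr0 mulr1.
    by rewrite (gt_eqF (W0 x)) implybT.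
  have -> : (\int[mu]_(x in leaf a h w) (f x `^ (p / r))%:E)%E =
      (\int[mu]_(x in leaf a h w) (G x `^ p * W x `^ p)%:E)%E.
    apply: eq_integral => x _; rewrite /f powRM ?powR_ge0// -!powRrM.
    by rewrite mulrCA divff ?gt_eqF// mulr1.
  have -> : (\int[mu]_(x in leaf a h w) (g x `^ b)%:E)%E =
      (\int[mu]_(x in leaf a h w) (W x `^ (- e))%:E)%E.
    by apply: eq_integral => x _; rewrite /g -powRrM mulNr eb.
  rewrite leaf_massE leaf_weightE; last by right.
  set Y := (\int[mu]_(x in _) _)%E => H.
  have Yfin : Y \is a fin_num.
    rewrite ge0_fin_numE; first by rewrite (le_lt_trans (leafX w))// ltry.
    by apply: integral_ge0 => x _; exact: pos.
  have Y0 : 0 <= fine Y by apply: fine_ge0; apply: integral_ge0 => x _; exact: pos.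
  move: H; rewrite -(fineK Yfin) !poweR_EFin -EFinM !lee_fin => H.
  exact: (@powR_average_le _ _ _ _ (p / r) b (leaf_mass_ge0 w) s0 Y0 pr0 prb H).
rewrite -lee_fin -sumEFin; apply: (le_trans (lee_sum _ (fun w _ => step w))).
rewrite -big_enum -ge0_integral_bigsetU//; last 4 first.
- by move=> w; exact: measurable_leaf.
- exact: enum_uniq.
- by move=> w w' _ _ [x [xw xw']]; exact: leaf_inj xw xw'.
- exact: measurable_funTS.
rewrite -XE; apply: ge0_subset_integral => //.
by apply: bigsetU_measurable => w _; exact: measurable_leaf.
Qed.

End on_grid.
End weight.

(** * Pointwise domination by dyadic averages *)

Lemma powR_sum_le {R : realType} (I : finType) (a : I -> R) (q : R) : 0 < q ->
  (forall i, 0 <= a i) ->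
  (\sum_i a i) `^ q <= #|I|%:R `^ q * \sum_i a i `^ q.
Proof.
move=> q0 a0; set S := \sum_i a i `^ q.
have S0 : 0 <= S by apply: sumr_ge0 => i _; exact: powR_ge0.
have ai i : a i <= S `^ q^-1.
  rewrite -[a i](powRVK q0)//; apply: ler_powRl; [by rewrite invr_ge0 ltW|exact: powR_ge0|].
  by rewrite /S (bigD1 i)//= lerDl; apply: sumr_ge0 => j _; exact: powR_ge0.
rewrite -[S in leRHS](powRKV q0)// -powRM ?powR_ge0//.
apply: ler_powRl; [exact: ltW|exact: sumr_ge0|].
apply: (le_trans (ler_sum _ (fun i _ => ai i))).
by rewrite sumr_const mulr_natl.
Qed.

Section pointwise.
Local Open Scope classical_set_scope.
Context {R : realType} {n : nat}.
Local Notation mu := (lebesgue_rV R n).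
Variables (alpha r C0 : R) (K G : 'rV[R]_n -> R) (B : R).
Hypothesis n0 : (0 < n)%N.
Hypothesis r0 : 0 < r.
Hypothesis C00 : 0 < C0.
Hypothesis mK : measurable_fun [set: 'rV[R]_n] (K : _ -> measurableTypeR R).
Hypothesis kernel : forall t (g : 'rV[R]_n -> R), 0 < t ->
  measurable_fun [set: 'rV[R]_n] (g : _ -> measurableTypeR R) ->
  (forall x, 0 <= g x) ->
  (\int[mu]_(x in shell t (2 * t)) (`|K x| * g x)%:E <=
   (C0 * t `^ (alpha - n%:R / r))%:E *
   (\int[mu]_(x in shell t (2 * t)) (g x `^ r)%:E) `^ r^-1)%E.
Hypothesis mG : measurable_fun [set: 'rV[R]_n] (G : _ -> measurableTypeR R).
Hypothesis G0 : forall x, 0 <= G x.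
Hypothesis GB : forall x, G x <= B.

Local Notation beta := (alpha / n%:R).

Definition convolution_on (a b : R) (x : 'rV[R]_n) : \bar R :=
  (\int[mu]_(z in shell a b) (`|K z| * G (x - z))%:E)%E.

Let mGx x : measurable_fun [set: 'rV[R]_n] ((fun z => G (x - z)) : _ -> measurableTypeR R).
Proof. by apply: measurableT_comp => //; exact: measurable_reflect. Qed.

Let mKabs : measurable_fun [set: 'rV[R]_n] (fun z => `|K z|).
Proof. by apply: measurableT_comp. Qed.

Let mKG x : measurable_fun [set: 'rV[R]_n] (fun z => (`|K z| * G (x - z))%:E).
Proof.
by apply/measurable_EFinP; apply: measurable_funM; [exact: mKabs|exact: mGx].
Qed.

Lemma convolution_on_ge0 a b x : (0 <= convolution_on a b x)%E.
Proof. by apply: integral_ge0 => z _; rewrite lee_fin mulr_ge0. Qed.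

Lemma convolution_on_shells (h : R) (j : nat) x : 0 < h ->
  (convolution_on h (2 ^+ j * h) x <=
   \sum_(k < j) convolution_on (2 ^+ k * h) (2 * (2 ^+ k * h)) x)%E.
Proof.
move=> h0; elim: j => [|j IHj].
  rewrite big_ord0 expr0 mul1r /convolution_on.
  rewrite (_ : shell h h = set0) ?integral_set0//.
  by apply/seteqP; split => z //= /andP[h1 h2]; move: (lt_le_trans h1 h2); rewrite ltxx.
rewrite big_ord_recr /=; apply: (le_trans _ (leeD IHj (lexx _))).
have hj : h <= 2 ^+ j * h.
  by rewrite -[leLHS]mul1r ler_wpM2r ?(ltW h0)// exprn_ege1// ler1n.
have hj2 : 2 ^+ j * h <= 2 ^+ j.+1 * h.
  by rewrite exprS -mulrA ler_peMl ?ler1n// (le_trans (ltW h0)).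
have E : shell h (2 ^+ j.+1 * h) =
    shell h (2 ^+ j * h) `|` shell (2 ^+ j * h) (2 * (2 ^+ j * h)) :> set 'rV[R]_n.
  rewrite mulrA -exprS; apply/seteqP; split => z; rewrite /shell /=.
    move=> /andP[z1 z2]; case: (leP (eucl_norm z) (2 ^+ j * h)) => z3.
      by left; rewrite z1.
    by right; rewrite z2.
  case=> /andP[z1 z2].
    by rewrite z1 (le_trans z2).
  by rewrite z2 andbT (le_lt_trans hj).
rewrite /convolution_on E ge0_integral_setU//.
- exact: measurable_shell.
- exact: measurable_shell.
- exact: measurable_funTS.
- by move=> z _; rewrite lee_fin mulr_ge0.
- apply/disj_setPS => z [] /andP[_ z1] /andP[z2 _].
  by move: (lt_le_trans z2 z1); rewrite ltxx.
Qed.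

Let mGr : measurable_fun [set: 'rV[R]_n] (fun x => (G x `^ r)%:E).
Proof. by apply/measurable_EFinP; exact: measurable_fun_powRl. Qed.

Let shell_subset (t : R) (x : 'rV[R]_n) (U : set 'rV[R]_n) : measurable U ->
  (forall y : 'rV[R]_n, (forall i, `|y ord0 i - x ord0 i| <= 2 * t) -> U y) ->
  (\int[mu]_(z in shell t (2 * t)) (G (x - z) `^ r)%:E <=
   \int[mu]_(y in U) (G y `^ r)%:E)%E.
Proof.
move=> mU xU; pose f y : \bar R := (G y `^ r * \1_U y)%:E.
have -> : (\int[mu]_(y in U) (G y `^ r)%:E = \int[mu]_y f y)%E.
  rewrite integral_mkcond; apply: eq_integral => y _.
  by rewrite patchE /f indicE; case: (y \in U); rewrite ?mulr1 ?mulr0.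
have mf : measurable_fun setT f.
  apply/measurable_EFinP; apply: measurable_funM; first exact: measurable_fun_powRl.
  exact: measurable_indic.
have f0 y : (0 <= f y)%E by rewrite lee_fin mulr_ge0 ?powR_ge0.
rewrite -(ge0_integral_reflect x mf f0) integral_mkcond.
apply: (le_integral_null measurable0 (measure0 mu)) => // [z|z _].
  by rewrite patchE; case: ifP => // _; rewrite lee_fin powR_ge0.
rewrite patchE; case: ifPn => [/set_mem /andP[_ z2]|_]; last exact: f0.
rewrite /f indicE mem_set ?mulr1//; apply: xU => i.
rewrite !mxE addrAC subrr add0r normrN.
by apply: le_trans z2; exact: coord_le_eucl_norm.
Qed.

(** The fractional dyadic operator of the grid shifted by [eps], evaluated
    at a leaf. *)
Definition cube_sum (m : nat) (eps : {ffun 'I_n -> bool})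
    (w : {ffun 'I_n -> 'I_(2 ^ (m + m + 5))}) : R :=
  \sum_(Q in @dyadic_cubes n (m + m + 5) | w \in Q)
    mass (fun=> (2 ^- m) ^+ n) Q `^ beta *
    (mass (leaf_mass (corner m eps) (2 ^- m) G r) Q / mass (fun=> (2 ^- m) ^+ n) Q)
      `^ r^-1.

Let cube_term m eps (w : {ffun 'I_n -> 'I_(2 ^ (m + m + 5))}) k : R :=
  mass (fun=> (2 ^- m) ^+ n) (cell (k + 4) w) `^ beta *
    (mass (leaf_mass (corner m eps) (2 ^- m) G r) (cell (k + 4) w) /
     mass (fun=> (2 ^- m) ^+ n) (cell (k + 4) w)) `^ r^-1.

(* 16 is the ratio of the side of the cube to the radius of its shell. *)
Let C1 := C0 * 16 `^ (n%:R / r - alpha).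

Let C10 : 0 < C1. Proof. by rewrite mulr_gt0// powR_gt0. Qed.

Let h0 m : 0 < 2 ^- m :> R. Proof. by rewrite invr_gt0 exprn_gt0. Qed.

Let cube_term_ge0 m eps (w : {ffun 'I_n -> 'I_(2 ^ (m + m + 5))}) k :
  0 <= cube_term eps w k.
Proof. by rewrite mulr_ge0 ?powR_ge0. Qed.

(** The translated shell lies in a cube of side 16 t by [one_third_trick],
    and for this cube |Q|^(alpha/n - 1/r) is a multiple of t^(alpha -
    n/r). *)
Lemma convolution_on_shell_le (m k : nat) (x : 'rV[R]_n) : (k < m + m)%N ->
  (forall i, `|x ord0 i| <= 2 ^+ m) ->
  exists (eps : {ffun 'I_n -> bool}) (w : {ffun 'I_n -> 'I_(2 ^ (m + m + 5))}),
    leaf (corner m eps) (2 ^- m) w x /\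
    (convolution_on (2 ^+ k * 2 ^- m) (2 * (2 ^+ k * 2 ^- m)) x <=
      (C1 * cube_term eps w k)%:E)%E.
Proof.
move=> km xm; have [eps [w [xw H]]] := one_third_trick km xm.
exists eps, w; split => //.
set t := 2 ^+ k * 2 ^- m.
have t0 : 0 < t by rewrite mulr_gt0// exprn_gt0.
have k4 : (k + 4 <= m + m + 5)%N by lia.
have tE : 2 * t = 2 ^+ k.+1 / 2 ^+ m by rewrite /t exprS mulrA.
rewrite -tE in H.
apply: (le_trans (kernel t0 (mGx x) (fun z => G0 _))).
have F0 : 0 <= mass (leaf_mass (corner m eps) (2 ^- m) G r) (cell (k + 4) w).
  by apply: sumr_ge0 => z _; exact: leaf_mass_ge0.
have := shell_subset (measurable_half_open_cube _ _) H.
rewrite -/(cell_cube (corner m eps) (2 ^- m) (k + 4) w) cell_cubeE//.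
rewrite integral_cell//; last by move=> z; rewrite lee_fin powR_ge0.
have -> : (\sum_(w' in cell (k + 4) w)
    \int[mu]_(y in leaf (corner m eps) (2 ^- m) w') (G y `^ r)%:E =
    (mass (leaf_mass (corner m eps) (2 ^- m) G r) (cell (k + 4) w))%:E)%E.
  by rewrite /mass -sumEFin; apply: eq_bigr => z _; rewrite (leaf_massE _ (h0 m) mG G0 GB r0).
rewrite /cube_term; move: F0; move: (mass (leaf_mass _ _ _ _) _) => F F0 FI.
rewrite (mass_cell (corner m eps) (h0 m) w k4).
have -> : 2 ^+ (k + 4) * 2 ^- m = 16 * t by rewrite /t exprD; ring.
apply: (@le_trans _ _ ((C0 * t `^ (alpha - n%:R / r))%:E * F%:E `^ r^-1)%E).
  apply: lee_wpmul2l; first by rewrite lee_fin mulr_ge0 ?powR_ge0// ltW.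
  apply: lee_poweRl FI; first by rewrite invr_ge0 ltW.
  by apply: integral_ge0 => z _; rewrite lee_fin powR_ge0.
rewrite poweR_EFin -EFinM lee_fin /C1.
have t16 : 0 < 16 * t by rewrite mulr_gt0.
have nR : n%:R != 0 :> R by rewrite pnatr_eq0 -lt0n.
have rn : r != 0 by rewrite gt_eqF.
have tn0 : 0 < (16 * t) ^+ n by rewrite exprn_gt0.
clearbody t. rewrite powRM ?invr_ge0 ?(ltW tn0)// -[_ ^- n]powR_inv1 ?(ltW tn0)// -powRrM.
rewrite -powR_mulrn ?(ltW t16)// -!powRrM.
have -> : n%:R * (-1 * r^-1) = - (n%:R / r) by rewrite mulN1r mulrN.
have -> : n%:R * beta = alpha by field.
have -> : t `^ (alpha - n%:R / r) =
    16 `^ (n%:R / r - alpha) * ((16 * t) `^ alpha * (16 * t) `^ (- (n%:R / r))).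
  rewrite -powRD; last by rewrite (gt_eqF t16) implybT.
  rewrite powRM ?(ltW t0)// mulrA -powRD; last by rewrite pnatr_eq0 implybT.
  by rewrite addrA subrK subrr powRr0 mul1r.
by rewrite le_eqVlt; apply/orP; left; apply/eqP; ring.
Qed.

(** The cubes above a leaf have different volumes in different
    generations, so each cube is counted once. *)
Lemma cube_terms_le m eps (w : {ffun 'I_n -> 'I_(2 ^ (m + m + 5))}) :
  \sum_(k < m + m) cube_term eps w k <= cube_sum eps w.
Proof.
have inj : {in [set: 'I_(m + m)]%SET &, injective (fun k : 'I_(m + m) => cell (k + 4) w)}.
  move=> j k _ _ jk; apply/val_inj.
  have j4 : (j + 4 <= m + m + 5)%N by have := ltn_ord j; lia.
  have k4 : (k + 4 <= m + m + 5)%N by have := ltn_ord k; lia.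
  have := congr1 (mass (fun=> (2 ^- m : R) ^+ n)) jk.
  rewrite (mass_cell (0 : 'rV[R]_n) (h0 m) w j4) (mass_cell (0 : 'rV[R]_n) (h0 m) w k4).
  move=> /(pexpIrn n0); rewrite !nnegrE => H.
  have {H} : 2 ^+ (j + 4) * 2 ^- m = 2 ^+ (k + 4) * 2 ^- m :> R.
    by apply: H; apply: mulr_ge0; rewrite ?exprn_ge0 ?invr_ge0 ?exprn_ge0.
  move=> /(mulIf (lt0r_neq0 (h0 m)))/eqP.
  by rewrite -!natrX eqr_nat eqn_exp2l// => /eqP/addIn.
pose F (Q : {set {ffun 'I_n -> 'I_(2 ^ (m + m + 5))}}) := mass (fun=> (2 ^- m) ^+ n) Q `^ beta *
    (mass (leaf_mass (corner m eps) (2 ^- m) G r) Q / mass (fun=> (2 ^- m) ^+ n) Q)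
      `^ r^-1.
have -> : \sum_(k < m + m) cube_term eps w k =
    \sum_(k in [set: 'I_(m + m)]%SET) F (cell (k + 4) w).
  by apply: eq_bigl => k; rewrite finset.in_setT.
rewrite -(big_imset F inj) /cube_sum /= -/F.
rewrite [leRHS](bigID (fun Q => Q \in [set cell ((k : 'I_(m + m)) + 4) w | k in [set: 'I_(m + m)]%SET]%SET)) /=.
rewrite -[leLHS]addr0; apply: lerD; last first.
  by apply: sumr_ge0 => Q _; rewrite mulr_ge0 ?powR_ge0.
rewrite le_eqVlt; apply/orP; left; apply/eqP; apply: eq_bigl => Q.
apply/idP/idP => [/imsetP[k _ ->]|/andP[]//].
have k4 : (k + 4 <= m + m + 5)%N by have := ltn_ord k; lia.
rewrite mem_cell andbT cell_dyadic//=.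
by apply: imset_f; rewrite finset.in_setT.
Qed.

Let C2 := C1 * #|{ffun 'I_n -> bool}|%:R.

(** Every shell is charged to a cube of one of the 2^n grids; in each
    grid, these cubes lie above the only leaf that contains x. *)
Lemma convolution_pointwise (m : nat) (x : 'rV[R]_n) (q : R) : 0 < q -> (forall i, `|x ord0 i| <= 2 ^+ m) ->
  (convolution_on (2 ^- m) (2 ^+ m) x `^ q <=
   (C2 `^ q * \sum_(eps : {ffun 'I_n -> bool})
      \sum_(w : {ffun 'I_n -> 'I_(2 ^ (m + m + 5))})
        cube_sum eps w `^ q * \1_(leaf (corner m eps) (2 ^- m) w) x)%:E)%E.
Proof.
move=> q0 xm.
pose V eps := \sum_(w : {ffun 'I_n -> 'I_(2 ^ (m + m + 5))})
  cube_sum eps w * \1_(leaf (corner m eps) (2 ^- m) w) x.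
have S0 eps (w : {ffun 'I_n -> 'I_(2 ^ (m + m + 5))}) : 0 <= cube_sum eps w.
  by apply: sumr_ge0 => Q _; rewrite mulr_ge0 ?powR_ge0.
have V0 eps : 0 <= V eps by apply: sumr_ge0 => w _; rewrite mulr_ge0.
have VE eps : V eps `^ q = \sum_(w : {ffun 'I_n -> 'I_(2 ^ (m + m + 5))})
    cube_sum eps w `^ q * \1_(leaf (corner m eps) (2 ^- m) w) x.
  have [[w xw]|nw] := pselect (exists w : {ffun 'I_n -> 'I_(2 ^ (m + m + 5))},
      leaf (corner m eps) (2 ^- m) w x); last first.
    have z (w : {ffun 'I_n -> 'I_(2 ^ (m + m + 5))}) : \1_(leaf (corner m eps) (2 ^- m) w) x = 0 :> R.
      by rewrite indicE memNset// => xw; apply: nw; exists w.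
    rewrite /V !big1 ?powR0 ?gt_eqF// => w _; by rewrite z mulr0.
  have z (w' : {ffun 'I_n -> 'I_(2 ^ (m + m + 5))}) : w' != w -> \1_(leaf (corner m eps) (2 ^- m) w') x = 0 :> R.
    move=> ww; rewrite indicE memNset// => xw'; move/eqP: ww; apply.
    exact: (leaf_inj (h0 m) xw' xw).
  rewrite /V (bigD1 w)//= [in RHS](bigD1 w)//= !big1 ?addr0; last 2 first.
  - by move=> w' /z ->; rewrite mulr0.
  - by move=> w' /z ->; rewrite mulr0.
  by rewrite indicE mem_set// !mulr1.
have main : (convolution_on (2 ^- m) (2 ^+ m) x <= (C1 * \sum_eps V eps)%:E)%E.
  have E : 2 ^+ m = 2 ^+ (m + m) * 2 ^- m :> R.
    by rewrite exprD mulfK// expf_neq0.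
  have := convolution_on_shells (m + m) x (h0 m); rewrite -E => /le_trans; apply.
  apply: (@le_trans _ _ (\sum_(k < m + m) (C1 * \sum_eps
     \sum_(w : {ffun 'I_n -> 'I_(2 ^ (m + m + 5))} )
       cube_term eps w k * \1_(leaf (corner m eps) (2 ^- m) w) x)%:E)%E).
    apply: lee_sum => k _; have [eps [w [xw H]]] := convolution_on_shell_le (ltn_ord k) xm.
    apply: (le_trans H); rewrite lee_fin ler_wpM2l ?(ltW C10)//.
    rewrite (bigD1 eps)//= (bigD1 w)//= indicE mem_set// mulr1 -addrA lerDl.
    rewrite addr_ge0//; apply: sumr_ge0 => *; last apply: sumr_ge0 => *; 
      by rewrite mulr_ge0.
  rewrite sumEFin lee_fin -mulr_sumr ler_wpM2l ?(ltW C10)//.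
  rewrite exchange_big; apply: ler_sum => eps _.
  rewrite exchange_big; apply: ler_sum => w _.
  by rewrite -mulr_suml ler_wpM2r// cube_terms_le.
have VS0 : 0 <= \sum_eps V eps by exact: sumr_ge0.
apply: (le_trans (lee_poweRl (ltW q0) (convolution_on_ge0 _ _ _) main)).
rewrite poweR_EFin lee_fin powRM ?(ltW C10)// /C2 powRM ?(ltW C10)//.
rewrite -mulrA ler_wpM2l ?powR_ge0//; under [in leRHS]eq_bigr do rewrite -VE.
exact: powR_sum_le.
Qed.

End pointwise.

(** * The bound for positive Borel weights *)

Section limn_einf.
Context {R : realType}.
Implicit Type u : nat -> \bar R.

Let limn_einf_sup_einfs u : limn_einf u = ereal_sup (range (einfs u)).
Proof.
rewrite limn_einf_lim; apply/cvg_lim => //.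
by apply: ereal_nondecreasing_cvgn; exact: nondecreasing_einfs.
Qed.

Lemma limn_einf_ge u (L : \bar R) (m0 : nat) :
  (forall m, (m0 <= m)%N -> (L <= u m)%E) -> (L <= limn_einf u)%E.
Proof.
move=> Lu; rewrite limn_einf_sup_einfs; apply: le_trans (_ : (einfs u m0 <= _)%E).
  by apply: le_ereal_inf_tmp => _ [m /= m0m <-]; exact: Lu.
by apply: ereal_sup_ubound; exists m0.
Qed.

Lemma limn_einf_le u (L : \bar R) :
  (forall m, (u m <= L)%E) -> (limn_einf u <= L)%E.
Proof.
move=> uL; rewrite limn_einf_sup_einfs; apply: ge_ereal_sup => _ [m _ <-].
by apply: le_trans (uL m); apply: ereal_inf_lbound; exists m => /=.
Qed.

End limn_einf.

Section convolution_limit.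
Local Open Scope classical_set_scope.
Context {R : realType} {n : nat}.
Local Notation mu := (lebesgue_rV R n).
Hypothesis n0 : (0 < n)%N.

(** The shells exhaust the complement of the origin, which is a null set
    as the dimension is positive. *)
Lemma integral_le_of_shells (f : 'rV[R]_n -> \bar R) (L : \bar R) :
  measurable_fun [set: 'rV[R]_n] f -> (forall x, (0 <= f x)%E) ->
  (\forall m \near \oo, (\int[mu]_(x in shell (2 ^- m) (2 ^+ m)) f x <= L)%E) ->
  (\int[mu]_x f x <= L)%E.
Proof.
move=> mf f0 fL.
pose F m : set 'rV[R]_n := shell (2 ^- m) (2 ^+ m).
have mF m : measurable (F m) by exact: measurable_shell.
have ndF : nondecreasing_seq F.
  move=> i j ij; apply/subsetPset => x /andP[x1 x2]; apply/andP; split.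
    apply: le_lt_trans x1; rewrite lef_pV2 ?posrE ?exprn_gt0//.
    by rewrite ler_weXn2l// ler1n.
  by apply: (le_trans x2); rewrite ler_weXn2l// ler1n.
have cvF := ge0_nondecreasing_set_cvg_integral (mu := mu) ndF mF
  (fun i => measurable_funTS mf) (fun i x _ => f0 x).
apply: (@le_trans _ _ (\int[mu]_(x in \bigcup_i F i) f x)%E); last first.
  by apply: (cvge_to_le _ fL); exact: cvF.
have mZ : measurable (rV_box (0 : 'rV[R]_n) 0) by exact: measurable_rV_box.
have Z0 : mu (rV_box (0 : 'rV[R]_n) 0) = 0%E.
  rewrite lebesgue_rV_box// (bigD1 (Ordinal n0))//= subrr mul0r//.
rewrite [leRHS]integral_mkcond.
apply: (le_integral_null mZ Z0) => // [x|x xZ]; rewrite patchE; first by case: ifP.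
rewrite mem_set//; have x0 : 0 < eucl_norm x.
  rewrite lt_neqAle eucl_norm_ge0 andbT eq_sym; apply/eqP => /eucl_norm_eq0 xE.
  by apply: xZ => i; rewrite xE lexx.
exists (maxn (Num.truncn (eucl_norm x)).+1 (Num.truncn (eucl_norm x)^-1).+1) => //.
set k := maxn _ _; have kk : (k%:R < 2 ^+ k :> R) by rewrite -natrX ltr_nat ltn_expl.
have big (t : R) : (Num.truncn t < k)%N -> t < 2 ^+ k.
  move=> tk; apply: lt_trans kk; apply: (lt_le_trans (truncnS_gt _)).
  by rewrite ler_nat.
apply/andP; split; last by rewrite ltW// big// leq_max leqnn.
rewrite invf_plt ?posrE ?exprn_gt0// big// leq_max leqnn orbT//.
Qed.

End convolution_limit.

Section borel_bound.
Local Open Scope classical_set_scope.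
Context {R : realType} {n : nat}.
Local Notation mu := (lebesgue_rV R n).
Variables (alpha r p q C0 : R) (K : 'rV[R]_n -> R).
Hypothesis n0 : (0 < n)%N.
Hypothesis alpha0 : 0 < alpha.
Hypothesis r1 : 1 <= r.
Hypothesis rp : r < p.
Hypothesis q0 : 0 < q.
Hypothesis qE : q^-1 = p^-1 - alpha / n%:R.
Hypothesis C00 : 0 < C0.
Hypothesis mK : measurable_fun [set: 'rV[R]_n] (K : _ -> measurableTypeR R).
Hypothesis kernel : forall t (g : 'rV[R]_n -> R), 0 < t ->
  measurable_fun [set: 'rV[R]_n] (g : _ -> measurableTypeR R) ->
  (forall x, 0 <= g x) ->
  (\int[mu]_(x in shell t (2 * t)) (`|K x| * g x)%:E <=
   (C0 * t `^ (alpha - n%:R / r))%:E *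
   (\int[mu]_(x in shell t (2 * t)) (g x `^ r)%:E) `^ r^-1)%E.

Local Notation e := ((r^-1 - p^-1)^-1).
Local Notation rho := (q / e).
Local Notation gamma := (Num.max ((1 + rho^-1) / q) (q^-1 + (1 - p^-1))).

(** [convolution_pointwise] majorizes W^q times the q-th power of the
    operator truncated to the shell between 2^-m and 2^m by a multiple of
    a function E_m, which is a multiple of W^q on each leaf of each grid
    and whose integral is bounded by [discrete_bound] uniformly in m. The
    truncated operators increase with m, so the lower limit of E_m does
    the same for the full operator, and Fatou's lemma bounds its integral. *)
Lemma positive_weight_bound : exists2 C : R, 0 < C &
  forall (W G : 'rV[R]_n -> R) (A X B : R),
  measurable_fun [set: 'rV[R]_n] (W : _ -> measurableTypeR R) ->
  (forall x, 0 < W x) ->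
  measurable_fun [set: 'rV[R]_n] (G : _ -> measurableTypeR R) ->
  (forall x, 0 <= G x) -> (forall x, G x <= B) ->
  (forall (c : 'rV[R]_n) (l : R), 0 < l ->
    ((mu (cube c l))^-1 * \int[mu]_(x in cube c l) (W x `^ q)%:E *
     ((mu (cube c l))^-1 * \int[mu]_(x in cube c l) (W x `^ (- e))%:E) `^ rho
     <= A%:E)%E) ->
  (\int[mu]_x (G x `^ p * W x `^ p)%:E = X%:E)%E ->
  (\int[mu]_x ((\int[mu]_z (`|K z| * G (x - z))%:E) `^ q * (W x `^ q)%:E) <=
   ((C * A `^ gamma * X `^ p^-1) `^ q)%:E)%E.
Proof.
have r0 : 0 < r by exact: lt_le_trans r1.
have p0 : 0 < p by exact: lt_trans rp.
have nR : 0 < n%:R :> R by rewrite ltr0n.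
have eV0 : 0 < r^-1 - p^-1 by rewrite subr_gt0 ltf_pV2.
have e0 : 0 < e by rewrite invr_gt0.
have [C CC0 HC] := discrete_bound (divr_gt0 alpha0 nR) r1 rp q0 qE.
pose N : R := #|{ffun 'I_n -> bool}|%:R.
have N0 : 0 < N by rewrite ltr0n card_ffun card_bool expn_gt0.
pose C2 := C0 * 16 `^ (n%:R / r - alpha) * N.
have C20 : 0 < C2 by rewrite !mulr_gt0 ?powR_gt0.
exists (C2 * N `^ q^-1 * C); first by rewrite !mulr_gt0// powR_gt0.
move=> W G A X B mW W0 mG G0 GB muckW XE.
have h0 m : 0 < 2 ^- m :> R by rewrite invr_gt0 exprn_gt0.
have X0 : 0 <= X.
  rewrite -lee_fin -XE; apply: integral_ge0 => x _.
  by rewrite lee_fin mulr_ge0 ?powR_ge0.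
pose J := (C * A `^ gamma * X `^ p^-1) `^ q.
have grid m eps : \sum_(w : {ffun 'I_n -> 'I_(2 ^ (m + m + 5))})
    leaf_weight W (corner m eps) (2 ^- m) q w * cube_sum alpha r G eps w `^ q <= J.
  have fam := weight_muckenhoupt_family mW W0 q0 e0 muckW (m + m + 5)
    (corner m eps) (h0 m) n0.
  rewrite invrK in fam.
  apply: (le_trans (HC _ _ _ _ _ _ _ fam (leaf_mass_ge0 (corner m eps) (2 ^- m) G r))).
  rewrite /J; apply: ler_powRl; first exact: ltW.
    by rewrite !mulr_ge0 ?powR_ge0// ltW.
  rewrite invrK; apply: ler_wpM2l; first by rewrite mulr_ge0 ?powR_ge0// ltW.
  have en := leaf_energy mW W0 q0 e0 muckW (m + m + 5) (corner m eps) (h0 m)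
    mG G0 GB r0 rp (invrK _) XE.
  apply: ler_powRl en; first by rewrite invr_ge0 ltW.
  apply: sumr_ge0 => w _; apply: mulr_ge0; last exact: powR_ge0.
  by apply/ltW/(leaf_weight_gt0 mW W0 q0 e0 muckW) => //; right.
pose S m eps (w : {ffun 'I_n -> 'I_(2 ^ (m + m + 5))}) := cube_sum alpha r G eps w `^ q.
pose F m eps (w : {ffun 'I_n -> 'I_(2 ^ (m + m + 5))}) x : \bar R :=
  ((S m eps w)%:E * (W x `^ q * \1_(leaf (corner m eps) (2 ^- m) w) x)%:E)%E.
pose E m x : \bar R := (\sum_eps \sum_w F m eps w x)%E.
have mF0 m eps (w : {ffun 'I_n -> 'I_(2 ^ (m + m + 5))}) :
    measurable_fun [set: 'rV[R]_n]
      (fun x => (W x `^ q * \1_(leaf (corner m eps) (2 ^- m) w) x)%:E).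
  apply/measurable_EFinP; apply: measurable_funM; first exact: measurable_fun_powRl.
  by apply: measurable_indic; exact: measurable_leaf.
have F0 m eps (w : {ffun 'I_n -> 'I_(2 ^ (m + m + 5))}) x :
    (0 <= (W x `^ q * \1_(leaf (corner m eps) (2 ^- m) w) x)%:E)%E.
  by rewrite lee_fin mulr_ge0 ?powR_ge0.
have S0 m eps w : 0 <= S m eps w by exact: powR_ge0.
have mF m eps w : measurable_fun [set: 'rV[R]_n] (F m eps w).
  exact: measurable_funeM.
have F0' m eps w x : (0 <= F m eps w x)%E by rewrite mule_ge0// lee_fin.
have mE m : measurable_fun [set: 'rV[R]_n] (E m).
  by apply: emeasurable_sum => eps; exact: emeasurable_sum.
have E0 m x : (0 <= E m x)%E by apply: sume_ge0 => eps _; exact: sume_ge0.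
have intE m : (\int[mu]_x E m x <= (N * J)%:E)%E.
  rewrite /E ge0_integral_sum//; last 2 first.
  - by move=> eps; exact: emeasurable_sum.
  - by move=> eps x _; exact: sume_ge0.
  rewrite (_ : N * J = \sum_(eps : {ffun 'I_n -> bool}) J); last first.
    by rewrite sumr_const mulr_natl.
  rewrite -sumEFin; apply: lee_sum => eps _.
  rewrite ge0_integral_sum//.
  have := grid m eps; rewrite -lee_fin => /(le_trans _); apply; rewrite -sumEFin; apply: lee_sum => w _.
  rewrite ge0_integralZl_EFin// muleC EFinM; apply: lee_wpmul2r; first by rewrite lee_fin.
  rewrite -(leaf_weightE mW W0 q0 e0 muckW _ (h0 m)); last by left.
  rewrite [leRHS]integral_mkcond le_eqVlt; apply/orP; left; apply/eqP.
  apply: eq_integral => x _; rewrite patchE indicE.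
  by case: (x \in _); rewrite ?mulr1 ?mulr0.
pose T x : \bar R := (\int[mu]_z (`|K z| * G (x - z))%:E)%E.
have mT x : measurable_fun [set: 'rV[R]_n] (fun z => (`|K z| * G (x - z))%:E).
  apply/measurable_EFinP; apply: measurable_funM; first exact: measurableT_comp.
  by apply: measurableT_comp => //; exact: measurable_reflect.
have T0 x z : (0 <= (`|K z| * G (x - z))%:E)%E by rewrite lee_fin mulr_ge0.
have pointwise x : (T x `^ q * (W x `^ q)%:E <=
    (C2 `^ q)%:E * limn_einf (fun m => E m x))%E.
  have u0 : 0 < W x `^ q by rewrite powR_gt0.
  set L := limn_einf _; have L0 : (0 <= L)%E by apply: (@limn_einf_ge _ _ _ 0%N) => m _.
  have c0 : 0 < C2 `^ q by rewrite powR_gt0.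
  set Y := ((C2 `^ q)%:E * L)%E; have Y0 : (0 <= Y)%E by rewrite mule_ge0// lee_fin ltW.
  suff TY : (T x <= (((W x `^ q)^-1)%:E * Y) `^ q^-1)%E.
    have Z0 : (0 <= ((W x `^ q)^-1)%:E * Y)%E.
      by rewrite mule_ge0// lee_fin invr_ge0 ltW.
    have T0' : (0 <= T x)%E by apply: integral_ge0 => z _; exact: T0.
    have := lee_poweRl (ltW q0) T0' TY; rewrite poweRKV// => H.
    by rewrite muleC -lee_pdivlMl.
  pose m0 := (Num.truncn (\sum_i `|x ord0 i|)).+1.
  have xm m : (m0 <= m)%N -> forall i, `|x ord0 i| <= 2 ^+ m.
    move=> m0m i; apply: (@le_trans _ _ (\sum_i `|x ord0 i|)).
      by rewrite (bigD1 i)//= lerDl sumr_ge0.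
    apply: (le_trans (ltW (truncnS_gt _))); apply: (@le_trans _ _ m%:R).
      by rewrite ler_nat.
    by rewrite -natrX ler_nat ltnW// ltn_expl.
  apply: (integral_le_of_shells n0 (mT x) (T0 x)).
  exists m0 => // k /= m0k.
  rewrite -[leLHS](poweRVK q0); last exact: convolution_on_ge0.
  apply: lee_poweRl; rewrite ?invr_ge0 ?(ltW q0)//; first exact: poweR_ge0.
  rewrite lee_pdivlMl// /Y muleC -lee_pdivrMl//.
  apply: (@limn_einf_ge _ _ _ k) => m km.
  rewrite lee_pdivrMl// muleC.
  have xm' := xm m (leq_trans m0k km).
  have := convolution_pointwise n0 r0 C00 mK kernel mG G0 GB q0 xm'.
  rewrite -/N -/C2 => H.
  have mono : (convolution_on K G (2 ^- k) (2 ^+ k) x <=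
      convolution_on K G (2 ^- m) (2 ^+ m) x)%E.
    apply: ge0_subset_integral => //; try exact: measurable_shell.
    - exact: measurable_funTS.
    - move=> z /andP[z1 z2]; apply/andP; split.
        apply: le_lt_trans z1; rewrite lef_pV2 ?posrE ?exprn_gt0//.
        by rewrite ler_weXn2l// ler1n.
      by apply: (le_trans z2); rewrite ler_weXn2l// ler1n.
  have {}H := le_trans (lee_poweRl (ltW q0) (convolution_on_ge0 _ _ _ _ _) mono) H.
  have EE : E m x = (W x `^ q * \sum_eps
      \sum_w S m eps w * \1_(leaf (corner m eps) (2 ^- m) w) x)%:E.
    rewrite /E /F; under eq_bigr => eps _ do under eq_bigr => w _ do rewrite -EFinM.
    under eq_bigr => eps _ do rewrite sumEFin.
    rewrite sumEFin mulr_sumr; congr EFin; apply: eq_bigr => eps _.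
    by rewrite mulr_sumr; apply: eq_bigr => w _; rewrite mulrCA.
  rewrite EE -EFinM mulrCA EFinM; apply: lee_wpmul2l; first by rewrite lee_fin ltW.
  exact: H.
apply: (@le_trans _ _ (\int[mu]_x ((C2 `^ q)%:E * limn_einf (fun m => E m x)))%E).
  apply: (le_integral_null measurable0 (measure0 mu)) => [x|x|x _].
  - by rewrite mule_ge0 ?poweR_ge0// lee_fin powR_ge0.
  - apply: mule_ge0; first by rewrite lee_fin powR_ge0.
    exact: (@limn_einf_ge _ _ _ 0%N).
  - exact: pointwise.
rewrite ge0_integralZl_EFin//; last 3 first.
- by move=> x _; exact: (@limn_einf_ge _ _ _ 0%N).
- apply: (measurableT_comp (f := -%E)) => //.
  apply: measurable_fun_limn_esup => m.
  by apply: (measurableT_comp (f := -%E)).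
- exact: powR_ge0.
have fat : (\int[mu]_x limn_einf (fun m => E m x) <= (N * J)%:E)%E.
  apply: (le_trans (fatou mu measurableT mE (fun m x _ => E0 m x))).
  exact: limn_einf_le.
apply: (@le_trans _ _ ((C2 `^ q)%:E * (N * J)%:E)%E).
  by apply: lee_wpmul2l fat; rewrite lee_fin powR_ge0.
have gen (a b c : R) : 0 <= a -> 0 <= b -> 0 <= c ->
    (a * b `^ q^-1 * c) `^ q = a `^ q * (b * c `^ q).
  move=> a0 b0 c0.
  rewrite powRM//; last by rewrite mulr_ge0 ?powR_ge0.
  by rewrite powRM ?powR_ge0// powRKV// mulrA.
rewrite -EFinM lee_fin /J -gen ?(ltW C20) ?(ltW N0)//; last first.
  by rewrite !mulr_ge0 ?powR_ge0// ltW.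
by rewrite !mulrA.
Qed.

End borel_bound.

(** * Zero sets of Muckenhoupt weights *)

Lemma ge0_integral_gt0 d (T : measurableType d) (R : realType)
    (mu : {measure set T -> \bar R}) (D P : set T) (h : T -> \bar R) :
  measurable D -> measurable P -> (P `<=` D)%classic -> measurable_fun setT h ->
  (forall x, (0 <= h x)%E) -> (forall x, P x -> (0 < h x)%E) -> mu P != 0%E ->
  (0 < \int[mu]_(x in D) h x)%E.
Proof.
move=> mD mP PD mh h0 hP P0; rewrite lt_neqAle integral_ge0// andbT eq_sym.
apply/eqP => I0; move/eqP: P0; apply; apply/negligibleP => //.
have /(ae_eq_integral_abs mu mD (measurable_funTS mh)) [N [mN N0 NP]] :
    (\int[mu]_(x in D) `|h x| = 0)%E.
  by rewrite -I0; apply: eq_integral => x _; rewrite gee0_abs.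
exists N; split => // x Px; apply: NP => /= H.
by have := hP _ Px; rewrite (H (PD _ Px)) ltxx.
Qed.

Section weights.
Local Open Scope classical_set_scope.
Context {R : realType} {n : nat}.
Local Notation mu := (lebesgue_rV R n).

Definition central_cube (k : nat) : set 'rV[R]_n := cube (const_mx (- k%:R)) (2 * k.+1%:R).

Lemma measurable_central_cube k : measurable (central_cube k).
Proof. exact: measurable_rV_box. Qed.

Lemma central_cubeS j k : (j <= k)%N -> central_cube j `<=` central_cube k.
Proof.
rewrite -(ler_nat R) => jk x xj i; have /andP[] := xj i; rewrite !mxE -!natr1.
by move=> x1 x2; apply/andP; split; lra.
Qed.

Lemma bigcup_central_cube (Z : set 'rV[R]_n) : Z = \bigcup_k (Z `&` central_cube k).
Proof.
apply/seteqP; split => x; last by case=> k _ [].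
move=> Zx; exists (Num.truncn (\sum_i `|x ord0 i|)).+1 => //; split => // i.
have : `|x ord0 i| <= \sum_i `|x ord0 i| by rewrite (bigD1 i)//= lerDl sumr_ge0.
move=> /le_lt_trans/(_ (truncnS_gt _)); move: (Num.truncn _).+1 => k.
by rewrite !mxE -natr1 ltr_norml => /andP[x1 x2]; apply/andP; split; lra.
Qed.

Lemma null_central_cubes (Z : set 'rV[R]_n) : measurable Z ->
  (forall k, mu (Z `&` central_cube k) = 0%E) -> mu Z = 0%E.
Proof.
move=> mZ H; apply/negligibleP => //; rewrite (bigcup_central_cube Z).
apply: negligible_bigcup => k; apply/negligibleP; last exact: H.
by apply: measurableI => //; exact: measurable_central_cube.
Qed.

Variables (a b : R) (v vb : 'rV[R]_n -> R) (N : set 'rV[R]_n).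
Hypothesis a1 : 1 < a.
Hypothesis b0 : 0 < b.
Hypothesis mN : measurable N.
Hypothesis N0 : mu N = 0%E.
Hypothesis mvb : measurable_fun [set: 'rV[R]_n] (vb : _ -> measurableTypeR R).
Hypothesis vb0 : forall x, 0 <= vb x.
Hypothesis vE : forall x, ~ N x -> v x = vb x.

Local Notation a' := (a / (a - 1)).

Lemma A_const_ge (c : 'rV[R]_n) (l : R) : 0 < l ->
  (((mu (cube c l))^-1 * \int[mu]_(x in cube c l) (v x `^ b)%:E) *
   ((mu (cube c l))^-1 * \int[mu]_(x in cube c l) ((v x `^ a')%:E)^-1) `^ (b / a')
   <= A_const a b v)%E.
Proof.
move=> l0; apply: ereal_sup_ubound; exists (cube c l); last by rewrite hoelder_conjugateE.
by exists c => //; exists l.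
Qed.

(** If neither set were null, a large cube would meet both in positive
    measure. On it the integral of v^b would be positive and that of
    v^(-a') infinite, and the Muckenhoupt constant would be infinite. *)
Lemma A_class_zero_or_positive : A_class a b v ->
  mu [set x | vb x = 0] = 0%E \/ mu [set x | vb x != 0] = 0%E.
Proof.
rewrite /A_class => Aoo.
have a'0 : 0 < a' by rewrite divr_gt0 ?subr_gt0// (lt_trans _ a1).
pose Z := [set x | vb x = 0].
have mZ : measurable Z.
  rewrite (_ : Z = vb @^-1` [set 0]); last by apply/seteqP; split.
  by rewrite -[X in measurable X]setTI; exact: mvb.
have -> : [set x | vb x != 0] = ~` Z.
  by apply/seteqP; split => x /=; [move/eqP|move=> ?; apply/eqP].
have mZC : measurable (~` Z) by exact: measurableC.
have mQ := measurable_central_cube.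
have one k : mu (Z `&` central_cube k) = 0%E \/ mu (~` Z `&` central_cube k) = 0%E.
  have [->|ZQ] := eqVneq (mu (Z `&` central_cube k)) 0%E; first by left.
  have [->|CQ] := eqVneq (mu (~` Z `&` central_cube k)) 0%E; first by right.
  exfalso; have l0 : 0 < 2 * k.+1%:R :> R by rewrite mulr_gt0.
  have := A_const_ge (const_mx (- k%:R)) l0.
  rewrite -/(central_cube k) cube_volume// inver gt_eqF ?exprn_gt0//.
  set V : R := ((2 * k.+1%:R) ^+ n)^-1.
  have V0 : (0 < V%:E)%E by rewrite lte_fin invr_gt0 exprn_gt0.
  set I1 := (\int[mu]_(x in _) (v x `^ b)%:E)%E.
  set I2 := (\int[mu]_(x in _) _^-1)%E.
  have I10 : (0 < I1)%E.
    rewrite /I1 (eq_integral_nullD (g := fun x => (vb x `^ b)%:E) mN N0); last first.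
    - by move=> x Nx _; rewrite vE.
    - by move=> x; rewrite lee_fin powR_ge0.
    - by move=> x; rewrite lee_fin powR_ge0.
    apply: (ge0_integral_gt0 (mQ k) (measurableI _ _ mZC (mQ k)) _ _ _ _ CQ).
    - exact: subIsetr.
    - by apply/measurable_EFinP; exact: measurable_fun_powRl.
    - by move=> x; rewrite lee_fin powR_ge0.
    - move=> x [/= Zx _]; rewrite lte_fin powR_gt0// lt_neqAle eq_sym vb0 andbT.
      exact/eqP.
  have I2y : I2 = +oo%E.
    apply/eqP; rewrite -leye_eq.
    apply: (@le_trans _ _ (\int[mu]_(x in Z `&` central_cube k) (cst +oo%E x))%E).
      rewrite integral_cst; last exact: measurableI.
      by rewrite gt0_mulye// lt_neqAle eq_sym ZQ measure_ge0.
    rewrite integral_mkcond /I2 [leRHS]integral_mkcond.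
    apply: (le_integral_null mN N0) => [x|x|x Nx]; rewrite !patchE.
    - by case: ifP => // _; exact: leey.
    - by case: ifP => // _; rewrite inve_ge0 lee_fin powR_ge0.
    case: ifPn => [/set_mem[Zx Qx]|_].
      rewrite mem_set// vE// Zx powR0 ?gt_eqF// inver eqxx//.
    by case: ifP => // _; rewrite inve_ge0 lee_fin powR_ge0.
  have ba0 : 0 < b / a' by exact: divr_gt0.
  rewrite I2y gt0_muley// poweRyr ?gt_eqF// gt0_muley; last exact: mule_gt0.
  by rewrite leye_eq => /eqP AE; rewrite AE ltxx in Aoo.
have mono j k (P : set 'rV[R]_n) : (j <= k)%N -> measurable P ->
    mu (P `&` central_cube k) = 0%E -> mu (P `&` central_cube j) = 0%E.
  move=> jk mP k0; apply: (subset_measure0 _ _ _ k0).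
  - exact: measurableI.
  - exact: measurableI.
  - by apply: setIS; exact: central_cubeS.
have [ZQ|/existsNP[k kZ]] := pselect (forall k, mu (Z `&` central_cube k) = 0%E).
  by left; exact: null_central_cubes.
right; apply: null_central_cubes => // j.
have [zk|zk] := one (maxn j k); last exact: (mono _ _ _ (leq_maxl j k)).
by case: kZ; exact: (mono _ _ _ (leq_maxr j k)).
Qed.

End weights.


(** * The bound for the operator *)

Section domination.
Local Open Scope classical_set_scope.
Context {R : realType} {n : nat}.
Local Notation mu := (lebesgue_rV R n).

Definition zero_on (N : set 'rV[R]_n) (f : 'rV[R]_n -> R) : 'rV[R]_n -> R :=
  fun x => if x \in N then 0 else f x.

Lemma zero_onE N f x : ~ N x -> zero_on N f x = f x.
Proof. by move=> Nx; rewrite /zero_on memNset. Qed.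

Lemma lebesgue_nullU (A B : set 'rV[R]_n) : measurable A -> measurable B ->
  mu A = 0%E -> mu B = 0%E -> mu (A `|` B) = 0%E.
Proof. by move=> mA mB A0 B0; exact: (null_set_setU (mu := mu) mA mB A0 B0). Qed.

(** [K] and [f] are changed on null sets, which reflections map to null
    sets, and the substitution y -> x - y moves the translation from the
    kernel to the function. *)
Lemma convolution_operator_le (K f : 'rV[R]_n -> R) (NK Nf : set 'rV[R]_n) x :
  measurable NK -> mu NK = 0%E -> measurable Nf -> mu Nf = 0%E ->
  measurable_fun [set: 'rV[R]_n] (zero_on NK K : _ -> measurableTypeR R) ->
  measurable_fun [set: 'rV[R]_n] (zero_on Nf f : _ -> measurableTypeR R) ->
  (`|convolution_operator K f x| <=
    \int[mu]_z (`|zero_on NK K z| * `|zero_on Nf f (x - z)|)%:E)%E.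
Proof.
move=> mNK NK0 mNf Nf0 mK mf; apply: (le_trans (abse_integral_le _ _)).
have refl : measurable_fun [set: 'rV[R]_n] (fun y => x - y) by exact: measurable_reflect.
have mh : measurable_fun [set: 'rV[R]_n]
    (fun z => (`|zero_on NK K z| * `|zero_on Nf f (x - z)|)%:E).
  apply/measurable_EFinP; apply: measurable_funM; first exact: measurableT_comp.
  have mfx : measurable_fun [set: 'rV[R]_n]
      ((fun z => zero_on Nf f (x - z)) : _ -> measurableTypeR R).
    exact: (measurableT_comp (f := zero_on Nf f : _ -> measurableTypeR R)).
  by apply: measurableT_comp.
have h0 z : (0 <= (`|zero_on NK K z| * `|zero_on Nf f (x - z)|)%:E)%E.
  by rewrite lee_fin mulr_ge0.
rewrite -(ge0_integral_reflect x mh h0).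
pose N := (fun y => x - y) @^-1` NK `|` Nf.
have mNx : measurable ((fun y => x - y) @^-1` NK).
  by rewrite -[X in measurable X]setTI; exact: refl.
have mN : measurable N by exact: measurableU.
have N0 : mu N = 0%E.
  have K0 : mu ((fun y => x - y) @^-1` NK) = 0%E by rewrite lebesgue_rV_reflect.
  exact: (lebesgue_nullU mNx mNf K0 Nf0).
apply: (le_integral_null mN N0) => // y Ny.
rewrite subKr !zero_onE; last 2 first.
- by move=> ?; apply: Ny; right.
- by move=> ?; apply: Ny; left.
by rewrite /= normrM.
Qed.

End domination.

Theorem theorem1p10 (R : realType) (n : nat) (alpha r p q : R)
    (K : 'rV[R]_n -> R) :
  0 < alpha < n%:R -> 1 <= r < p -> p < n%:R / alpha ->
  q^-1 = p^-1 - alpha / n%:R ->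
  size_condition alpha (hoelder_conjugate r%:E) K ->
  hormander_condition alpha (hoelder_conjugate r%:E) K ->
  exists2 c : R, 0 < c &
    forall w f : 'rV[R]_n -> R,
      weight w -> A_class (p / r) (q / r) (fun x => w x `^ r) -> Linfty_c f ->
      (weighted_norm q (fun x => w x `^ q)%R (convolution_operator K f) <=
       c%:E *
       A_const (p / r) (q / r) (fun x => w x `^ r)%R `^
         (Num.max (1 - alpha / n%:R)
            (fine (hoelder_conjugate (p / r)%:E) / q *
              (1 - alpha * r / n%:R)))%R *
       weighted_norm p (fun x => w x `^ p)%R (EFin \o f))%E.
Proof.
move=> /andP[alpha0 an] /andP[r1 rp] pn qE [mK size] _.
have r0 : 0 < r by exact: lt_le_trans r1.
have p0 : 0 < p by exact: lt_trans rp.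
have nR : 0 < n%:R :> R by exact: lt_trans an.
have n0 : (0 < n)%N by rewrite -(ltr_nat R).
have q0 : 0 < q.
  rewrite -invr_gt0 qE subr_gt0 -invf_div ltf_pV2 ?posrE//.
  exact: divr_gt0.
have pr1 : 1 < p / r by rewrite ltr_pdivlMr// mul1r.
have qr0 : 0 < q / r by exact: divr_gt0.
have [NK [mNK NK0] mKb] := borel_version mK.
have [C0 C00 kernel] := shell_kernel_bound an r1 mNK NK0 mKb size.
have [C CC0 HC] := positive_weight_bound n0 alpha0 r1 rp q0 qE C00 mKb
  (fun t g t0 mg g0 => kernel t g t0 mg g0).
exists C => // w f [w0 mw _] Aw [mf [B fB] _].
have pr0 : 0 < p - r by rewrite subr_gt0.
pose e := (r^-1 - p^-1)^-1.
have eE : e = r * p / (p - r).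
  rewrite /e (_ : r^-1 - p^-1 = (p - r) / (r * p)) ?invf_div//.
  by field; rewrite !gt_eqF.
have e0 : 0 < e by rewrite eE divr_gt0// mulr_gt0.
have aE : p / r / (p / r - 1) = e / r.
  by rewrite eE; field; rewrite !gt_eqF.
have [Nw [mNw Nw0] mwb] := borel_version mw.
have [Nf [mNf Nf0] mfb] := borel_version mf.
have wb0 (x : 'rV[R]_n) : 0 <= zero_on Nw w x by rewrite /zero_on; case: ifP.
(* The zero set of the weight, which is null unless its complement is. *)
pose Z := [set x : 'rV[R]_n | zero_on Nw w x = 0]%classic.
have mZ : measurable Z.
  rewrite (_ : Z = (zero_on Nw w @^-1` [set 0])%classic); last by apply/seteqP; split.
  by rewrite -[X in measurable X]setTI; exact: mwb.
have wrE (x : 'rV[R]_n) : ~ Nw x -> w x `^ r = zero_on Nw w x `^ r by move=> /zero_onE ->.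
have LHS0 (x : 'rV[R]_n) :
    (0 <= `|convolution_operator K f x| `^ q * (w x `^ q)%:E)%E.
  by rewrite mule_ge0 ?poweR_ge0// lee_fin powR_ge0.
have RHSc : (0 <= C%:E * A_const (p / r) (q / r) (fun x => w x `^ r)%R `^
    (Num.max (1 - alpha / n%:R) (fine (hoelder_conjugate (p / r)%:E) / q *
      (1 - alpha * r / n%:R)))%R)%E.
  by rewrite mule_ge0 ?poweR_ge0// lee_fin ltW.
have mwr : measurable_fun [set: 'rV[R]_n]
    ((fun x : 'rV[R]_n => zero_on Nw w x `^ r) : _ -> measurableTypeR R).
  exact: measurable_fun_powRl.
have := @A_class_zero_or_positive R n (p / r) (q / r) (fun x => w x `^ r)
  (fun x : 'rV[R]_n => zero_on Nw w x `^ r) Nw pr1 qr0 mNw Nw0 mwr (fun x => powR_ge0 _ _) wrE Aw.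
have -> : [set x : 'rV[R]_n | zero_on Nw w x `^ r = 0]%classic = Z.
  apply/seteqP; split => x /=; last by rewrite /Z /= => ->; rewrite powR0// gt_eqF.
  by move/eqP; rewrite powR_eq0 => /andP[/eqP].
have -> : [set x : 'rV[R]_n | zero_on Nw w x `^ r != 0]%classic = (~` Z)%classic.
  apply/seteqP; split => x /=; first by rewrite powR_eq0 (gt_eqF r0) andbT => /eqP.
  by move=> /eqP h; rewrite powR_eq0 negb_and h.
(* If the weight vanishes almost everywhere, so does the left-hand side. *)
case=> [Z0|ZC0]; last first.
  have I0 : (\int[lebesgue_rV R n]_x (`|convolution_operator K f x| `^ q * (w x `^ q)%:E) = 0)%E.
    apply/eqP; rewrite eq_le integral_ge0// andbT.
    have mN : measurable (~` Z `|` Nw)%classic by apply: measurableU => //; exact: measurableC.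
    have N0 : lebesgue_rV R n (~` Z `|` Nw)%classic = 0%E.
      by apply: lebesgue_nullU => //; exact: measurableC.
    rewrite -[leRHS](integral0 (lebesgue_rV R n) setT).
    apply: (le_integral_null mN N0) => // x /not_orP[/= /contrapT Zx Nx].
    by rewrite -(zero_onE w Nx) Zx powR0 ?gt_eqF// mule0.
  rewrite {1}/weighted_norm I0 poweR0r ?invr_eq0 ?gt_eqF//.
  by rewrite mule_ge0// poweR_ge0.
(* A positive Borel function equal to the weight off the null set Z. *)
pose W (x : 'rV[R]_n) := zero_on Nw w x + \1_Z x.
have mW : measurable_fun [set: 'rV[R]_n] (W : _ -> measurableTypeR R).
  by apply: measurable_funD => //; exact: measurable_indic.
have W0 (x : 'rV[R]_n) : 0 < W x.
  rewrite /W indicE; have [/set_mem ->|] := boolP (x \in Z); first by rewrite add0r.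
  by rewrite notin_setE => /eqP Zx; rewrite addr0 lt_neqAle eq_sym Zx wb0.
have WE (x : 'rV[R]_n) : ~ Z x -> w x = W x.
  move=> Zx; rewrite /W indicE memNset// addr0 zero_onE// => Nx.
  by apply: Zx; rewrite /Z /= /zero_on mem_set.
have Afin (c : 'rV[R]_n) (l : R) : 0 < l ->
    ((lebesgue_rV R n (cube c l))^-1 * \int[lebesgue_rV R n]_(x in cube c l) (W x `^ q)%:E *
     ((lebesgue_rV R n (cube c l))^-1 * \int[lebesgue_rV R n]_(x in cube c l) (W x `^ (- e))%:E) `^ (q / e)
    <= A_const (p / r) (q / r) (fun x => w x `^ r)%R)%E.
  move=> l0; have := A_const_ge (q / r) (fun x => w x `^ r) pr1 c l0.
  rewrite aE.
  have -> : q / r / (e / r) = q / e by field; rewrite !gt_eqF.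
  have -> : (\int[lebesgue_rV R n]_(x in cube c l) ((w x `^ r) `^ (q / r))%:E =
      \int[lebesgue_rV R n]_(x in cube c l) (W x `^ q)%:E)%E.
    apply: (eq_integral_nullD mZ Z0) => [x|x|x Zx _]; rewrite ?lee_fin ?powR_ge0//.
    by rewrite -powRrM mulrC divfK ?gt_eqF// WE.
  have -> : (\int[lebesgue_rV R n]_(x in cube c l) (((w x `^ r) `^ (e / r))%:E)^-1 =
      \int[lebesgue_rV R n]_(x in cube c l) (W x `^ (- e))%:E)%E.
    apply: (eq_integral_nullD mZ Z0) => [x|x|x Zx _].
    - by rewrite inve_ge0 lee_fin powR_ge0.
    - by rewrite lee_fin powR_ge0.
    by rewrite -powRrM mulrC divfK ?gt_eqF// WE// inver gt_eqF ?powR_gt0// powRN.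
  by [].
move: Aw Afin RHSc; rewrite /A_class; set AA := A_const _ _ _ => Aoo Afin RHSc.
have AAfin : AA \is a fin_num.
  rewrite ge0_fin_numE//; apply: le_trans (Afin 0 1 ltr01).
  by rewrite !mule_ge0 ?poweR_ge0// ?inve_ge0 ?measure_ge0//;
     apply: integral_ge0 => x _; rewrite lee_fin powR_ge0.
move: Afin RHSc; rewrite -(fineK AAfin); move: (fine AA) => A muckW RHSc.
have A0 : 0 < A.
  have [I1 J1 I2 J2 ] := cube_integrals mW W0 q0 e0 muckW 0 ltr01.
  rewrite expr1n !divr1 => /(lt_le_trans _); apply.
  by rewrite mulr_gt0 ?powR_gt0// fine_gt0// ?I1 ?I2.
pose G (x : 'rV[R]_n) := `|zero_on Nf f x|.
have mG : measurable_fun [set: 'rV[R]_n] (G : _ -> measurableTypeR R).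
  by apply: measurableT_comp.
have G0 (x : 'rV[R]_n) : 0 <= G x by exact: normr_ge0.
have GB (x : 'rV[R]_n) : G x <= B.
  rewrite /G /zero_on; case: ifP => _; last exact: fB.
  by rewrite normr0 (le_trans _ (fB x)).
have normE : (weighted_norm p (fun x => w x `^ p)%R (EFin \o f) =
    (\int[lebesgue_rV R n]_x (G x `^ p * W x `^ p)%:E) `^ p^-1)%E.
  have mN : measurable (Z `|` Nf)%classic by exact: measurableU.
  have N0 : lebesgue_rV R n (Z `|` Nf)%classic = 0%E by exact: lebesgue_nullU.
  rewrite /weighted_norm; congr (_ `^ _)%E.
  apply: (eq_integral_nullD mN N0) => [x|x|x /not_orP[Zx Nx] _].
  - by rewrite mule_ge0 ?poweR_ge0// lee_fin powR_ge0.
  - by rewrite lee_fin mulr_ge0 ?powR_ge0.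
  - by rewrite /G zero_onE// WE.
have X0 : (0 <= \int[lebesgue_rV R n]_x (G x `^ p * W x `^ p)%:E)%E.
  by apply: integral_ge0 => x _; rewrite lee_fin mulr_ge0 ?powR_ge0.
(* The bound is trivial when the norm of f is infinite, since A > 0. *)
have [Xoo|Xfin] := eqVneq (\int[lebesgue_rV R n]_x (G x `^ p * W x `^ p)%:E)%E +oo%E.
  rewrite normE Xoo poweRyr ?invr_eq0 ?gt_eqF// gt0_muley ?leey//.
  by rewrite poweR_EFin -EFinM lte_fin mulr_gt0// powR_gt0.
have XE : (\int[lebesgue_rV R n]_x (G x `^ p * W x `^ p)%:E =
    (fine (\int[lebesgue_rV R n]_x (G x `^ p * W x `^ p)%:E))%:E)%E.
  by rewrite fineK// ge0_fin_numE// ltey.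
have main := HC W G A _ B mW W0 mG G0 GB muckW XE.
rewrite normE XE; move: main; move: (fine _) (fine_ge0 X0) => X XX0 main.
rewrite {1}/weighted_norm.
(* With e = r (p/r)', the identity (p/r)' (1 - alpha r / n) = 1 + e / q. *)
have exponents : Num.max (1 - alpha / n%:R)
    (fine (hoelder_conjugate (p / r)%:E) / q * (1 - alpha * r / n%:R)) =
    Num.max ((1 + (q / e)^-1) / q) (q^-1 + (1 - p^-1)).
  rewrite maxC hoelder_conjugateE//= aE; congr Num.max; last by rewrite qE; ring.
  have -> : alpha * r / n%:R = r * (p^-1 - q^-1) by rewrite qE; ring.
  by rewrite eE; field; rewrite !gt_eqF.
rewrite exponents !poweR_EFin -!EFinM.
set J := C * _ * _ in main *.
have J0 : 0 <= J by rewrite !mulr_ge0 ?powR_ge0// ltW.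
rewrite -[J](powRVK q0 J0) -poweR_EFin; apply: lee_poweRl.
- by rewrite invr_ge0 ltW.
- by apply: integral_ge0 => x _; exact: LHS0.
apply: le_trans main; apply: (le_integral_null mZ Z0) => [x|x|x Zx].
- exact: LHS0.
- by rewrite mule_ge0 ?poweR_ge0// lee_fin powR_ge0.
rewrite WE//; apply: lee_wpmul2r; first by rewrite lee_fin powR_ge0.
apply: lee_poweRl; [exact: ltW|exact: abse_ge0|].
exact: convolution_operator_le.
Qed.
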